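(* Let $r\ge2$ and assume that the rank $r-1$ irregular vector $v_0=|I^{(r-1)}\rangle$ is normalized to satisfy its full lower Virasoro deformation equations. Let $W=|\widetilde I^{(r-1/2)}\rangle$ be the canonical half-integer-rank vector, i.e. the unique formal series $$W=\Lambda_{2r-1}^{\nu}\exp\left(\sum_{j=1}^{r-1}\frac{g_j}{\Lambda_{2r-1}^j}\right)\sum_{k\ge0}\Lambda_{2r-1}^kv_k,\qquad \nu,g_j\in\mathcal A,\ v_k\in M_{\mathcal A},$$ with the given $v_0$, satisfying $L_*W=\Lambda_{2r-1}^r\frac{\partial}{\partial\Lambda_{2r-1}}W$ and $L_nW=\Lambda_nW$ for $r\le n\le 2r-1$. Then there exists a non-zero scalar formal function $f=f(c_0,c_1,\ldots,c_{r-1})$ such that $|I^{(r-1/2)}\rangle:=fW$ satisfies $$R_i|I^{(r-1/2)}\rangle=0,\qquad 0\le i\le r-1,$$ equivalently $L_i|I^{(r-1/2)}\rangle=\mathcal L_i|I^{(r-1/2)}\rangle$ for $0\le i\le r-1$. The function $f$ is unique up to multiplication by a non-zero function of $c_0$.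
   Context: Virasoro algebra: $\mathrm{Vir}=\bigoplus_{n\in\mathbb Z}\mathbb C L_n\oplus\mathbb C\mathbf c$, $[L_m,L_n]=(m-n)L_{m+n}+\frac{\mathbf c}{12}(m^3-m)\delta_{m+n,0}$, with $\mathbf c$ acting by $1+6Q^2$. $Q,c_0,c_1,\ldots,c_{r-1},\Lambda_{2r-1}$ are independent parameters; $c_a=0$ for $a<0$ or $a>r-1$; $\Delta_a=a(Q-a)$. Weights: $\Lambda_n=-\sum_{p+q=n,\,1\le p,q\le r-1}c_pc_q$ for $r\le n\le 2r-2$; $\Lambda_{2r-1}$ is an independent parameter; $\Lambda_n=0$ for $n>2r-1$. Write $S_n=\Lambda_n$ for $n\ge r$. Put $\Lambda'_n=((n+1)Q-2c_0)c_n-\sum_{p+q=n,\,1\le p,q\le r-1}c_pc_q$ for $n\ge1$ (with $c_n=0$ for $n\ge r$). Coefficient rings: $\mathcal A=\mathbb C(Q,c_0)[c_1,\ldots,c_{r-1},c_{r-1}^{-1}]$ and $\mathcal A_{\mathrm{Laur}}=\mathbb C(Q,c_0)[c_1^{\pm1},\ldots,c_{r-1}^{\pm1}]$. $M_{\mathcal A}$ is the rank $r-1$ irregular Verma module over $\mathcal A$: induced from the subalgebra generated by $L_n$ ($n\ge r-1$) and $\mathbf c$ acting on $\mathcal Av_0$ by $L_nv_0=\Lambda'_nv_0$ ($n\ge r-1$); PBW basis $L_{-\lambda_1+r-1}\cdots L_{-\lambda_\ell+r-1}v_0$ over partitions $\lambda$. Full lower deformation equations of $v_0$: with $\mathcal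 D^{(r-1)}_n=\sum_{k=1}^{r-1-n}kc_{n+k}\partial_{c_k}$, they read $L_0v_0=(\Delta_{c_0}+\mathcal D^{(r-1)}_0)v_0$ and $L_iv_0=(\Lambda'_i+\mathcal D^{(r-1)}_i)v_0$ for $1\le i\le r-2$. Action of parameter derivatives on vectors: $\partial_{c_j}$ ($1\le j\le r-1$) acts on $M_{\mathcal A}$ by the Leibniz rule over $\mathcal A$, commutes with the PBW generators $L_p$ ($p<r-1$), and $\partial_{c_j}v_0$ is determined by the equations just displayed (the $\mathcal D^{(r-1)}_n$, $0\le n\le r-2$, form a frame after inverting $c_{r-1}$). $\partial_{\Lambda_{2r-1}}$ annihilates $M_{\mathcal A}$. On formal series with prefactor $P=\Lambda_{2r-1}^\nu\exp(\sum_jg_j/\Lambda_{2r-1}^j)$ derivatives act by the Leibniz rule with $\partial P=(\partial\log P)P$. Vector fields: $\mathcal V_0=\sum_{k=1}^{r-1}kc_k\partial_{c_k}+(2r-1)\Lambda_{2r-1}\partial_{\Lambda_{2r-1}}$; for $1\le n\le r-1$, $\mathcal V_n=\sum_{k=1}^{r-n}h_{n,k}\partial_{c_k}$ is the unique rational vector field of this form with $\mathcal V_n(S_m)=(m-n)S_{m+n}$ for $r\le m\le 2r-1$. The $r\times r$ matrix $\mathcal M$ is defined by $(\mathcal V_0,\ldots,\mathcal V_{r-1})^{\mathsf T}=\mathcal M(\partial_{c_1},\ldots,\partial_{c_{r-1}},\partial_{\Lambda_{2r-1}})^{\mathsf T}$; it is invertible after inverting $c_{r-1}$ and $\Lambda_{2r-1}$.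 $L_*=\Lambda_{2r-1}^r\sum_{m=0}^{r-1}(\mathcal M^{-1})_{r,m+1}L_m$. Completed differential operators in the $L_*$-gauge: scalar functions $\sigma_0,\ldots,\sigma_{r-1}$ in the localized formal coefficient ring $\mathcal A_{\mathrm{Laur}}((\Lambda_{2r-1}))$ are fixed such that, with $\mathcal L_i=\sigma_i+\mathcal V_i$ ($0\le i\le r-1$) and $\mathcal L_m=S_m$ ($m\ge r$; so $\mathcal L_N=0$ for $N>2r-1$), one has $[\mathcal L_m,\mathcal L_n]=(n-m)\mathcal L_{m+n}$ for all $m,n\ge0$, and $\sum_{i=0}^{r-1}(\mathcal M^{-1})_{r,i+1}\sigma_i=0$ (such a choice exists). Finally $R_n=L_n-\mathcal L_n$ for $n\ge0$. Scalar formal function of $c_0,c_1,\ldots,c_{r-1}$: a formal exponential $f=e^h$ (with $\partial f=(\partial h)f$), where $dh$ is a closed one-form in $c_1,\ldots,c_{r-1}$ with coefficients in $\mathcal A_{\mathrm{Laur}}$ (logarithmic terms in $h$ allowed); $f$ does not depend on $\Lambda_{2r-1}$. *)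

(* Defs.v *)
From HB Require Import structures.
From mathcomp Require Import all_boot all_order all_algebra.
From mathcomp Require Import boolp classical_sets functions cardinality fsbigop reals.
From mathcomp Require Import complex mpoly zify ring.

Set Implicit Arguments.
Unset Strict Implicit.
Unset Printing Implicit Defensive.

Import Order.TTheory GRing.Theory Num.Theory.
Local Open Scope ring_scope.

(* Formal Laurent series in one variable (called Lambda below): functions     *)
(* int -> A whose support is bounded below.                                   *)
Section LaurentSeries.
Variable A : comNzRingType.

Record laurent := Laurent {
  lcoef :> int -> A;
  _ : exists N : int, forall n : int, n < N -> lcoef n = 0 }.

HB.instance Definition _ := gen_eqMixin laurent.
HB.instance Definition _ := gen_choiceMixin laurent.

Lemma lboundP (s : laurent) : exists N : int, forall n : int, n < N -> s n = 0.
Proof. by case: s. Qed.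

Lemma laurentP (s t : laurent) : (forall n, s n = t n) -> s = t.
Proof.
case: s t => [s hs] [t ht] /= st; have {}st : s = t by apply/funext.
by case: _ / st ht => ht; congr Laurent; exact: Prop_irrelevance.
Qed.

Definition lconv (a b : int -> A) (n : int) : A :=
  \sum_(m \in [set: int]) a m * b (n - m).

Definition ltrunc (N : int) (T : nat) (a : int -> A) : {poly A} :=
  \poly_(i < T) a (N + i%:Z).

Lemma lconvE (a b : int -> A) (N M : int) (k T : nat) : (k < T)%N ->
  (forall n, n < N -> a n = 0) -> (forall n, n < M -> b n = 0) ->
  lconv a b (N + M + k%:Z) = (ltrunc N T a * ltrunc M T b)`_k.
Proof.
move=> kT ha hb; rewrite coefM.
transitivity (\sum_(i < k.+1) a (N + i%:Z) * b (M + (k - i)%N%:Z)).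
  rewrite (fsbig_ord _ _ (fun i : nat => a (N + i%:Z) * b (M + (k - i)%N%:Z))).
  rewrite /lconv -(fsbig_widen ((fun i : nat => N + i%:Z) @` `I_k.+1)) //.
    rewrite fsbig_image; last by move=> i j _ _ /addrI [].
    apply: eq_fsbigr => i; rewrite inE /= => ik.
    by congr (_ * b _); lia.
  move=> m [_ /= hm]; have [mN|Nm] := ltP m N; first by rewrite ha ?mul0r.
  rewrite hb ?mulr0 //; rewrite ltNge; apply/negP => hM; apply: hm.
  exists `|m - N|%N => /=; lia.
apply: eq_bigr => i _; rewrite !coef_poly.
have := ltn_ord i; rewrite ltnS => ik.
by rewrite (leq_ltn_trans ik kT) (leq_ltn_trans (leq_subr _ _) kT).
Qed.

Lemma lconv_low (a b : int -> A) (N M : int) :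
  (forall n, n < N -> a n = 0) -> (forall n, n < M -> b n = 0) ->
  forall n, n < N + M -> lconv a b n = 0.
Proof.
move=> ha hb n nNM; apply: fsbig1 => m _.
have [mN|Nm] := ltP m N; first by rewrite ha ?mul0r.
by rewrite hb ?mulr0 //; lia.
Qed.

Definition lmon_fun (k : int) (a : A) (n : int) : A := if n == k then a else 0.

Fact lmon_bound k a : exists N : int, forall n : int, n < N -> lmon_fun k a n = 0.
Proof. by exists k => n nk; rewrite /lmon_fun lt_eqF. Qed.
(* a Lambda^k *)
Definition lmon k a := Laurent (lmon_bound k a).

Fact ladd_bound (s t : laurent) :
  exists N : int, forall n : int, n < N -> s n + t n = 0.
Proof.
have [N hN] := lboundP s; have [M hM] := lboundP t.
exists (Num.min N M) => n; rewrite lt_min => /andP[nN nM].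
by rewrite hN // hM // addr0.
Qed.
Definition ladd s t := Laurent (ladd_bound s t).

Fact lopp_bound (s : laurent) : exists N : int, forall n : int, n < N -> - s n = 0.
Proof. by have [N hN] := lboundP s; exists N => n nN; rewrite hN // oppr0. Qed.
Definition lopp s := Laurent (lopp_bound s).

Fact lmul_bound (s t : laurent) :
  exists N : int, forall n : int, n < N -> lconv s t n = 0.
Proof.
have [N hN] := lboundP s; have [M hM] := lboundP t.
by exists (N + M); exact: lconv_low.
Qed.
Definition lmul s t := Laurent (lmul_bound s t).

Fact laddA : associative ladd.
Proof. by move=> s t u; apply: laurentP => n /=; rewrite addrA. Qed.
Fact laddC : commutative ladd.
Proof. by move=> s t; apply: laurentP => n /=; rewrite addrC. Qed.
Fact ladd0 : left_id (lmon 0 0) ladd.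
Proof.
by move=> s; apply: laurentP => n /=; rewrite /lmon_fun; case: ifP; rewrite add0r.
Qed.
Fact laddN : left_inverse (lmon 0 0) lopp ladd.
Proof.
by move=> s; apply: laurentP => n /=; rewrite /lmon_fun; case: ifP; rewrite addNr.
Qed.
HB.instance Definition _ := GRing.isZmodule.Build laurent laddA laddC ladd0 laddN.

Lemma laurent_split (n N : int) : N <= n -> exists k : nat, n = N + k%:Z.
Proof. by move=> Nn; exists `|n - N|%N; lia. Qed.

Fact lmulC : commutative lmul.
Proof.
move=> s t; apply: laurentP => n /=.
have [N hN] := lboundP s; have [M hM] := lboundP t.
have [nl|/laurent_split [k ->]] := ltP n (N + M).
  by rewrite (lconv_low hN hM) // (lconv_low hM hN) // addrC.
rewrite (lconvE (ltnSn k) hN hM) [N + M]addrC.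
by rewrite (lconvE (ltnSn k) hM hN) mulrC.
Qed.

Lemma coefM_lt (p p' q : {poly A}) (k : nat) :
  (forall i, (i <= k)%N -> p`_i = p'`_i) -> (p * q)`_k = (p' * q)`_k.
Proof.
move=> pp'; rewrite !coefM; apply: eq_bigr => i _.
by rewrite pp' // -ltnS.
Qed.

Lemma ltrunc_lconv (a b : int -> A) (N M : int) (T i : nat) : (i < T)%N ->
  (forall n, n < N -> a n = 0) -> (forall n, n < M -> b n = 0) ->
  (ltrunc (N + M) T (lconv a b))`_i = (ltrunc N T a * ltrunc M T b)`_i.
Proof. by move=> iT ha hb; rewrite coef_poly iT; apply: lconvE. Qed.

Fact lmulA : associative lmul.
Proof.
move=> s t u; rewrite [RHS]lmulC; apply: laurentP => n /=.
have [N hN] := lboundP s; have [M hM] := lboundP t; have [P hP] := lboundP u.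
have hst := lconv_low hN hM; have htu := lconv_low hM hP.
have [nl|/laurent_split [k ->]] := ltP n (N + (M + P)).
  by rewrite (lconv_low hN htu) // (lconv_low hP hst) // addrC -addrA.
rewrite (lconvE (ltnSn k) hN htu) mulrC.
rewrite (coefM_lt (p' := ltrunc M k.+1 t * ltrunc P k.+1 u)); last first.
  by move=> i ik; apply: ltrunc_lconv.
rewrite (_ : N + (M + P) = P + (N + M)); last by rewrite addrA addrC.
rewrite (lconvE (ltnSn k) hP hst) [in RHS]mulrC.
rewrite [RHS](@coefM_lt _ (ltrunc N k.+1 s * ltrunc M k.+1 t)); last first.
  by move=> i ik; apply: ltrunc_lconv.
by congr (_`_k); rewrite mulrC mulrA.
Qed.

Fact lmul1 : left_id (lmon 0 1) lmul.
Proof.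
move=> s; apply: laurentP => n /=; rewrite /lconv.
rewrite -(fsbig_widen [set 0 : int]) //; last first.
  by move=> m [_ /= /eqP m0]; rewrite /lmon_fun (negbTE m0) mul0r.
by rewrite fsbig_set1 /lmon_fun eqxx mul1r subr0.
Qed.

Fact lmulDl : left_distributive lmul ladd.
Proof.
move=> s t u; apply: laurentP => n /=.
have [N1 h1] := lboundP s; have [N2 h2] := lboundP t.
have [M hM] := lboundP u; pose N := Num.min N1 N2.
have hs k : k < N -> s k = 0 by rewrite lt_min => /andP[/h1].
have ht k : k < N -> t k = 0 by rewrite lt_min => /andP[_ /h2].
have hst k : k < N -> s k + t k = 0 by move=> kN; rewrite hs // ht // addr0.
have [nl|/laurent_split [k ->]] := ltP n (N + M).
  by rewrite !(lconv_low _ hM nl) // addr0.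
rewrite !(@lconvE _ _ N M k k.+1) // -coefD -mulrDl.
apply: coefM_lt => i ik; rewrite coefD !coef_poly ltnS ik //.
Qed.

Fact lone_neq0 : lmon 0 1 != 0.
Proof.
apply/eqP => /(congr1 (fun s : laurent => s 0)) /=.
by rewrite /lmon_fun eqxx => /eqP; rewrite oner_eq0.
Qed.

HB.instance Definition _ := GRing.Zmodule_isComNzRing.Build laurent
  lmulA lmulC lmul1 lmulDl lone_neq0.

Definition lunit : pred laurent := fun s => `[< exists t, t * s = 1 >].
Definition linv (s : laurent) : laurent :=
  if pselect (exists t, t * s = 1) is left h then projT1 (cid h) else s.

Fact linvV : {in lunit, left_inverse 1 linv *%R}.
Proof.
move=> s sU; have hs : exists t, t * s = 1 by exact/asboolP.
by rewrite /linv; case: pselect => [h|[]//]; case: (cid h).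
Qed.
Fact lunitP : forall s t : laurent, t * s = 1 -> lunit s.
Proof. by move=> s t ts; apply/asboolP; exists t. Qed.
Fact linv0 : {in [predC lunit], linv =1 id}.
Proof.
move=> s sU; rewrite /linv; case: pselect => // h.
by case/negP: sU; apply/asboolP.
Qed.
HB.instance Definition _ :=
  GRing.ComNzRing_hasMulInverse.Build laurent linvV lunitP linv0.

Fact lmap_bound (D : A -> A) (D0 : D 0 = 0) (s : laurent) :
  exists N : int, forall n : int, n < N -> D (s n) = 0.
Proof. by have [N hN] := lboundP s; exists N => n nN; rewrite hN. Qed.
Definition lmap D D0 s := Laurent (@lmap_bound D D0 s).

Fact lderiv_bound (s : laurent) :
  exists N : int, forall n : int, n < N -> (n + 1)%:~R * s (n + 1) = 0.
Proof.
have [N hN] := lboundP s; exists (N - 1) => n nN.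
by rewrite hN ?mulr0 //; lia.
Qed.
(* d/dLambda *)
Definition lderiv s := Laurent (lderiv_bound s).

End LaurentSeries.

Section Irregular.
(* The parameters c_1, ..., c_{r-1} are indexed by 'I_r.-1: j stands for      *)
(* c_{j+1}. The list (c_1, ..., c_{r-1}, Lambda_{2r-1}) is indexed by the     *)
(* naturals j < r, j = r-1 being Lambda_{2r-1}.                               *)
Variables (R : realType) (r : nat).

(* C(Q, c_0) *)
Definition baseField : fieldType := {fraction {mpoly R[i][2]}}.
(* C(Q, c_0)(c_1, ..., c_{r-1}), which contains both coefficient rings        *)
Definition paramField : fieldType := {fraction {mpoly baseField[r.-1]}}.

Local Notation K := baseField.
Local Notation F := paramField.
Local Notation LF := (laurent paramField).

Definition polyF (p : {mpoly K[r.-1]}) : F := FracField.tofrac p.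
Definition baseF (k : K) : F := polyF (mpolyC r.-1 k).

Definition Q : F := baseF (FracField.tofrac 'X_(0 : 'I_2)).
Definition c0 : F := baseF (FracField.tofrac 'X_(1 : 'I_2)).
Definition cpar (k : nat) : F :=
  if k is k'.+1 then (if insub k' is Some j then polyF 'X_j else 0) else c0.

(* quotient rule, applied to the chosen representative *)
Definition fder (j : 'I_r.-1) (x : F) : F :=
  let u := repr (x : {fraction {mpoly K[r.-1]}}) in
  (polyF (mderiv j \n_u) * polyF \d_u - polyF \n_u * polyF (mderiv j \d_u))
    / polyF \d_u ^+ 2.

Lemma fder0 j : fder j 0 = 0.
Proof.
rewrite /fder; set u := repr _.
have -> : \n_u = 0.
  apply/eqP; rewrite FracField.numer0 reprK; apply/eqP.
  rewrite -[LHS](@tofrac0 {mpoly K[r.-1]}); unlock FracField.tofrac.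
  congr (\pi_({fraction {mpoly K[r.-1]}})%qT _); apply: val_inj.
  by rewrite /= val_insubd oner_neq0.
by rewrite raddf0 /polyF tofrac0 !mul0r subrr mul0r.
Qed.

(* Coefficients in A, resp. in A_Laur. *)
Definition inA (x : F) : Prop := exists p m, x = polyF p / cpar r.-1 ^+ m.
Definition inALaur (x : F) : Prop :=
  exists p m, x = polyF p / (\prod_(1 <= k < r) cpar k) ^+ m.

Definition quadc (n : nat) : F :=
  \sum_(1 <= p < r) \sum_(1 <= q < r | (p + q == n)%N) cpar p * cpar q.

Definition weight' (n : nat) : F := (n.+1%:R * Q - 2%:R * c0) * cpar n - quadc n.

Definition Delta (a : F) : F := a * (Q - a).

Definition Lambda : LF := lmon 1 1.

(* S_n = Lambda_n, only meaningful for n >= r *)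
Definition weightS (n : nat) : LF :=
  if (n <= 2 * r - 2)%N then lmon 0 (- quadc n)
  else if n == (2 * r - 1)%N then Lambda else 0.

Section Module.
Variables (M : lmodType F) (L : int -> {linear M -> M}) (v0 : M).

Definition is_partition (la : seq nat) : bool := sorted geq la && (0%N \notin la).

(* L_{-la_1+r-1} ... L_{-la_l+r-1} v_0 *)
Definition pbw (la : seq nat) : M :=
  foldr (fun k v => L (r.-1%:Z - k%:Z) v) v0 la.

(* the vectors whose PBW coordinates satisfy B *)
Definition pbw_span (B : F -> Prop) (m : M) : Prop :=
  exists (s : seq (seq nat)) (a : seq nat -> F),
    [/\ all is_partition s, forall la, B (a la)
      & m = \sum_(la <- s) a la *: pbw la].

Definition virasoro_action : Prop := forall (m n : int) (v : M),
  L m (L n v) - L n (L m v) =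
    (m - n)%:~R *: L (m + n) v
    + (if m + n == 0
       then ((1 + 6%:R * Q ^+ 2) / 12%:R * (m ^+ 3 - m)%:~R) *: v else 0).

(* M is the scalar extension to C(Q,c_0)(c_1..c_{r-1}) of the module induced  *)
(* from A v_0. The A-form M_A is the A-span of the PBW basis.                 *)
Record irregular_verma : Prop := {
  verma_vir : virasoro_action;
  verma_v0 : forall n : nat, (r.-1 <= n)%N -> L n%:Z v0 = weight' n *: v0;
  verma_span : forall m : M, pbw_span (fun=> True) m;
  verma_free : forall (s : seq (seq nat)) (a : seq nat -> F),
    uniq s -> all is_partition s -> \sum_(la <- s) a la *: pbw la = 0 ->
    forall la, la \in s -> a la = 0 }.

Definition in_MA : M -> Prop := pbw_span inA.

(* The derivations d/dc_{j+1} of M fixed by the full lower deformation        *)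
(* equations of v_0.                                                          *)
Record parameter_derivations (dM : 'I_r.-1 -> M -> M) : Prop := {
  pd_add : forall j (u v : M), dM j (u + v) = dM j u + dM j v;
  pd_leibniz : forall j (a : F) (v : M), dM j (a *: v) = fder j a *: v + a *: dM j v;
  pd_comm : forall j (p : int) (v : M), p < r.-1%:Z -> dM j (L p v) = L p (dM j v);
  pd_L0 : L 0 v0 = Delta c0 *: v0 + \sum_(j < r.-1) (j.+1%:R * cpar j.+1) *: dM j v0;
  pd_Li : forall i : nat, (1 <= i <= r - 2)%N ->
    L i%:Z v0 = weight' i *: v0
      + \sum_(j < r.-1 | (j.+1 <= r - 1 - i)%N) (j.+1%:R * cpar (i + j.+1)) *: dM j v0 }.

End Module.

(* j-th partial derivative on F((Lambda)) *)
Definition pder (j : nat) (s : LF) : LF :=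
  if insub j is Some k then lmap (fder0 k) s else lderiv s.

Section VectorFields.
(* h n k is the coefficient of d/dc_k in V_n *)
Variable h : nat -> nat -> LF.

Definition vf_coef (n j : nat) : LF :=
  if n is 0 then
    (if (j.+1 < r)%N then lmon 0 (j.+1%:R * cpar j.+1) else (2 * r - 1)%:R * Lambda)
  else if (j.+1 <= r - n)%N then h n j.+1 else 0.

Definition vfield (n : nat) (s : LF) : LF := \sum_(j < r) vf_coef n j * pder j s.

(* The solution is unique in F((Lambda)), and polynomial in Lambda, so        *)
(* rationality need not be imposed.                                           *)
Definition vf_equations : Prop := forall n m : nat,
  (1 <= n <= r - 1)%N -> (r <= m <= 2 * r - 1)%N ->
  vfield n (weightS m) = (m%:R - n%:R) * weightS (m + n).

(* r.-1.+1 is r *)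
Definition vf_matrix : 'M[LF]_(r.-1.+1) := \matrix_(i, j) vf_coef i j.

(* (M^{-1})_{r,m+1} *)
Definition inv_last (m : nat) : LF := invmx vf_matrix ord_max (inord m).

Definition Lstar_coef (m : nat) : LF := Lambda ^+ r * inv_last m.

Variable sigma : nat -> LF.

Definition calL_scalar (i : nat) (s : LF) : LF :=
  if (i < r)%N then sigma i * s + vfield i s else weightS i * s.

Record Lstar_gauge : Prop := {
  gauge_coef : forall i (n : int), (i < r)%N -> inALaur (sigma i n);
  gauge_comm : forall (m n : nat) (s : LF),
    calL_scalar m (calL_scalar n s) - calL_scalar n (calL_scalar m s)
    = (n%:R - m%:R) * calL_scalar (m + n) s;
  gauge_norm : \sum_(i < r) inv_last i * sigma i = 0 }.

(* A vector P * w is given by the derivatives of log P and by the body w,     *)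
(* where w a n is the coefficient of (log Lambda)^a Lambda^n. Logarithms      *)
(* arise when nu is differentiated in the c_j. Elements of                    *)
(* {poly F((Lambda))} are polynomials in log Lambda. All operators below      *)
(* are transported to bodies.                                                 *)

Section Vectors.
Variables (M : lmodType F) (L : int -> {linear M -> M}) (dM : 'I_r.-1 -> M -> M).

Definition lact (q : {poly LF}) (w : nat -> int -> M) : nat -> int -> M :=
  fun a n => \sum_(i < a.+1) \sum_(m \in [set: int]) (q`_i m) *: w (a - i)%N (n - m).

Definition Lact (p : int) (w : nat -> int -> M) : nat -> int -> M :=
  fun a n => L p (w a n).

Definition vder (j : nat) (w : nat -> int -> M) : nat -> int -> M :=
  fun a n =>
    if insub j is Some k then dM k (w a n)
    else (n + 1)%:~R *: w a (n + 1) + a.+1%:R *: w a.+1 (n + 1).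

Definition nabla (dlogP : nat -> {poly LF}) (j : nat) (w : nat -> int -> M) :=
  vder j w + lact (dlogP j) w.

Definition Lstar (w : nat -> int -> M) : nat -> int -> M :=
  \sum_(m < r) lact (Lstar_coef m)%:P (Lact m%:Z w).

Definition calL (dlogP : nat -> {poly LF}) (i : nat) (w : nat -> int -> M) :=
  if (i < r)%N then
    lact (sigma i)%:P w + \sum_(j < r) lact (vf_coef i j)%:P (nabla dlogP j w)
  else lact (weightS i)%:P w.

Definition Rop (dlogP : nat -> {poly LF}) (i : nat) (w : nat -> int -> M) :=
  Lact i%:Z w - calL dlogP i w.

Definition power_series (v : nat -> M) : nat -> int -> M :=
  fun a n => if (a, n) is (0%N, Posz k) then v k else 0.

End Vectors.
End VectorFields.

(* j-th partial derivative on polynomials in log Lambda *)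
Definition lpder (j : nat) (q : {poly LF}) : {poly LF} :=
  map_poly (pder j) q + (if (j < r.-1)%N then 0 else lmon (-1) 1 *: q^`()).

(* nu log Lambda + sum_j g_j / Lambda^j *)
Definition logP (nu : F) (g : nat -> F) : {poly LF} :=
  lmon 0 nu *: 'X + (\sum_(1 <= j < r) lmon (- j%:Z) (g j))%:P.

Definition dlog_prefactor (nu : F) (g : nat -> F) (j : nat) : {poly LF} :=
  lpder j (logP nu g).

(* W = P * sum_k Lambda^k v_k as in the definition of the canonical vector    *)
Record canonical_vector (h : nat -> nat -> LF) (M : lmodType F)
    (L : int -> {linear M -> M}) (v0 : M) (dM : 'I_r.-1 -> M -> M)
    (nu : F) (g : nat -> F) (v : nat -> M) : Prop := {
  cv_nu : inA nu;
  cv_g : forall j, (1 <= j < r)%N -> inA (g j);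
  cv_v : forall k, in_MA L v0 (v k);
  cv_v0 : v 0%N = v0;
  cv_Lstar : Lstar h L (power_series v)
    = lact (Lambda ^+ r)%:P
        (nabla dM (dlog_prefactor nu g) r.-1 (power_series v));
  cv_Ln : forall n : nat, (r <= n <= 2 * r - 1)%N ->
    Lact L n%:Z (power_series v) = lact (weightS n)%:P (power_series v) }.

(* kappa * e^h with kappa in C(Q,c_0), where dh = sum_j (ff_dh j) dc_{j+1}.   *)
(* One primitive h of each closed form dh is fixed; other primitives differ   *)
(* by functions of c_0, which are accounted for by kappa.                     *)
Record formal_function := FormalFunction {
  ff_const : K;
  ff_dh : 'I_r.-1 -> F;
  _ : forall j, inALaur (ff_dh j);
  _ : forall i j, fder i (ff_dh j) = fder j (ff_dh i) }.

Definition ff_scale (k : K) (f : formal_function) : formal_function :=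
  let: FormalFunction k' dh hL hc := f in FormalFunction (k * k') hL hc.

Definition ff_nonzero (f : formal_function) : Prop := ff_const f != 0.

Definition ff_dlog (f : formal_function) (j : nat) : {poly LF} :=
  if insub j is Some k then (lmon 0 (ff_dh f k))%:P else 0.

(* e^h P and kappa * w, for f = kappa * e^h *)
Definition ff_prefactor (f : formal_function) (dlogP : nat -> {poly LF}) (j : nat) :=
  ff_dlog f j + dlogP j.
Definition ff_body (f : formal_function) (M : lmodType F) (w : nat -> int -> M) :=
  fun a n => baseF (ff_const f) *: w a n.

End Irregular.

(* Main.v *)
Require Import Defs.
From HB Require Import structures.
From mathcomp Require Import all_boot all_order all_algebra perm.
From mathcomp Require Import boolp classical_sets functions cardinality fsbigop reals.
From mathcomp Require Import complex mpoly zify ring.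

(** Put [R_n = L_n - calL_n]. The gauge relations make [R_m, R_n] = (m - n) R_(m+n)
    up to the curvature of the prefactor, and [R_n] is linear over Laurent series for n >= r.
    The equation of [L_*] says that a combination R_* of R_0, ..., R_(r-1) kills W; commuting
    it with R_r, ..., R_(2r-1) gives R_(2r) W = 0, which brackets of these operators do not
    reach, and then brackets give R_n W = 0 for every n >= r. Hence each R_i W is a
    Whittaker vector, and since the Whittaker vectors of M for the L_n with n >= r are the
    multiples of v_0 (on symbols L_(r-1+k) - Lambda'_(r-1+k) is 2k Lambda'_(2r-2) times the
    derivative in L_(r-1-k)), R_i W = rho_i W. The rho_i are the values on V_0, ..., V_(r-1)
    of a one-form, which the commutators show to be closed up to the term
    d nu / Lambda_(2r-1) coming from the logarithm in the prefactor, and R_* W = 0 says that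
    it has no Lambda_(2r-1) component. A derivative has no residue, so d nu = 0 and the form
    is a closed form in the c_k alone; its exponential is f. *)

Set Implicit Arguments.
Unset Strict Implicit.
Unset Printing Implicit Defensive.

Import Order.TTheory GRing.Theory Num.Theory.
Local Open Scope ring_scope.

(** * Laurent series with coefficients in a module *)

Section LaurentModule.
Variable A : comNzRingType.

(** The Whittaker argument runs over the field [paramField], so it says nothing about denominators,
    while f needs a form with coefficients in A_Laur. Hence a lattice accompanies it: the vectors
    with PBW coordinates in A_Laur are stable under all [L p] and [dM j], the v_0-coordinate keeps
    the eigenvalues in that ring, and the linear systems to be solved have on their antidiagonals
    units of A_Laur or Lambda times such units. A second obstacle is that [dM j] is only given to
    commute with the lower generators, and nothing is given about [dM j] and [dM k]. Both kinds of
    commutation are derived from L_n v_0 = (Lambda'_n + D_n) v_0 and a cocycle identity of the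
    weights along the D_n. For series, the weight of index 2r-1 is Lambda instead of Lambda'_(2r-1)
    = 0. Multiplication by Lambda raises the order, so it is invisible at the lowest coefficient of
    a series, which is therefore a Whittaker vector of M. Existence and uniqueness of f come from a
    single equivalence: fW is annihilated exactly when d log f is the form that was found. *)

Definition lbounded (M : lmodType A) (w : int -> M) : Prop :=
  exists N : int, forall n : int, n < N -> w n = 0.

Definition ract (M : lmodType A) (a : int -> A) (w : int -> M) (n : int) : M :=
  \sum_(m \in [set: int]) a m *: w (n - m).

(** The length [T] is free above a threshold, so that several convolutions can be cut at the same
    length and compared term by term. *)
Lemma ractE (M : lmodType A) (a : int -> A) (w : int -> M) (N n : int) (T : nat) :
  (forall m, m < N -> a m = 0) -> (forall m, m <= n - N - T%:Z -> w m = 0) ->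
  ract a w n = \sum_(i < T) a (N + i%:Z) *: w (n - N - i%:Z).
Proof.
move=> ha hw; rewrite (fsbig_ord _ _ (fun i : nat => a (N + i%:Z) *: w (n - N - i%:Z))).
rewrite /ract -(fsbig_widen ((fun i : nat => N + i%:Z) @` `I_T)) //.
  rewrite fsbig_image; last by move=> i j _ _ /addrI [].
  by apply: eq_fsbigr => i _; congr (_ *: w _); lia.
move=> m [_ /= hm]; have [mN|Nm] := ltP m N; first by rewrite ha ?scale0r.
rewrite hw ?scaler0 // leNgt; apply/negP => hM; apply: hm.
by exists `|m - N|%N => /=; lia.
Qed.

Lemma ract_bounded (M : lmodType A) (a : int -> A) (w : int -> M) (N P : int) :
  (forall m, m < N -> a m = 0) -> (forall m, m < P -> w m = 0) ->
  forall n, n < N + P -> ract a w n = 0.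
Proof.
move=> ha hw n nNP; rewrite (@ractE _ _ _ N n 0) ?big_ord0 // => m hm.
by apply: hw; lia.
Qed.

Lemma ract_assoc (M : lmodType A) (a b : int -> A) (w : int -> M) (N P S : int) :
  (forall m, m < N -> a m = 0) -> (forall m, m < P -> b m = 0) ->
  (forall m, m < S -> w m = 0) ->
  forall n, ract (@lconv A a b) w n = ract a (ract b w) n.
Proof.
(* For n >= N + P + S this counts the indices that contribute; otherwise the absolute value still
   gives a length beyond which all terms vanish. *)
move=> ha hb hw n; pose T := absz (n - N - P - S + 1).
rewrite (@ractE _ _ _ (N + P) _ T); last 2 first.
- exact: lconv_low.
- by move=> m hm; apply: hw; lia.
rewrite (@ractE _ a _ N _ T) //; last first.
  by move=> m hm; apply: (ract_bounded hb hw); lia.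
transitivity (\sum_(k < T) \sum_(i < T)
    a (N + i%:Z) *: (b (P + k%:Z - i%:Z) *: w (n - (N + P) - k%:Z))).
  apply: eq_bigr => k _.
  have -> : lconv a b (N + P + k%:Z) = \sum_(i < T) a (N + i%:Z) * b (P + k%:Z - i%:Z).
    rewrite -[LHS]/(@ract A^o a b _) (@ractE _ _ _ N _ T) //.
      by apply: eq_bigr => i _; congr (_ * b _); lia.
    by move=> m hm; apply: hb; have := ltn_ord k; lia.
  by rewrite scaler_suml; apply: eq_bigr => i _; rewrite scalerA.
rewrite exchange_big; apply: eq_bigr => i _ /=; rewrite -scaler_sumr; congr (_ *: _).
rewrite (@ractE _ b w (P - i%:Z) _ T).
- by apply: eq_bigr => k _; congr (b _ *: w _); lia.
- by move=> m hm; apply: hb; lia.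
- by move=> m hm; apply: hw; lia.
Qed.

Variable M : lmodType A.

(** Each exponent may bring a new vector of [M], so for [M] of infinite rank this is larger than the
    tensor product of [M] with the Laurent series. The body of W lives here. *)
Record mlaurent := MLaurent { mcoef :> int -> M; _ : lbounded mcoef }.

HB.instance Definition _ := gen_eqMixin mlaurent.
HB.instance Definition _ := gen_choiceMixin mlaurent.

Implicit Types (u v w : mlaurent) (a b : laurent A).

Lemma mboundP w : exists N : int, forall n : int, n < N -> w n = 0.
Proof. by case: w. Qed.

Lemma mlaurentP u v : (forall n, u n = v n) -> u = v.
Proof.
case: u v => [u hu] [v hv] /= uv; have {}uv : u = v by apply/funext.
by case: _ / uv hv => hv; congr MLaurent; exact: Prop_irrelevance.
Qed.

Fact mzero_bound : lbounded (fun _ : int => 0 : M).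
Proof. by exists 0. Qed.
Definition mzero := MLaurent mzero_bound.

Fact madd_bound u v : lbounded (fun n => u n + v n).
Proof.
have [N hN] := mboundP u; have [P hP] := mboundP v.
exists (Num.min N P) => n; rewrite lt_min => /andP[nN nP].
by rewrite hN // hP // addr0.
Qed.
Definition madd u v := MLaurent (madd_bound u v).

Fact mopp_bound u : lbounded (fun n => - u n).
Proof. by have [N hN] := mboundP u; exists N => n nN; rewrite hN // oppr0. Qed.
Definition mopp u := MLaurent (mopp_bound u).

Fact mscale_bound a u : lbounded (ract a u).
Proof.
have [N hN] := lboundP a; have [P hP] := mboundP u.
by exists (N + P); exact: ract_bounded.
Qed.
Definition mscale a u := MLaurent (mscale_bound a u).

Fact maddA : associative madd.
Proof. by move=> s t u; apply: mlaurentP => n /=; rewrite addrA. Qed.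
Fact maddC : commutative madd.
Proof. by move=> s t; apply: mlaurentP => n /=; rewrite addrC. Qed.
Fact madd0 : left_id mzero madd.
Proof. by move=> s; apply: mlaurentP => n /=; rewrite add0r. Qed.
Fact maddN : left_inverse mzero mopp madd.
Proof. by move=> s; apply: mlaurentP => n /=; rewrite addNr. Qed.
HB.instance Definition _ := GRing.isZmodule.Build mlaurent maddA maddC madd0 maddN.

Lemma mcoefD u v n : (u + v) n = u n + v n. Proof. by []. Qed.
Lemma mcoefN u n : (- u) n = - u n. Proof. by []. Qed.
Lemma mscaleE_bounded a u (N P n : int) :
  (forall m, m < N -> a m = 0) -> (forall m, m < P -> u m = 0) ->
  forall T : nat, n - N - T%:Z < P ->
  mscale a u n = \sum_(i < T) a (N + i%:Z) *: u (n - N - i%:Z).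
Proof. by move=> ha hu T hT; apply: ractE => // m hm; apply: hu; lia. Qed.

Lemma common_bound (V W : zmodType) (f : int -> V) (g : int -> W) :
  (exists N, forall n : int, n < N -> f n = 0) ->
  (exists N, forall n : int, n < N -> g n = 0) ->
  exists N, (forall n : int, n < N -> f n = 0) /\ (forall n : int, n < N -> g n = 0).
Proof.
move=> [N hN] [P hP]; exists (Num.min N P).
by split=> n; rewrite lt_min => /andP[/hN ? /hP].
Qed.

Fact mscaleA a b u : mscale a (mscale b u) = mscale (a * b) u.
Proof.
apply: mlaurentP => n; have [N hN] := lboundP a; have [P hP] := lboundP b.
by have [S hS] := mboundP u; rewrite [RHS](ract_assoc hN hP hS).
Qed.

Lemma mscale_monE (k : int) (x : A) u n : mscale (lmon k x) u n = x *: u (n - k).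
Proof.
rewrite /= /ract -(fsbig_widen [set k]%classic) //; last first.
  by move=> m [_ /= /eqP mk]; rewrite /lmon_fun (negbTE mk) scale0r.
by rewrite fsbig_set1 /lmon_fun eqxx.
Qed.

Fact mscale1 : left_id 1 mscale.
Proof. by move=> u; apply: mlaurentP => n; rewrite mscale_monE scale1r subr0. Qed.

Fact mscaleDr : right_distributive mscale +%R.
Proof.
move=> a u v; apply: mlaurentP => n; have [N hN] := lboundP a.
have [P [hu hv]] := common_bound (mboundP u) (mboundP v).
have huv m : m < P -> (u + v) m = 0 by move=> mP; rewrite mcoefD hu // hv // addr0.
have hT : n - N - (absz (n - N - P + 1))%:Z < P by lia.
rewrite mcoefD !(mscaleE_bounded hN _ hT) // -big_split.
by apply: eq_bigr => i _; rewrite mcoefD scalerDr.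
Qed.

Fact mscaleDl u : {morph mscale^~ u : a b / a + b}.
Proof.
move=> a b; apply: mlaurentP => n; have [P hP] := mboundP u.
have [N [ha hb]] := common_bound (lboundP a) (lboundP b).
have hab m : m < N -> (a + b) m = 0 by move=> mP /=; rewrite ha // hb // addr0.
have hT : n - N - (absz (n - N - P + 1))%:Z < P by lia.
rewrite mcoefD !(mscaleE_bounded _ hP hT) // -big_split.
by apply: eq_bigr => i _; rewrite /= scalerDl.
Qed.

HB.instance Definition _ :=
  GRing.Zmodule_isLmodule.Build (laurent A) mlaurent mscaleA mscale1 mscaleDr mscaleDl.

Lemma mcoef_scale_mon (k : int) (x : A) u n : (lmon k x *: u) n = x *: u (n - k).
Proof. exact: mscale_monE. Qed.

Lemma mcoef_scale a u n : (a *: u) n = ract a u n. Proof. by []. Qed.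

Lemma mcoef_sum (I : Type) (s : seq I) (P : pred I) (F : I -> mlaurent) n :
  (\sum_(i <- s | P i) F i) n = \sum_(i <- s | P i) F i n.
Proof. by elim/big_rec2: _ => // i x y _ <-. Qed.

Fact mlmap_bound (f : M -> M) (f0 : f 0 = 0) u : lbounded (fun n => f (u n)).
Proof. by have [N hN] := mboundP u; exists N => n nN; rewrite hN. Qed.
Definition mlmap f f0 u := MLaurent (@mlmap_bound f f0 u).

Fact mlderiv_bound u : lbounded (fun n => (n + 1)%:~R *: u (n + 1)).
Proof.
have [N hN] := mboundP u; exists (N - 1) => n nN.
by rewrite hN ?scaler0 //; lia.
Qed.
Definition mlderiv u := MLaurent (mlderiv_bound u).

Lemma mlderivD : {morph mlderiv : u v / u + v}.
Proof. by move=> u v; apply: mlaurentP => n /=; rewrite -scalerDr. Qed.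

Lemma mlderivZ a u : mlderiv (a *: u) = lderiv a *: u + a *: mlderiv u.
Proof.
apply: mlaurentP => n; have [N hN] := lboundP a; have [P hP] := mboundP u.
(* The three products have bounds or arguments shifted by one; the slack makes one length serve them
   all. *)
pose T := absz (n - N - P + 3).
rewrite mcoefD !mcoef_scale /=.
rewrite (@ractE _ a u N _ T) //; last by move=> m hm; apply: hP; lia.
rewrite (@ractE _ (lderiv a) u (N - 1) _ T); last 2 first.
- by move=> m hm /=; rewrite hN ?mulr0 //; lia.
- by move=> m hm; apply: hP; lia.
rewrite (@ractE _ a (mlderiv u) N _ T) //; last first.
  by move=> m hm /=; rewrite hP ?scaler0 //; lia.
rewrite scaler_sumr -big_split; apply: eq_bigr => i _ /=.
have -> : N - 1 + i%:Z + 1 = N + i%:Z by lia.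
have -> : n - (N - 1) - i%:Z = n + 1 - N - i%:Z by lia.
have -> : n - N - i%:Z + 1 = n + 1 - N - i%:Z by lia.
rewrite !scalerA -scalerDl; congr (_ *: _).
by rewrite [a _ * _]mulrC -mulrDl -rmorphD /=; congr (_%:~R * _); lia.
Qed.

Lemma mlmapD (f : M -> M) (f0 : f 0 = 0) : {morph f : x y / x + y} ->
  {morph mlmap f0 : u v / u + v}.
Proof. by move=> fD u v; apply: mlaurentP => n /=; rewrite fD. Qed.

Lemma mlmapZ (D : A -> A) (D0 : D 0 = 0) (f : M -> M) (f0 : f 0 = 0) :
  {morph f : x y / x + y} -> (forall x y, f (x *: y) = D x *: y + x *: f y) ->
  forall a u, mlmap f0 (a *: u) = lmap D0 a *: u + a *: mlmap f0 u.
Proof.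
move=> fD fZ a u; apply: mlaurentP => n.
have [N hN] := lboundP a; have [P hP] := mboundP u.
pose T := absz (n - N - P + 3).
rewrite mcoefD !mcoef_scale /=.
rewrite (@ractE _ a u N _ T) //; last by move=> m hm; apply: hP; lia.
rewrite (@ractE _ (lmap D0 a) u N _ T); last 2 first.
- by move=> m hm /=; rewrite hN.
- by move=> m hm; apply: hP; lia.
rewrite (@ractE _ a (mlmap f0 u) N _ T) //; last first.
  by move=> m hm /=; rewrite hP //; lia.
rewrite (big_morph f fD f0) -big_split; apply: eq_bigr => i _ /=.
by rewrite fZ.
Qed.

Lemma mlmap_linear (f : {linear M -> M}) (f0 : f 0 = 0) a u :
  mlmap f0 (a *: u) = a *: mlmap f0 u.
Proof.
apply: mlaurentP => n.
have [N hN] := lboundP a; have [P hP] := mboundP u.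
pose T := absz (n - N - P + 3).
rewrite !mcoef_scale /=.
rewrite (@ractE _ a u N _ T) //; last by move=> m hm; apply: hP; lia.
rewrite (@ractE _ a (mlmap f0 u) N _ T) //; last first.
  by move=> m hm /=; rewrite hP //; lia.
by rewrite linear_sum; apply: eq_bigr => i _; rewrite linearZ.
Qed.

Definition mlmap_lin (f : {linear M -> M}) : mlaurent -> mlaurent := mlmap (linear0 f).

Fact mlmap_lin_linear (f : {linear M -> M}) : linear (mlmap_lin f).
Proof.
move=> a u v; rewrite /mlmap_lin mlmapD ?mlmap_linear //.
by move=> x y; rewrite linearD.
Qed.
HB.instance Definition _ (f : {linear M -> M}) :=
  GRing.isLinear.Build (laurent A) mlaurent mlaurent *:%R (mlmap_lin f) (mlmap_lin_linear f).

End LaurentModule.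

(** * Derivations and the ring of Laurent series *)

Definition derivation (A : comNzRingType) (D : A -> A) : Prop :=
  {morph D : x y / x + y} /\ forall x y, D (x * y) = D x * y + x * D y.

Section Derivation.
Variables (A : comNzRingType) (D : A -> A).
Hypothesis hD : derivation D.

Lemma derD x y : D (x + y) = D x + D y. Proof. exact: hD.1. Qed.
Lemma derM x y : D (x * y) = D x * y + x * D y. Proof. exact: hD.2. Qed.
Lemma der0 : D 0 = 0.
Proof. by apply: (addrI (D 0)); rewrite -derD !addr0. Qed.
Lemma derN x : D (- x) = - D x.
Proof. by apply: (addrI (D x)); rewrite -derD !subrr der0. Qed.
Lemma derB x y : D (x - y) = D x - D y. Proof. by rewrite derD derN. Qed.
Lemma der1 : D 1 = 0.
Proof. by apply: (addrI (D 1)); rewrite addr0 -{3}[1]mulr1 derM mulr1 mul1r. Qed.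
Lemma der_nat n : D n%:R = 0.
Proof. by elim: n => [|n IH]; rewrite ?der0 // -addn1 natrD derD IH der1 addr0. Qed.
Lemma der_natM n x : D (n%:R * x) = n%:R * D x.
Proof. by rewrite derM der_nat mul0r add0r. Qed.
Lemma der_int (n : int) : D n%:~R = 0.
Proof. by case: n => n; rewrite ?NegzE ?mulrNz ?derN -pmulrn der_nat ?oppr0. Qed.
Lemma der_sum (I : Type) (s : seq I) (P : pred I) (F : I -> A) :
  D (\sum_(i <- s | P i) F i) = \sum_(i <- s | P i) D (F i).
Proof. exact: (big_morph D derD der0). Qed.
End Derivation.

Section LaurentRing.
Variable A : comNzRingType.
Implicit Types a b s : laurent A.

(** Seen as a series with coefficients in the regular module, a factor of a product becomes a
    vector, and the Leibniz rules and coefficient formulas for scaling specialise to the ring. *)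
Definition regular_mlaurent b : mlaurent A^o := @MLaurent A A^o b (lboundP b).

Lemma lcoefD a b n : (a + b) n = a n + b n. Proof. by []. Qed.
Lemma lcoefN a n : (- a) n = - a n. Proof. by []. Qed.
Lemma lcoef_sum (I : Type) (s : seq I) (P : pred I) (F : I -> laurent A) n :
  (\sum_(i <- s | P i) F i) n = \sum_(i <- s | P i) F i n.
Proof.
elim/big_rec2: _ => [|i x y _ <- //]; by rewrite /= /lmon_fun; case: ifP.
Qed.
Lemma lcoef0 n : (0 : laurent A) n = 0.
Proof. by rewrite /= /lmon_fun; case: ifP. Qed.

Lemma lcoef_mon k x n : lmon k (x : A) n = if n == k then x else 0.
Proof. by []. Qed.

Lemma lcoefM_mon k (x : A) a n : (lmon k x * a) n = x * a (n - k).
Proof. exact: (@mscale_monE A A^o k x (regular_mlaurent a) n). Qed.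

Lemma lmonD k : {morph (fun x : A => lmon k x) : x y / x + y}.
Proof.
by move=> x y; apply: laurentP => n; rewrite lcoefD !lcoef_mon; case: ifP => //; rewrite addr0.
Qed.
Lemma lmon0 k : lmon k (0 : A) = 0.
Proof. by apply: laurentP => n; rewrite lcoef_mon lcoef0; case: ifP. Qed.
Lemma lmonN k (x : A) : lmon k (- x) = - lmon k x.
Proof. by apply: (addrI (lmon k x)); rewrite -lmonD !subrr lmon0. Qed.
Lemma lmonM i j (x y : A) : lmon i x * lmon j y = lmon (i + j) (x * y).
Proof.
apply: laurentP => n; rewrite lcoefM_mon !lcoef_mon.
have -> : (n - i == j) = (n == i + j) by lia.
by case: ifP => //; rewrite mulr0.
Qed.
Lemma lmon1 : lmon 0 1 = 1 :> laurent A. Proof. by []. Qed.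
Lemma lmon_nat n : lmon 0 n%:R = n%:R :> laurent A.
Proof. by elim: n => [|n IH]; rewrite ?lmon0 // -addn1 !natrD lmonD IH. Qed.
Lemma lmon_inj k : injective (lmon k : A -> laurent A).
Proof.
by move=> x y /(congr1 (fun a : laurent A => a k)); rewrite !lcoef_mon eqxx.
Qed.

Lemma lcoef_nat n k : (n%:R : laurent A) k = if k == 0 then n%:R else 0.
Proof. by rewrite -lmon_nat lcoef_mon. Qed.

Lemma lderiv_derivation : derivation (@lderiv A).
Proof.
split=> a b; first by apply: laurentP => n; rewrite /= mulrDr.
apply: laurentP => n.
exact: (congr1 (fun u : mlaurent A^o => u n) (mlderivZ a (regular_mlaurent b))).
Qed.

Lemma lmap_derivation (D : A -> A) (D0 : D 0 = 0) :
  derivation D -> derivation (lmap D0).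
Proof.
move=> hD; split=> a b; first by apply: laurentP => n; rewrite /= (derD hD).
apply: laurentP => n.
exact: (congr1 (fun u : mlaurent A^o => u n)
  (@mlmapZ A A^o D D0 D D0 (derD hD) (derM hD) a (regular_mlaurent b))).
Qed.

Lemma lmap_mon (D : A -> A) (D0 : D 0 = 0) k x : lmap D0 (lmon k x) = lmon k (D x).
Proof. by apply: laurentP => n; rewrite /= /lmon_fun; case: ifP. Qed.

Lemma lderiv_mon k (x : A) : lderiv (lmon k x) = lmon (k - 1) (k%:~R * x).
Proof.
apply: laurentP => n; rewrite /= /lmon_fun.
have -> : (n + 1 == k) = (n == k - 1) by lia.
by case: eqP => [->|_]; rewrite ?mulr0 // subrK.
Qed.

Lemma lderiv_const (x : A) : lderiv (lmon 0 x) = 0.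
Proof. by rewrite lderiv_mon mul0r lmon0. Qed.

Lemma lmapC (D E : A -> A) (D0 : D 0 = 0) (E0 : E 0 = 0) :
  (forall x, D (E x) = E (D x)) -> forall a, lmap D0 (lmap E0 a) = lmap E0 (lmap D0 a).
Proof. by move=> DE a; apply: laurentP => n /=. Qed.

Lemma lmap_lderiv (D : A -> A) (D0 : D 0 = 0) : derivation D ->
  forall a, lmap D0 (lderiv a) = lderiv (lmap D0 a).
Proof.
move=> hD a; apply: laurentP => n /=; rewrite (derM hD).
by rewrite (der_int hD) mul0r add0r.
Qed.

Section Subring.
Variable B : A -> Prop.
Hypotheses (B1 : B 1) (BB : forall x y, B x -> B y -> B (x - y)).
Hypothesis BM : forall x y, B x -> B y -> B (x * y).

Lemma subP0 : B 0. Proof. by rewrite -(subrr 1); apply: BB. Qed.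
Lemma subPN x : B x -> B (- x).
Proof. by move=> Bx; rewrite -sub0r; apply: BB => //; exact: subP0. Qed.
Lemma subPD x y : B x -> B y -> B (x + y).
Proof. by move=> Bx By; rewrite -[y]opprK; apply: BB => //; exact: subPN. Qed.
Lemma subP_sum (I : Type) (s : seq I) (P : pred I) (F : I -> A) :
  (forall i, P i -> B (F i)) -> B (\sum_(i <- s | P i) F i).
Proof. by move=> BF; apply: (big_ind B) => //; [exact: subP0 | exact: subPD]. Qed.
Lemma subP_nat n : B n%:R.
Proof. by elim: n => [|n IH]; [exact: subP0 | rewrite -addn1 natrD; exact: subPD]. Qed.
Lemma subP_int (n : int) : B n%:~R.
Proof.
by case: n => n; rewrite ?NegzE ?mulrNz -pmulrn; [|apply: subPN]; exact: subP_nat.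
Qed.
Lemma subPX x n : B x -> B (x ^+ n).
Proof. by move=> Bx; elim: n => [|n IH]; rewrite ?expr0 // exprS; exact: BM. Qed.

Definition lsub (a : laurent A) : Prop := forall n, B (a n).

Lemma lsub_mon k x : B x -> lsub (lmon k x).
Proof. by move=> Bx n; rewrite lcoef_mon; case: ifP => // _; exact: subP0. Qed.
Lemma lsub1 : lsub 1. Proof. exact: lsub_mon. Qed.
Lemma lsubD a b : lsub a -> lsub b -> lsub (a + b).
Proof. by move=> ha hb n; rewrite lcoefD; exact: subPD. Qed.
Lemma lsubN a : lsub a -> lsub (- a).
Proof. by move=> ha n; rewrite lcoefN; exact: subPN. Qed.
Lemma lsubB a b : lsub a -> lsub b -> lsub (a - b).
Proof. by move=> ha hb; apply: lsubD => //; exact: lsubN. Qed.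
Lemma lsub_sum (I : Type) (s : seq I) (P : pred I) (F : I -> laurent A) :
  (forall i, P i -> lsub (F i)) -> lsub (\sum_(i <- s | P i) F i).
Proof. by move=> BF n; rewrite lcoef_sum; apply: subP_sum => i /BF. Qed.
Lemma lsubM a b : lsub a -> lsub b -> lsub (a * b).
Proof.
move=> ha hb n; have [N hN] := lboundP a; have [P hP] := lboundP b.
have -> : (a * b) n = (a *: regular_mlaurent b) n by [].
have hT : n - N - (absz (n - N - P + 1))%:Z < P by lia.
rewrite (mscaleE_bounded hN (_ : forall m, m < P -> regular_mlaurent b m = 0) hT) //.
apply: subP_sum => i _; exact: (BM (ha _) (hb _)).
Qed.

Section Inverse.
Variable s : laurent A.
Hypotheses (s_neg : forall n, n < 0 -> s n = 0) (s_one : s 0 = 1) (sB : lsub s).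

(** The recursion t_(m+1) = - sum_(i <= m) t_i s_(m+1-i) for the inverse of s; the whole prefix is
    stored because each coefficient uses all earlier ones. *)
Fixpoint inv_seq (n : nat) : seq A :=
  if n is m.+1 then
    rcons (inv_seq m) (- \sum_(i < m.+1) (inv_seq m)`_i * s (m.+1%:Z - i%:Z))
  else [:: 1].

Lemma size_inv_seq n : size (inv_seq n) = n.+1.
Proof. by elim: n => //= n IH; rewrite size_rcons IH. Qed.

Lemma nth_inv_seq n i : (i <= n)%N -> (inv_seq n)`_i = (inv_seq i)`_i.
Proof.
elim: n => [|n IH]; first by rewrite leqn0 => /eqP ->.
rewrite leq_eqVlt => /orP[/eqP -> //|]; rewrite ltnS => le_in.
by rewrite /= nth_rcons size_inv_seq ltnS le_in IH.
Qed.

Fact linv_bound : exists N : int, forall n : int, n < N ->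
  (if n is Posz k then (inv_seq k)`_k else 0) = 0.
Proof. by exists 0 => -[]. Qed.

(** With constant term 1 the recursion never divides, so the inverse stays over the subring [B]. *)
Lemma unit_of_one : exists2 t : laurent A, lsub t & t * s = 1.
Proof.
pose t := Laurent linv_bound; exists t.
  have tB k : forall i, B (inv_seq k)`_i.
    elim: k => [|k IH] i /=.
      by case: i => [|[|i]] //=; exact: subP0.
    rewrite nth_rcons; case: ifP => // _; case: ifP => _; last exact: subP0.
    by apply: subPN; apply: subP_sum => j _; exact: BM.
  by case=> k /=; [exact: tB | exact: subP0].
apply: laurentP => n; rewrite -lmon1 lcoef_mon.
have -> : (t * s) n = (t *: regular_mlaurent s) n by [].
have hP m : m < 0 -> regular_mlaurent s m = 0 by move=> /s_neg.
have [n0|n0] := ltP n 0.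
  rewrite (@mscaleE_bounded _ _ _ _ 0 0 _ _ _ 0%N) ?big_ord0 //; last 2 first.
  - by case.
  - by lia.
  by rewrite lt_eqF.
case: n n0 => // k _.
rewrite (@mscaleE_bounded _ _ _ _ 0 0 _ _ _ k.+1) //; last 2 first.
- by case.
- by lia.
under eq_bigr => i _ do rewrite add0r subr0 /=.
rewrite big_ord_recr /= subrr s_one.
rewrite [_ *: _]mulr1; case: k => [|k]; first by rewrite big_ord0 add0r.
apply/eqP; rewrite addr_eq0; apply/eqP.
rewrite /= nth_rcons size_inv_seq ltnn eqxx opprK; apply: eq_bigr => i _.
have ik : (i <= k)%N by rewrite -ltnS.
by rewrite (nth_inv_seq ik) nth_inv_seq // (leq_trans ik).
Qed.

End Inverse.
End Subring.
End LaurentRing.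

(** * Torsion-freeness and anti-triangular systems *)

Section TorsionFree.
Variables (F : fieldType) (M : lmodType F).

(** The lowest nonzero coefficient of [a] is invertible in the field. Comparing coefficients upward
    from a lower bound of [u] kills those of [u] one after the other. *)
Lemma mlaurent_torsion (a : laurent F) (u : mlaurent M) : a *: u = 0 -> a != 0 -> u = 0.
Proof.
move=> au a0; have [N0 h0] := lboundP a; have [P hP] := mboundP u.
have [k ak] : exists k : nat, a (N0 + k%:Z) != 0.
  apply/not_existsP => ha; move/eqP: a0; apply; apply: laurentP => n.
  have [/h0 -> //|/laurent_split [k ->]] := ltP n N0; first by rewrite lcoef0.
  by rewrite lcoef0; apply/eqP/negPn/negP; exact: ha.
have [{ak}k [ak hk]] : exists k : nat, a (N0 + k%:Z) != 0 /\
    forall i : nat, (i < k)%N -> a (N0 + i%:Z) = 0.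
  have exk : exists k : nat, a (N0 + k%:Z) != 0 by exists k.
  exists (ex_minn exk); case: ex_minnP => m am hm; split=> // i im.
  by apply/eqP/negPn/negP => /hm; rewrite leqNgt im.
pose N := N0 + k%:Z.
have hN m : m < N -> a m = 0.
  have [/h0 -> //|/laurent_split [i ->]] := ltP m N0.
  by rewrite /N => hi; apply: hk; lia.
apply: mlaurentP => n; have [/hP //|/laurent_split [m ->]] := ltP n P.
have [d] := ubnP m; elim: d m => // d IH m md.
have := congr1 (fun w : mlaurent M => w (N + (P + m%:Z))) au.
rewrite (@mscaleE_bounded _ _ _ _ N P _ hN hP m.+1); last by lia.
rewrite big_ord_recl big1 /=; last first.
  move=> i _; rewrite [u _](_ : _ = 0) ?scaler0 //; rewrite /bump /= add1n.
  have im := ltn_ord i.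
  have -> : N + (P + m%:Z) - N - i.+1%:Z = P + (m - i.+1)%N%:Z by lia.
  by apply: IH; lia.
rewrite !addr0 => /eqP; rewrite scaler_eq0 (negPf ak) /= => /eqP <-.
by congr (u _); lia.
Qed.

End TorsionFree.

Section AntiTriangular.
Variables (A : comUnitRingType) (X : lmodType A) (n : nat) (t : nat -> nat -> A) (x : 'I_n -> X).
Variables (B : A -> Prop) (Z : X -> Prop).
Hypotheses (Z0 : Z 0) (ZB : forall u v, Z u -> Z v -> Z (u - v)).
Hypothesis ZZ : forall a u, B a -> Z u -> Z (a *: u).
Hypothesis t_out : forall i j, (j < n)%N -> (n <= i + j)%N -> t i j = 0.
Hypothesis t_unit : forall j, (j < n)%N -> t (n - j.+1) j \is a GRing.unit.
Hypothesis tB : forall i j, (i < n)%N -> (j < n)%N -> B (t i j).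
Hypothesis tVB : forall j, (j < n)%N -> B (t (n - j.+1) j)^-1.

(** Row n - j - 1 involves only x_0, ..., x_j, with a unit in front of x_j, so substitution proceeds
    upward in j. The predicates [Z] and [B] let one elimination serve for uniqueness ([Z] is being
    zero) and for integrality ([Z] is membership in a lattice). *)
Lemma antitriangular_solve :
  (forall i, (i < n)%N -> Z (\sum_(j < n) t i j *: x j)) -> forall j, Z (x j).
Proof.
move=> hZ j; have [d] := ubnP (j : nat); elim: d j => // d IH j jd.
have ZN u : Z u -> Z (- u) by move=> Zu; rewrite -sub0r; exact: ZB.
have ZD u v : Z u -> Z v -> Z (u + v) by move=> Zu Zv; rewrite -[v]opprK; apply/ZB/ZN.
have jn := ltn_ord j; pose i := (n - j.+1)%N.
have i_n : (i < n)%N by rewrite /i; lia.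
have e : x j = (t i j)^-1 *: (\sum_(k < n) t i k *: x k - \sum_(k < n | (k < j)%N) t i k *: x k).
  rewrite [in X in X - _](bigID (fun k : 'I_n => (k < j)%N)) /= addrAC subrr add0r.
  rewrite (bigD1 j) ?ltnn //= big1 ?addr0.
    by rewrite scalerA mulVr ?scale1r //; exact: t_unit.
  move=> k; rewrite -leqNgt => /andP[jk kj]; rewrite (t_out (ltn_ord k)) ?scale0r // /i.
  by move: kj jk; rewrite -val_eqE /=; lia.
rewrite e; apply: ZZ; first exact: tVB.
apply: ZB; first exact: hZ.
apply: (big_ind Z) => // k kj; apply: ZZ; first exact: tB.
by apply: IH; apply: leq_trans kj _.
Qed.

End AntiTriangular.

(** * The weights along the deformation vector fields *)

Section WeightCocycle.
Variables (A : comNzRingType) (c : nat -> A) (D : nat -> A -> A).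
Hypotheses (hD : forall n, derivation (D n)) (Dc : forall n k, D n (c k) = k%:R * c (n + k)).

Definition quad n : A := \sum_(1 <= p < n) c p * c (n - p).

Lemma quad_rev (f : nat -> A) n :
  \sum_(1 <= p < n) f p * (c p * c (n - p))
  = \sum_(1 <= p < n) f (n - p)%N * (c p * c (n - p)).
Proof.
rewrite big_nat_rev; apply: eq_big_nat => p /andP[p1 pn].
have -> : (1 + n - p.+1 = n - p)%N by lia.
by rewrite (_ : (n - (n - p) = p)%N); [rewrite [c p * _]mulrC | lia].
Qed.

Lemma der_quad n m :
  D n (quad m) = 2%:R * \sum_(1 <= p < m) p%:R * (c (n + p) * c (m - p)).
Proof.
rewrite /quad (der_sum (hD n)).
under eq_big_nat => p hp do rewrite (derM (hD n)) !Dc.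
rewrite big_split /= mulr_natl mulr2n; congr (_ + _).
  by apply: eq_bigr => p _; rewrite mulrA.
rewrite big_nat_rev; apply: eq_big_nat => p /andP[p1 pn].
have -> : (1 + m - p.+1 = m - p)%N by lia.
by rewrite (_ : (m - (m - p) = p)%N); [ring | lia].
Qed.

(** After reindexing, both derivatives are pieces of one sum over 1 <= p < m + n of (p - n) c_p
    c_(m+n-p), whose missing term p = n has coefficient 0. Averaging with the reflection p -> m + n
    - p replaces 2(p - n) by m - n. *)
Lemma quad_cocycle n m :
  D n (quad m) - D m (quad n) = (m%:R - n%:R) * quad (m + n).
Proof.
pose T p := c p * c (m + n - p); pose f p : A := p%:R - n%:R.
have e1 : \sum_(1 <= p < m) p%:R * (c (n + p) * c (m - p))
    = \sum_(n.+1 <= p < m + n) f p * T p.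
  have -> : n.+1 = (1 + n)%N by rewrite add1n.
  rewrite big_addn addnK; apply: eq_big_nat => p /andP[p1 pm].
  rewrite /f /T natrD addrK addnC; congr (_ * (_ * c _)); lia.
have e2 : \sum_(1 <= p < n) p%:R * (c (m + p) * c (n - p))
    = - \sum_(1 <= p < n) f p * T p.
  rewrite big_nat_rev -sumrN; apply: eq_big_nat => p /andP[p1 pn].
  have -> : (1 + n - p.+1 = n - p)%N by lia.
  rewrite (_ : (n - (n - p) = p)%N); last by lia.
  rewrite /f /T natrB; last by lia.
  by rewrite (_ : (m + (n - p) = m + n - p)%N); [ring | lia].
have e3 : D n (quad m) - D m (quad n) = 2%:R * \sum_(1 <= p < m + n) f p * T p.
  rewrite !der_quad -mulrBr e1 e2 opprK addrC; congr (_ * _).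
  case: n @f @T {e1 e2} => [|n] f T; first by rewrite (@big_geq _ _ _ 1 0) // add0r.
  case: m @f @T => [|m] f T.
    by rewrite [X in _ + X]big_geq ?addr0 // !add0n.
  rewrite [RHS](@big_cat_nat _ _ _ n.+1) //=; last by lia.
  congr (_ + _); rewrite [RHS]big_ltn; last by lia.
  by rewrite /f subrr mul0r add0r.
rewrite e3 mulr_natl mulr2n [X in _ + X](quad_rev f) -big_split mulr_sumr.
apply: eq_big_nat => p /andP[p1 pmn]; rewrite /f /T natrB ?natrD; last by lia.
by rewrite /= -mulrDl; congr (_ * _); ring.
Qed.

Lemma quad_square r (n : nat) : (forall k, (r <= k)%N -> c k = 0) ->
  \sum_(1 <= p < r) \sum_(1 <= q < r | (p + q == n)%N) c p * c q = quad n.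
Proof.
move=> c_out.
transitivity (\sum_(1 <= p < r | (p < n)%N) c p * c (n - p)).
  rewrite [RHS]big_mkcond; apply: eq_big_nat => p /andP[p1 pr].
  case: ltnP => [pn|np]; last first.
    by rewrite big_nat_cond big_pred0 // => q; case: eqP => //; lia.
  have [nr|rn] := ltnP (n - p) r; last first.
    rewrite (c_out _ rn) mulr0 big_nat_cond big_pred0 // => q; case: eqP => //; lia.
  rewrite big_mkcond (bigD1_seq (n - p)%N) ?iota_uniq ?mem_index_iota //=; last by lia.
  rewrite subnKC ?(ltnW pn) // eqxx big1 ?addr0 // => q qn.
  by case: eqP => // e; case/negP: qn; apply/eqP; lia.
rewrite (big_nat_widen _ _ (r + n)) ?leq_addr // /quad [RHS](big_nat_widen _ _ (r + n)) ?leq_addl //.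
rewrite big_mkcond [RHS]big_mkcond; apply: eq_bigr => p _ /=.
by case: (ltnP p n) => //= _; case: ltnP => // /c_out ->; rewrite mul0r.
Qed.

Lemma quad_out r n : (forall k, (r <= k)%N -> c k = 0) -> (2 * r - 2 < n)%N -> quad n = 0.
Proof.
move=> c_out rn; rewrite /quad big_nat big1 // => p /andP[p1 pn].
have [rp|pr] := leqP r p; first by rewrite (c_out _ rp) mul0r.
by rewrite (c_out (n - p)%N) ?mulr0 //; lia.
Qed.

Lemma quad_top r : (2 <= r)%N -> (forall k, (r <= k)%N -> c k = 0) ->
  quad (2 * r - 2) = c r.-1 * c r.-1.
Proof.
move=> hr c_out; rewrite /quad (bigD1_seq r.-1) ?iota_uniq ?mem_index_iota //=; last by lia.
rewrite (_ : (2 * r - 2 - r.-1 = r.-1)%N); last by lia.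
rewrite big_seq_cond big1 ?addr0 // => p; rewrite mem_index_iota => /andP[p12 /eqP pr].
have [rp|rp] := leqP r p; first by rewrite (c_out _ rp) mul0r.
by rewrite (c_out (2 * r - 2 - p)%N) ?mulr0 //; lia.
Qed.

Lemma der_quad_coord (d : A -> A) k m : derivation d -> (forall l, d (c l) = (l == k)%:R) ->
  (0 < k < m)%N -> d (quad m) = 2%:R * c (m - k).
Proof.
move=> hdd dc km; rewrite /quad (der_sum hdd).
under eq_bigr => p _ do rewrite (derM hdd) !dc.
have k_in : k \in index_iota 1 m by rewrite mem_index_iota.
have mk_in : (m - k)%N \in index_iota 1 m by rewrite mem_index_iota; lia.
rewrite big_split mulr_natl mulr2n /=; congr (_ + _).
  rewrite (bigD1_seq k) ?iota_uniq //= eqxx mul1r big1 ?addr0 // => p /negbTE ->.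
  by rewrite mul0r.
rewrite (bigD1_seq (m - k)%N) ?iota_uniq //= subKn; last by lia.
rewrite eqxx mulr1 big_seq_cond big1 ?addr0 // => p; rewrite mem_index_iota => /andP[pm pk].
rewrite (_ : (m - p == k)%N = false) ?mulr0 //.
by apply/negbTE; apply: contra pk => /eqP <-; apply/eqP; lia.
Qed.

Variables (q c0 d0 : A).
Hypotheses (Dq : forall n, D n q = 0) (Dc0 : forall n, D n c0 = 0) (Dd0 : forall n, D n d0 = 0).

(** Index 0 is separate: in the application c_0 is also the parameter [c0], and the general formula
    would subtract 2 c_0^2 where Delta_(c_0) subtracts c_0^2, since the two products c_0 c_n and c_n
    c_0 coincide at n = 0. *)
Definition gen_weight n : A :=
  if n is 0 then d0 else (n.+1%:R * q - 2%:R * c0) * c n - quad n.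

Lemma der_gen_weight n m : (0 < m)%N ->
  D n (gen_weight m) = (m.+1%:R * q - 2%:R * c0) * (m%:R * c (n + m)) - D n (quad m).
Proof.
case: m => // m _; rewrite (derB (hD n)) (derM (hD n)) (derB (hD n)) !(der_natM (hD n)).
by rewrite Dq Dc0 !mulr0 subrr mul0r add0r Dc.
Qed.

(** The scalar part of the Witt relations for the operators w_n + D_n. On the part linear in c it
    amounts to m(m+1) - n(n+1) = (m-n)(m+n+1). *)
Lemma weight_cocycle n m :
  D n (gen_weight m) - D m (gen_weight n) = (m%:R - n%:R) * gen_weight (m + n).
Proof.
have quad0 : quad 0 = 0 by rewrite /quad big_geq.
have quadD0 k : D 0%N (quad k) = k%:R * quad k.
  by have := quad_cocycle 0 k; rewrite quad0 (der0 (hD k)) !subr0 addn0.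
case: (posnP n) => [->|n0]; case: (posnP m) => [->|m0].
- by rewrite !subrr mul0r.
- rewrite (der_gen_weight 0 m0) /= Dd0 subr0 addn0 add0n quadD0 subr0.
  by case: m m0 => // m _; rewrite /=; ring.
- rewrite (der_gen_weight 0 n0) /= Dd0 sub0r !add0n quadD0 sub0r.
  by case: n n0 => // n _; rewrite /=; ring.
rewrite !der_gen_weight //.
have -> : gen_weight (m + n)
    = ((m + n).+1%:R * q - 2%:R * c0) * c (m + n) - quad (m + n).
  by case: m m0 => // m _.
rewrite mulrBr -quad_cocycle -!natr1 !natrD [(n + m)%N]addnC.
by ring.
Qed.

End WeightCocycle.

(** * The irregular Verma module *)

Section Coordinates.
Variables (F : fieldType) (M : lmodType F) (I : eqType) (good : pred I) (e : I -> M).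
Hypothesis spanning : forall m : M, exists s (a : I -> F),
  all good s /\ m = \sum_(i <- s) a i *: e i.
Hypothesis independent : forall (s : seq I) (a : I -> F),
  uniq s -> all good s -> \sum_(i <- s) a i *: e i = 0 -> forall i, i \in s -> a i = 0.

Lemma combination_undup (s : seq I) (a : I -> F) : exists b : I -> F,
  \sum_(i <- s) a i *: e i = \sum_(i <- undup s) b i *: e i.
Proof.
exists (fun i => (count_mem i s)%:R * a i).
rewrite -big_undup_iterop_count; apply: eq_bigr => i _.
by rewrite -[LHS]/(_ *+ _) -scaler_nat scalerA.
Qed.

Lemma coordinates_exist (m : M) : exists sa : seq I * (I -> F),
  [/\ uniq sa.1, all good sa.1, forall i, i \notin sa.1 -> sa.2 i = 0
    & m = \sum_(i <- sa.1) sa.2 i *: e i].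
Proof.
have [s [a [gs ->]]] := spanning m; have [b ->] := combination_undup s a.
exists (undup s, fun i => if i \in undup s then b i else 0); split=> /=.
- exact: undup_uniq.
- by apply/allP => i; rewrite mem_undup => /(allP gs).
- by move=> i /negbTE ->.
- by rewrite [LHS]big_seq [RHS]big_seq; apply: eq_bigr => i ->.
Qed.

(** An arbitrary choice of support and coefficients; [coord_unique] makes the choice immaterial. *)
Definition coord_data m := projT1 (cid (coordinates_exist m)).
Definition coord (i : I) (m : M) : F := (coord_data m).2 i.

Lemma combination_widen (s t : seq I) (a : I -> F) : uniq s -> uniq t -> {subset s <= t} ->
  (forall i, i \notin s -> a i = 0) ->
  \sum_(i <- s) a i *: e i = \sum_(i <- t) a i *: e i.
Proof.
move=> us ut st ha; rewrite [RHS](bigID (mem s)) /= [X in _ + X]big1 ?addr0; last first.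
  by move=> i /ha ->; rewrite scale0r.
rewrite -[RHS]big_filter; apply: perm_big; apply: uniq_perm => //; first exact: filter_uniq.
by move=> i; rewrite mem_filter; case: (boolP (i \in s)) => // /st ->.
Qed.

Lemma coord_decomposition m : exists s,
  [/\ uniq s, all good s, forall i, i \notin s -> coord i m = 0
    & m = \sum_(i <- s) coord i m *: e i].
Proof. by rewrite /coord /coord_data; case: cid => -[s a] /= ?; exists s. Qed.

Lemma coord_unique (s : seq I) (a : I -> F) : uniq s -> all good s ->
  (forall i, i \notin s -> a i = 0) ->
  forall i, coord i (\sum_(i <- s) a i *: e i) = a i.
Proof.
move=> us gs ha i; set m := \sum_(_ <- _) _.
have [t [ut gt ht mt]] := coord_decomposition m.
pose z := undup (s ++ t).
have uz : uniq z by exact: undup_uniq.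
have sz : {subset s <= z} by move=> j js; rewrite mem_undup mem_cat js.
have tz : {subset t <= z} by move=> j jt; rewrite mem_undup mem_cat jt orbT.
have gz : all good z by apply/allP => j; rewrite mem_undup mem_cat => /orP[/(allP gs)|/(allP gt)].
have e0 : \sum_(j <- z) (coord j m - a j) *: e j = 0.
  under eq_bigr => j _ do rewrite scalerBl.
  rewrite big_split /= sumrN -(combination_widen ut uz tz ht) -mt.
  by rewrite -(combination_widen us uz sz ha) subrr.
have [iz|iz] := boolP (i \in z).
  by apply/eqP; rewrite -subr_eq0; apply/eqP; exact: (independent uz gz e0 iz).
move: iz; rewrite mem_undup mem_cat negb_or => /andP[/ha -> /ht].
by [].
Qed.

Lemma coord_linear i a (m n : M) : coord i (a *: m + n) = a * coord i m + coord i n.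
Proof.
have [s [us gs hs ms]] := coord_decomposition m.
have [t [ut gt ht nt]] := coord_decomposition n.
pose z := undup (s ++ t).
have uz : uniq z by exact: undup_uniq.
have sz : {subset s <= z} by move=> j js; rewrite mem_undup mem_cat js.
have tz : {subset t <= z} by move=> j jt; rewrite mem_undup mem_cat jt orbT.
have gz : all good z by apply/allP => j; rewrite mem_undup mem_cat => /orP[/(allP gs)|/(allP gt)].
have -> : a *: m + n = \sum_(j <- z) (a * coord j m + coord j n) *: e j.
  rewrite {1}ms {1}nt (combination_widen us uz sz hs) (combination_widen ut uz tz ht).
  by rewrite scaler_sumr -big_split; apply: eq_bigr => j _ /=; rewrite scalerDl scalerA.
rewrite coord_unique // => j.
by rewrite mem_undup mem_cat negb_or => /andP[/hs -> /ht ->]; rewrite mulr0 addr0.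
Qed.

Lemma coordD i (m n : M) : coord i (m + n) = coord i m + coord i n.
Proof. by rewrite -[m]scale1r coord_linear mul1r scale1r. Qed.
Lemma coord0 i : coord i (0 : M) = 0.
Proof. by apply: (addrI (coord i 0)); rewrite -coordD !addr0. Qed.
Lemma coordZ i a (m : M) : coord i (a *: m) = a * coord i m.
Proof. by rewrite -[a *: m]addr0 coord_linear coord0 addr0. Qed.
Lemma coordN i (m : M) : coord i (- m) = - coord i m.
Proof. by rewrite -scaleN1r coordZ mulN1r. Qed.
Lemma coord_basis i j : good j -> coord i (e j) = (i == j)%:R.
Proof.
move=> gj; have -> : e j = \sum_(k <- [:: j]) (k == j)%:R *: e k.
  by rewrite big_seq1 eqxx scale1r.
rewrite (coord_unique (a := fun k => (k == j)%:R)) //=; first by rewrite gj.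
by move=> k; rewrite inE => /negbTE ->.
Qed.

End Coordinates.

Section IrregularVerma.
Variables (F : fieldType) (r : nat) (w : nat -> F) (cc : F).
Variables (M : lmodType F) (L : int -> {linear M -> M}) (v0 : M).
Hypothesis hr : (2 <= r)%N.
Hypothesis vir : forall (m n : int) (v : M),
  L m (L n v) - L n (L m v) = (m - n)%:~R *: L (m + n) v
    + (if m + n == 0 then (cc * (m ^+ 3 - m)%:~R) *: v else 0).
Hypothesis L_v0 : forall n : nat, (r.-1 <= n)%N -> L n%:Z v0 = w n *: v0.

Local Notation lower k := (L (r.-1%:Z - k%:Z)).

Definition word (s : seq nat) : M := foldr (fun k v => lower k v) v0 s.

(** * Whittaker vectors of the irregular module *)

Section Whittaker.
Hypothesis char0 : forall n : nat, (n.+1%:R : F) != 0.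
Hypotheses (w_out : forall n, (2 * r - 2 < n)%N -> w n = 0) (w_top : w (2 * r - 2) != 0).

(** Words in any order are allowed, so that lowering operators preserve the filtration without
    reordering. The bound is strict, which makes [filt 0] zero and lets truncated subtraction
    express annihilation. *)
Inductive filt (d : nat) : M -> Prop :=
| filt0 : filt d 0
| filt_cons a s m : 0%N \notin s -> (sumn s < d)%N -> filt d m -> filt d (a *: word s + m).

Lemma filtD d m n : filt d m -> filt d n -> filt d (m + n).
Proof.
elim=> [|a s {}m s0 sd _ IH] hn; first by rewrite add0r.
by rewrite -addrA; apply: filt_cons => //; exact: IH.
Qed.

Lemma filtZ d a m : filt d m -> filt d (a *: m).
Proof.
elim=> [|b s {}m s0 sd _ IH]; first by rewrite scaler0; exact: filt0.
by rewrite scalerDr scalerA; exact: filt_cons.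
Qed.

Lemma filt_word d s : 0%N \notin s -> (sumn s < d)%N -> filt d (word s).
Proof.
move=> s0 sd; rewrite -[word s]scale1r -[_ *: _]addr0.
by apply: filt_cons => //; exact: filt0.
Qed.

Lemma filt_le d d' m : (d <= d')%N -> filt d m -> filt d' m.
Proof.
move=> dd'; elim=> [|a s {}m s0 sd _ IH]; first exact: filt0.
by apply: filt_cons => //; exact: leq_trans dd'.
Qed.

(** The bound on [d'] is asked for positive [d] only: when a truncated subtraction has produced d =
    0, the vector is zero and the bound may fail. *)
Lemma filt_lower d d' k m : (0 < k)%N -> ((0 < d)%N -> (d + k <= d')%N) ->
  filt d m -> filt d' (lower k m).
Proof.
move=> k0 dd'; elim=> [|a s {}m s0 sd _ IH]; first by rewrite linear0; exact: filt0.
rewrite linearD linearZ; apply: (@filt_cons _ _ (k :: s)) => //.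
  by rewrite inE negb_or s0 andbT neq_ltn k0.
by have := dd' (leq_ltn_trans (leq0n _) sd); rewrite /=; lia.
Qed.

Lemma filt_zero m : filt 0 m -> m = 0.
Proof. by case. Qed.

Definition raising (k : nat) (m : M) : M := L (r.-1 + k)%N%:Z m - w (r.-1 + k) *: m.

Lemma raisingE k m : L (r.-1 + k)%N%:Z m = raising k m + w (r.-1 + k) *: m.
Proof. by rewrite subrK. Qed.

Lemma raisingD k m n : raising k (m + n) = raising k m + raising k n.
Proof. by rewrite /raising linearD scalerDr opprD addrACA. Qed.
Lemma raisingZ k a m : raising k (a *: m) = a *: raising k m.
Proof. by rewrite /raising linearZ scalerBr !scalerA mulrC. Qed.
Lemma raising0 k : raising k 0 = 0.
Proof. by rewrite /raising linear0 scaler0 subr0. Qed.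

(* On symbols, [raising k] acts as the derivation [2 k w_(2r-2) d/d(lower k)]. *)
Fixpoint leading (k : nat) (s : seq nat) : M :=
  if s is j :: s' then
    (if j == k then ((2 * k)%:R * w (2 * r - 2)) *: word s' else 0) + lower j (leading k s')
  else 0.

Lemma filt_leading k s : 0%N \notin s -> filt ((sumn s).+1 - k) (leading k s).
Proof.
elim: s => [|j s IH] /=; first by move=> _; exact: filt0.
rewrite inE negb_or => /andP[j0 s0]; apply: filtD.
  case: eqP => [->|_]; last exact: filt0.
  by apply/filtZ/filt_word => //; lia.
by apply: filt_lower (IH s0); [rewrite lt0n eq_sym | lia].
Qed.

Lemma raising_lower k j m :
  raising k (lower j m) = lower j (raising k m)
    + ((k + j)%:R *: L ((2 * r - 2 + k)%N%:Z - j%:Z) m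
    + (if (2 * r - 2 + k == j)%N then
         (cc * ((r.-1 + k)%N%:Z ^+ 3 - (r.-1 + k)%N%:Z)%:~R) *: m else 0)).
Proof.
have := vir (r.-1 + k)%N%:Z (r.-1%:Z - j%:Z) m.
have -> : (r.-1 + k)%N%:Z - (r.-1%:Z - j%:Z) = (k + j)%N%:Z by lia.
have -> : (r.-1 + k)%N%:Z + (r.-1%:Z - j%:Z) = (2 * r - 2 + k)%N%:Z - j%:Z by lia.
have -> : ((2 * r - 2 + k)%N%:Z - j%:Z == 0) = (2 * r - 2 + k == j)%N by lia.
move=> <-; rewrite /raising linearB [lower j (_ *: _)]linearZ.
by rewrite [RHS]addrC addrA subrK.
Qed.

(** Commuting with the first letter j leaves L_(2r-2+k-j) on the tail. For j = k its eigenvalue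
    w_(2r-2) is the leading term. Everything else has smaller weight: a raising part and a lowering
    part each lose at least r - 1 >= 1 more, for j < k the eigenvalue vanishes, for j > k it comes
    with a tail of smaller weight, and so does the central term. *)
Lemma raising_word k s : 0%N \notin s ->
  filt (sumn s - k) (raising k (word s) - leading k s).
Proof.
elim: s k => [|j s IH] k.
  by move=> _ /=; rewrite subr0 /raising L_v0 ?leq_addr // subrr; exact: filt0.
rewrite inE negb_or => /andP[j0 s0]; have {}j0 : (0 < j)%N by rewrite lt0n eq_sym.
have raising_le d : filt ((sumn s).+1 - d) (raising d (word s)).
  rewrite -[raising _ _](subrK (leading d s)); apply: filtD (filt_leading _ s0).
  by apply: filt_le (IH d s0); lia.
have m_filt d : (sumn s < d)%N -> filt d (word s) by exact: filt_word.
rewrite /= raising_lower opprD [_ - lower j _]addrC addrACA -linearB.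
apply: filtD; first by apply: filt_lower (IH k s0) => //; lia.
have [jk|jk] := eqVneq j k.
  rewrite jk ifN; last by rewrite gtn_eqF //; lia.
  have -> : (2 * r - 2 + k)%N%:Z - k%:Z = (r.-1 + r.-1)%N%:Z by lia.
  rewrite addr0 raisingE (_ : (r.-1 + r.-1 = 2 * r - 2)%N); last by lia.
  rewrite scalerDr scalerA addnn -mul2n addrK.
  by apply: filtZ; apply: filt_le (raising_le r.-1); lia.
rewrite oppr0 addr0; apply: filtD; last first.
  by case: eqP => [e|_]; [apply/filtZ/m_filt; lia | exact: filt0].
apply: filtZ.
have [q1|q1] := leqP j (r.-1 + k); last first.
  have -> : (2 * r - 2 + k)%N%:Z - j%:Z = r.-1%:Z - (j - (r.-1 + k))%N%:Z by lia.
  apply: (@filt_word _ (_ :: s)); last by rewrite /=; lia.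
  by rewrite inE negb_or s0 andbT eq_sym -lt0n; lia.
have -> : (2 * r - 2 + k)%N%:Z - j%:Z = (r.-1 + (r.-1 + k - j))%N%:Z by lia.
rewrite raisingE; apply: filtD.
  by apply: filt_le (raising_le _); lia.
have [jk'|kj] := ltnP j k; first by rewrite w_out ?scale0r; [exact: filt0 | lia].
by apply/filtZ/m_filt; lia.
Qed.

Lemma filt_raising d k m : filt d m -> filt (d - k) (raising k m).
Proof.
elim=> [|a s {}m s0 sd _ IH]; first by rewrite raising0; exact: filt0.
rewrite raisingD raisingZ; apply: filtD => //; apply: filtZ.
rewrite -[raising _ _](subrK (leading k s)); apply: filtD.
  by apply: filt_le (raising_word k s0); lia.
by apply: filt_le (filt_leading k s0); lia.
Qed.

Lemma geq_trans : transitive geq.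
Proof. by move=> a b c ab bc; exact: leq_trans bc ab. Qed.

(** In a sorted word equal letters are adjacent, so deleting any one of the k's gives the same word
    and the contributions add up to the multiplicity. *)
Lemma leading_partition k s : sorted geq s ->
  leading k s = ((count_mem k s)%:R * ((2 * k)%:R * w (2 * r - 2))) *: word (rem k s).
Proof.
elim: s => [|j s IH] //= js; first by rewrite mul0r scale0r.
rewrite (IH (path_sorted js)) linearZ /=.
have [jk|jk] := eqVneq j k; last by rewrite add0r add0n.
rewrite jk in js *; have [ks|ks] := boolP (k \in s); last first.
  by rewrite (count_memPn ks) mul0r scale0r addr0 mul1r.
suff -> : lower k (word (rem k s)) = word s by rewrite -scalerDl natrD mulrDl mul1r.
case: s js ks {IH} => // i s js; rewrite inE => ks /=.
case: eqVneq => [-> //|ik]; move: ks; rewrite eq_sym (negbTE ik) /= => ks.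
have /andP[ki /(order_path_min geq_trans)/allP/(_ k ks)] : (i <= k)%N && path geq i s by [].
by rewrite /= => ki'; move: ik; rewrite eqn_leq ki ki'.
Qed.

Definition raisings (t : seq nat) (m : M) : M := foldl (fun m k => raising k m) m t.

Lemma raisingsD t m n : raisings t (m + n) = raisings t m + raisings t n.
Proof. by elim: t m n => //= k t IH m n; rewrite raisingD IH. Qed.
Lemma raisingsZ t a m : raisings t (a *: m) = a *: raisings t m.
Proof. by elim: t m => //= k t IH m; rewrite raisingZ IH. Qed.
Lemma raisings0 t : raisings t 0 = 0.
Proof. by elim: t => //= k t; rewrite raising0. Qed.
Lemma raisings_sum t (I : Type) (s : seq I) (P : pred I) (f : I -> M) :
  raisings t (\sum_(i <- s | P i) f i) = \sum_(i <- s | P i) raisings t (f i).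
Proof. exact: (big_morph _ (raisingsD t) (raisings0 t)). Qed.

Lemma raisings_filt t d m : (d <= sumn t)%N -> filt d m -> raisings t m = 0.
Proof.
elim: t d m => [|k t IH] d m /=.
  by rewrite leqn0 => /eqP -> /filt_zero.
by move=> dt /(filt_raising k); apply: IH; rewrite leq_subLR.
Qed.

(** In equal weight only symbols survive, and there the operators act as derivatives on a monomial:
    a full set of derivatives is nonzero exactly when it matches the monomial as a multiset. *)
Lemma raisings_partition t mu : is_partition mu -> 0%N \notin t -> sumn t = sumn mu ->
  exists2 a : F, raisings t (word mu) = a *: v0 & (a != 0) = perm_eq t mu.
Proof.
elim: t mu => [|k t IH] mu /andP[smu mu0] t0 /= tmu.
  case: mu smu mu0 tmu => [|[|j] mu] //= _ _ _.
  by exists 1; rewrite ?scale1r // oner_neq0.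
have [k0 {}t0] : (0 < k)%N /\ 0%N \notin t.
  by move: t0; rewrite inE negb_or lt0n eq_sym => /andP.
have -> : raising k (word mu) = leading k mu + (raising k (word mu) - leading k mu).
  by rewrite addrC subrK.
rewrite raisingsD (raisings_filt _ (raising_word k mu0)) ?addr0; last by lia.
rewrite leading_partition // raisingsZ.
have [kmu|kmu] := boolP (k \in mu); last first.
  exists 0; first by rewrite (count_memPn kmu) mul0r !scale0r.
  rewrite eqxx; apply/esym/negbTE/negP => /perm_mem/(_ k).
  by rewrite inE eqxx (negbTE kmu).
have rmu : is_partition (rem k mu).
  apply/andP; split; first exact: (subseq_sorted geq_trans (rem_subseq k mu)).
  by apply/negP => /mem_rem; exact/negP.
have srem : sumn mu = (k + sumn (rem k mu))%N by rewrite (perm_sumn (perm_to_rem kmu)).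
have [|a -> aP] := IH _ rmu t0; first by lia.
eexists; first by rewrite scalerA.
rewrite (permPr (perm_to_rem kmu)) perm_cons -aP !mulf_eq0 !negb_or w_top andbT.
have -> : (count_mem k mu)%:R != 0 :> F.
  have : (0 < count_mem k mu)%N by rewrite -has_count has_pred1.
  by case: (count_mem k mu) => // n _; exact: char0.
suff -> : (2 * k)%:R != 0 :> F by [].
by case: k k0 {t0 kmu rmu srem aP IH tmu} => // k _; exact: char0.
Qed.

Section WhittakerVectors.
Hypothesis spanning : forall m : M, exists s (a : seq nat -> F),
  all is_partition s /\ m = \sum_(la <- s) a la *: word la.
Hypothesis independent : forall (s : seq (seq nat)) (a : seq nat -> F),
  uniq s -> all is_partition s -> \sum_(la <- s) a la *: word la = 0 ->
  forall la, la \in s -> a la = 0.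
Local Notation crd := (coord spanning).

(** Coordinates are killed from the heaviest partition downward. Applying [raisings la] to [u]
    isolates the coordinate at [la]: heavier partitions have been dealt with, lighter ones are
    annihilated by the filtration, and others of the same weight do not pair with [la]. *)
Lemma whittaker_vector (u : M) : v0 != 0 -> (forall k, (0 < k)%N -> raising k u = 0) ->
  u = crd [::] u *: v0.
Proof.
move=> v0_neq0 hu; have [s [us gs hs uE]] := coord_decomposition spanning u.
have part0 : is_partition [::] by [].
suff coord_eq0 la : la != [::] -> crd la u = 0.
  rewrite {1}uE; have [es|es] := boolP ([::] \in s).
    by rewrite (bigD1_seq [::]) //= big1 ?addr0 // => la /coord_eq0 ->; rewrite scale0r.
  rewrite (hs _ es) scale0r big_seq big1 // => la las.
  by rewrite coord_eq0 ?scale0r //; apply: contraNneq es => <-.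
pose bnd := \max_(mu <- s) sumn mu.
have [d] := ubnP (bnd - sumn la); elim: d la => // d IH la lad la0.
have [las|/hs //] := boolP (la \in s).
have /andP[sla la_pos] := allP gs _ las.
have [a aE a_neq0] := raisings_partition (allP gs _ las) la_pos erefl.
rewrite perm_refl in a_neq0.
have : raisings la u = (crd la u * a) *: v0.
  rewrite {1}uE raisings_sum (bigD1_seq la) //= raisingsZ aE scalerA.
  rewrite big_seq_cond big1 ?addr0 // => mu /andP[mus mu_la]; rewrite raisingsZ.
  have /andP[smu mu_pos] := allP gs _ mus.
  have [lt|lt|e] := ltngtP (sumn mu) (sumn la).
  - by rewrite (raisings_filt (leqnn _) (filt_word mu_pos lt)) scaler0.
  - rewrite IH ?scale0r //; last by case: mu lt {mus mu_la smu mu_pos}.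
    have : (sumn mu <= bnd)%N by exact: (@leq_bigmax_seq _ s xpredT sumn mu mus).
    by move: lad lt; move: (sumn mu) (sumn la) (bnd) => x y z; clear -d; lia.
  have [b -> bE] := raisings_partition (allP gs _ mus) la_pos (esym e).
  suff /eqP -> : b == 0 by rewrite scale0r scaler0.
  rewrite -[_ == _]negbK bE; apply: contra mu_la => pe; apply/eqP.
  apply: (sorted_eq geq_trans _ smu sla); last by rewrite perm_sym.
  by move=> x y /= /andP[yx xy]; apply/eqP; rewrite eqn_leq yx xy.
have -> : raisings la u = 0.
  case: la la0 la_pos {las sla lad aE} => // k t _; rewrite inE negb_or => /andP[k0 _] /=.
  by rewrite hu ?raisings0 // lt0n eq_sym.
move/esym/eqP; rewrite scaler_eq0 (negbTE v0_neq0) orbF mulf_eq0 (negbTE a_neq0) orbF.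
by move/eqP.
Qed.

End WhittakerVectors.

End Whittaker.

(** * The PBW lattice over a subring of coefficients *)

Section Lattice.
Hypothesis spanning : forall m : M, exists s (a : seq nat -> F),
  all is_partition s /\ m = \sum_(la <- s) a la *: word la.
Hypothesis independent : forall (s : seq (seq nat)) (a : seq nat -> F),
  uniq s -> all is_partition s -> \sum_(la <- s) a la *: word la = 0 ->
  forall la, la \in s -> a la = 0.
Local Notation crd := (coord spanning).

Variable B : F -> Prop.
Hypotheses (B1 : B 1) (BB : forall x y, B x -> B y -> B (x - y)).
Hypothesis BM : forall x y, B x -> B y -> B (x * y).
Hypotheses (Bcc : B cc) (Bw : forall n, (r.-1 <= n)%N -> B (w n)).

Definition lattice (m : M) : Prop := forall la, B (crd la m).
(** The length bound is what the reordering induction runs on: exchanging two generators costs words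
    with one or two letters fewer. *)
Definition lattice_le (N : nat) (m : M) : Prop :=
  forall la, B (crd la m) /\ ((N < size la)%N -> crd la m = 0).

Let B0 : B 0 := subP0 B1 BB.

Lemma lattice_leD N m n : lattice_le N m -> lattice_le N n -> lattice_le N (m + n).
Proof.
move=> hm hn la; have [Bm cm] := hm la; have [Bn cn] := hn la.
rewrite (coordD spanning independent); split; first exact: (subPD B1 BB).
by move=> Nla; rewrite cm // cn // addr0.
Qed.

Lemma lattice_leZ N a m : B a -> lattice_le N m -> lattice_le N (a *: m).
Proof.
move=> Ba hm la; have [Bm cm] := hm la; rewrite (coordZ spanning independent).
by split=> [|Nla]; [exact: BM | rewrite cm // mulr0].
Qed.

Lemma lattice_le0 N : lattice_le N 0.
Proof. by move=> la; rewrite (coord0 spanning independent). Qed.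

Lemma lattice_leS N P m : (N <= P)%N -> lattice_le N m -> lattice_le P m.
Proof.
move=> NP hm la; have [Bm cm] := hm la; split=> // Pla.
by apply: cm; apply: leq_ltn_trans Pla.
Qed.

Lemma lattice_le_sum N (I : Type) (s : seq I) (P : pred I) (f : I -> M) :
  (forall i, P i -> lattice_le N (f i)) -> lattice_le N (\sum_(i <- s | P i) f i).
Proof.
move=> hf; apply: (big_ind (lattice_le N)) => //; [exact: lattice_le0|].
by move=> x y; exact: lattice_leD.
Qed.

Lemma lattice_le_word N la : is_partition la -> (size la <= N)%N -> lattice_le N (word la).
Proof.
move=> pla laN mu; rewrite (coord_basis spanning independent) //; split.
  by case: eqP => _; [exact: B1 | exact: B0].
by case: eqP => // -> ; rewrite ltnNge laN.
Qed.

Definition letters (s : seq int) : M := foldr (fun p v => L p v) v0 s.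

Lemma letters_cat_linear (s : seq int) a (t1 t2 : seq int) (m : M) :
  letters t1 = a *: letters t2 + m ->
  letters (s ++ t1) = a *: letters (s ++ t2) + foldr (fun p v => L p v) m s.
Proof. by elim: s => //= p s IH /IH ->; rewrite linearP. Qed.

Lemma lattice_swap N s p q t : (size s + size t).+2 = N ->
  (forall z, (size z < N)%N -> lattice_le N (letters z)) ->
  lattice_le N (letters (s ++ q :: p :: t)) -> lattice_le N (letters (s ++ p :: q :: t)).
Proof.
move=> sN low hqp.
pose C := if p + q == 0 then cc * (p ^+ 3 - p)%:~R else 0.
have e : letters (s ++ p :: q :: t) = 1 *: letters (s ++ q :: p :: t)
    + ((p - q)%:~R *: letters (s ++ (p + q) :: t) + C *: letters (s ++ t)).
  have vir1 : letters (p :: q :: t) = 1 *: letters (q :: p :: t)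
      + ((p - q)%:~R *: letters ((p + q) :: t) + C *: letters t).
    rewrite scale1r addrC; apply/eqP; rewrite -subr_eq; apply/eqP.
    by rewrite [LHS]vir /C; congr (_ + _); case: ifP; rewrite ?scale0r.
  rewrite (letters_cat_linear s vir1); congr (_ + _).
  elim: s {sN hqp} => //= x s ->; by rewrite linearD !linearZ.
rewrite e scale1r; apply: lattice_leD => //; apply: lattice_leD.
  apply: lattice_leZ; first exact: (subP_int B1 BB).
  by apply: low; rewrite size_cat /=; lia.
apply: lattice_leZ; last by apply: low; rewrite size_cat /=; lia.
rewrite /C; case: ifP => // _; apply: BM => //; exact: (subP_int B1 BB).
Qed.

Lemma lattice_move N s0 s1 s2 p : (size (s0 ++ p :: s1 ++ s2) = N)%N ->
  (forall z, (size z < N)%N -> lattice_le N (letters z)) ->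
  lattice_le N (letters (s0 ++ s1 ++ p :: s2)) -> lattice_le N (letters (s0 ++ p :: s1 ++ s2)).
Proof.
move=> sN low; elim: s1 s0 sN => //= q s1 IH s0 sN hyp.
apply: lattice_swap => //; first by rewrite -sN !size_cat /= size_cat; lia.
rewrite -cat_rcons; apply: IH; last by rewrite cat_rcons.
by rewrite -sN !size_cat size_rcons /= size_cat; lia.
Qed.

Lemma sorted_insert k (la : seq nat) : sorted geq la ->
  exists s1 s2, la = s1 ++ s2 /\ sorted geq (s1 ++ k :: s2).
Proof.
elim: la => [|j la IH] /= jla; first by exists [::], [::].
have [jk|kj] := leqP j k; first by exists [::], (j :: la); rewrite /= jk.
have [s1 [s2 [e ss]]] := IH (path_sorted jla); exists (j :: s1), s2; rewrite {1}e; split=> //=.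
rewrite (path_sortedE geq_trans) ss andbT.
have := order_path_min geq_trans jla; rewrite e !all_cat /= (ltnW kj).
by case/andP => -> ->.
Qed.

Lemma letters_word la : letters [seq r.-1%:Z - (k : nat)%:Z | k <- la] = word la.
Proof. by elim: la => //= k la ->. Qed.

(* Reordering a word costs only shorter words, with coefficients in [B]. *)
Lemma letters_lattice N s : (size s <= N)%N -> lattice_le N (letters s).
Proof.
have [d] := ubnP N; elim: d N s => // d IH N s Nd sN.
have low P z : (P < N)%N -> (size z <= P)%N -> lattice_le P (letters z).
  by move=> PN zP; apply: IH => //; apply: leq_trans PN _.
have low' z : (size z < N)%N -> lattice_le N (letters z).
  by move=> zN; apply: lattice_leS (low _ _ zN (leqnn _)); exact: ltnW.
case: s sN => [|p s] sN; first exact: (@lattice_le_word _ [::]).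
rewrite [letters _]/= -/(letters s).
(* By induction the tail is already a [B]-combination of partitions that are no longer than [s], so
   a single letter [p] remains to be placed. *)
have [t [ut gt ht ->]] := coord_decomposition spanning (letters s).
rewrite linear_sum /=; rewrite big_seq; apply: lattice_le_sum => la /(allP gt) /andP[sla la0].
have /(_ la)[Bla cla] := low _ _ sN (leqnn (size s)).
have [las|/cla ->] := leqP (size la) (size s); last first.
  by rewrite scale0r linear0; exact: lattice_le0.
rewrite linearZ; apply: lattice_leZ => //.
rewrite -letters_word.
rewrite -[X in lattice_le _ X]/(letters (p :: [seq r.-1%:Z - (k : nat)%:Z | k <- la])).
have [laN|Nla] := ltnP (size la).+1 N; first by apply: low'; rewrite /= size_map.
have szN : (size la).+1 = N by apply/eqP; rewrite eqn_leq Nla (leq_trans _ sN).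
have [pr|rp] := ltP p r.-1%:Z.
  have [k k0 ->] : exists2 k : nat, (0 < k)%N & p = r.-1%:Z - k%:Z.
    by exists (absz (r.-1%:Z - p)); lia.
  have [s1 [s2 [e ss]]] := sorted_insert k sla.
  rewrite e map_cat; apply: (@lattice_move _ [::]) => //.
    by rewrite -map_cat -e /= size_map.
  rewrite cat0s; have -> : [seq r.-1%:Z - (i : nat)%:Z | i <- s1] ++
      (r.-1%:Z - k%:Z) :: [seq r.-1%:Z - (i : nat)%:Z | i <- s2]
    = [seq r.-1%:Z - (i : nat)%:Z | i <- s1 ++ k :: s2] by rewrite map_cat.
  rewrite letters_word; apply: lattice_le_word.
    apply/andP; split => //; move: la0; rewrite e !mem_cat inE !negb_or => /andP[-> ->].
    by rewrite andbT neq_ltn k0.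
  by rewrite size_cat /= addnS -size_cat -e szN.
(* A generator with p >= r - 1 is moved to the right end, where it acts on [v0] by its weight. *)
have [n rn ->] : exists2 n : nat, (r.-1 <= n)%N & p = n%:Z.
  by exists (absz p); lia.
rewrite -[map _ la]cats0; apply: (@lattice_move _ [::]) => //.
  by rewrite cats0 /= size_map.
have e1 : letters [:: n%:Z] = w n *: letters [::] + 0 by rewrite addr0 /= L_v0.
rewrite cat0s (letters_cat_linear _ e1) cats0 letters_word.
have -> : forall z, foldr (fun p v => L p v) 0 z = 0 :> M.
  by elim=> //= x z ->; rewrite linear0.
rewrite addr0; apply: lattice_leZ; first exact: Bw.
by apply: lattice_le_word; [apply/andP | exact: leq_trans las (ltnW sN)].
Qed.

Lemma lattice_of_le N m : lattice_le N m -> lattice m.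
Proof. by move=> hm la; case: (hm la). Qed.

Lemma latticeZ a m : B a -> lattice m -> lattice (a *: m).
Proof. by move=> Ba hm la; rewrite (coordZ spanning independent); exact: BM. Qed.
Lemma latticeB m n : lattice m -> lattice n -> lattice (m - n).
Proof.
by move=> hm hn la; rewrite (coordD spanning independent) (coordN spanning independent); exact: BB.
Qed.
Lemma lattice0 : lattice 0.
Proof. by move=> la; rewrite (coord0 spanning independent). Qed.
Lemma latticeD m n : lattice m -> lattice n -> lattice (m + n).
Proof.
move=> hm hn; rewrite -[n]opprK; apply: latticeB => //.
by rewrite -sub0r; apply: latticeB => //; exact: lattice0.
Qed.
Lemma lattice_sum (I : Type) (s : seq I) (P : pred I) (f : I -> M) :
  (forall i, P i -> lattice (f i)) -> lattice (\sum_(i <- s | P i) f i).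
Proof.
move=> hf; apply: (big_ind lattice) => //; [exact: lattice0|].
by move=> x y; exact: latticeD.
Qed.

Lemma lattice_word la : lattice (word la).
Proof. by rewrite -letters_word; apply: lattice_of_le (letters_lattice (leqnn _)). Qed.

Lemma lattice_v0 : lattice v0. Proof. exact: (lattice_word [::]). Qed.

Lemma lattice_L p m : lattice m -> lattice (L p m).
Proof.
move=> hm; have [s [us gs hs ->]] := coord_decomposition spanning m.
rewrite linear_sum; apply: lattice_sum => la _ /=; rewrite linearZ; apply: latticeZ => //.
rewrite -letters_word.
rewrite -[X in lattice X]/(letters (p :: [seq r.-1%:Z - (k : nat)%:Z | k <- la])).
exact: lattice_of_le (letters_lattice (leqnn _)).
Qed.

End Lattice.

(** * The parameter derivations of the module *)

Section Deformation.
Hypothesis spanning : forall m : M, exists s (a : seq nat -> F),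
  all is_partition s /\ m = \sum_(la <- s) a la *: word la.
Hypothesis char0 : forall n : nat, (n.+1%:R : F) != 0.
Variables (c : nat -> F) (d : 'I_r.-1 -> F -> F) (dM : 'I_r.-1 -> M -> M).
Hypotheses (hd : forall j, derivation (d j)) (d_cc : forall j, d j cc = 0).
Hypothesis dc : forall j k, d j (c k) = (k == j.+1)%:R.
Hypothesis dC : forall i j x, d i (d j x) = d j (d i x).
Hypotheses (c_out : forall k, (r.-1 < k)%N -> c k = 0) (c_top : c r.-1 != 0).
Hypothesis dMD : forall j u v, dM j (u + v) = dM j u + dM j v.
Hypothesis dMZ : forall j a v, dM j (a *: v) = d j a *: v + a *: dM j v.
Hypothesis dM_lower : forall j (p : int) v, p < r.-1%:Z -> dM j (L p v) = L p (dM j v).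

Definition frame (n j : nat) : F := j.+1%:R * c (n + j.+1).
Definition frame_der (n : nat) (x : F) : F := \sum_(j < r.-1) frame n j * d j x.
Definition frame_vec (n : nat) (m : M) : M := \sum_(j < r.-1) frame n j *: dM j m.

Hypothesis L_low : forall i : nat, (i < r.-1)%N -> L i%:Z v0 = w i *: v0 + frame_vec i v0.
Hypothesis w_cocycle : forall n m,
  frame_der n (w m) - frame_der m (w n) = (m%:R - n%:R) * w (m + n).

Lemma frame_out i j : (r.-1 <= i + j)%N -> frame i j = 0.
Proof. by move=> ij; rewrite /frame c_out ?mulr0 // addnS ltnS. Qed.

Lemma frame_diag j : (j < r.-1)%N -> frame (r.-1 - j.+1) j = j.+1%:R * c r.-1.
Proof. by move=> jr; rewrite /frame subnK. Qed.

(** The frame matrix is anti-triangular with antidiagonal entries (j+1) c_(r-1), which is why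
    inverting c_(r-1) turns the D_n into a frame. *)
Lemma frame_solve (B : F -> Prop) (Z : M -> Prop) (x : 'I_r.-1 -> M) :
  Z 0 -> (forall u v, Z u -> Z v -> Z (u - v)) -> (forall a u, B a -> Z u -> Z (a *: u)) ->
  (forall i j, B (frame i j)) -> (forall j, B (j.+1%:R * c r.-1)^-1) ->
  (forall i, (i < r.-1)%N -> Z (\sum_(j < r.-1) frame i j *: x j)) -> forall j, Z (x j).
Proof.
move=> Z0 ZB ZZ Bf BfV; apply: (antitriangular_solve Z0 ZB ZZ (fun i j _ => @frame_out i j)) => //.
  by move=> j jr; rewrite frame_diag // unitfE mulf_neq0 ?char0.
by move=> j jr; rewrite frame_diag.
Qed.

Lemma frame_eq0 (x : 'I_r.-1 -> M) :
  (forall i, (i < r.-1)%N -> \sum_(j < r.-1) frame i j *: x j = 0) -> forall j, x j = 0.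
Proof.
apply: (@frame_solve (fun=> True) (fun m => m = 0)) => //.
  by move=> u v -> ->; rewrite subrr.
by move=> a u _ ->; rewrite scaler0.
Qed.

Lemma frame_der_out n x : (r.-1 <= n)%N -> frame_der n x = 0.
Proof.
move=> rn; apply: big1 => j _; rewrite frame_out ?mul0r //.
exact: leq_trans rn (leq_addr _ _).
Qed.
Lemma frame_vec_out n m : (r.-1 <= n)%N -> frame_vec n m = 0.
Proof.
move=> rn; apply: big1 => j _; rewrite frame_out ?scale0r //.
exact: leq_trans rn (leq_addr _ _).
Qed.

(** The eigenvalue equations and the deformation equations become one formula, as D_n = 0 for n >= r
    - 1. *)
Lemma L_v0_frame n : L n%:Z v0 = w n *: v0 + frame_vec n v0.
Proof.
have [nr|rn] := ltnP n r.-1; first exact: L_low.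
by rewrite frame_vec_out // addr0 L_v0.
Qed.

Lemma dM0 j : dM j 0 = 0.
Proof. by apply: (addrI (dM j 0)); rewrite -dMD !addr0. Qed.
Lemma dM_sum j (I : Type) (s : seq I) (P : pred I) (f : I -> M) :
  dM j (\sum_(i <- s | P i) f i) = \sum_(i <- s | P i) dM j (f i).
Proof. exact: (big_morph (dM j) (dMD j) (dM0 j)). Qed.

Lemma frame_vecD n u v : frame_vec n (u + v) = frame_vec n u + frame_vec n v.
Proof. by rewrite -big_split; apply: eq_bigr => j _; rewrite dMD scalerDr. Qed.
Lemma frame_vecZ n a m : frame_vec n (a *: m) = frame_der n a *: m + a *: frame_vec n m.
Proof.
rewrite /frame_vec /frame_der scaler_suml scaler_sumr -big_split; apply: eq_bigr => j _.
by rewrite dMZ scalerDr !scalerA [a * _]mulrC.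
Qed.
Lemma vir_frame (p i : nat) : (i < r.-1 <= p)%N ->
  L p%:Z (L i%:Z v0) = L i%:Z (L p%:Z v0) + (p%:R - i%:R) *: L (p + i)%N%:Z v0.
Proof.
move=> ip; apply/eqP; rewrite addrC -subr_eq vir; apply/eqP.
by rewrite ifF ?addr0 ?rmorphB //; lia.
Qed.

(* For [r.-1 <= p], contracting the commutators of [dM j] and [L p] at [v0] with [frame i] gives
   [D_i w_p - (p - i) w_(p+i)], which is [D_p w_i = 0] by the cocycle identity. *)
Lemma dM_L_v0 j (p : int) : dM j (L p v0) = L p (dM j v0).
Proof.
have [pr|rp] := ltP p r.-1%:Z; first exact: dM_lower.
have [n rn ->] : exists2 n : nat, (r.-1 <= n)%N & p = n%:Z by exists (absz p); lia.
apply/eqP; rewrite -subr_eq0; apply/eqP; move: j.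
apply: (@frame_eq0 (fun j => dM j (L n%:Z v0) - L n%:Z (dM j v0))) => i ir.
under eq_bigr => j _ do rewrite scalerBr -[frame i j *: L _ _]linearZ.
rewrite big_split /= sumrN -linear_sum -/(frame_vec i _) -/(frame_vec i _).
have fi : frame_vec i v0 = L i%:Z v0 - w i *: v0.
  by rewrite L_v0_frame addrC addKr.
rewrite (L_v0 rn) frame_vecZ fi [L n%:Z (_ - _)]linearB [L n%:Z (_ *: _)]linearZ.
rewrite vir_frame ?ir // (L_v0 rn) (L_v0 (leq_trans rn (leq_addr _ _))).
rewrite [L i%:Z (_ *: _)]linearZ /= !scalerA -w_cocycle (frame_der_out _ rn) subr0 scalerBr scalerA.
apply/eqP; rewrite subr_eq0; apply/eqP.
by rewrite [LHS]addrC -addrA [- _ + _]addrC addrA [w i * _]mulrC.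
Qed.

(** Moving [L p] past the first letter, with which [dM j] commutes, creates only structure constants
    killed by [d j], so the claim passes to the shorter word. *)
Lemma dM_L_word j (p : int) la : 0%N \notin la -> dM j (L p (word la)) = L p (dM j (word la)).
Proof.
elim: la p => [|k la IH] p; first by move=> _; exact: dM_L_v0.
rewrite inE negb_or => /andP[k0 la0]; pose q := r.-1%:Z - k%:Z.
have qr : q < r.-1%:Z by rewrite /q; move: k0; rewrite eq_sym -lt0n; lia.
pose m := word la; rewrite [word _]/= -/q -/m.
have swap u : L p (L q u) = L q (L p u) + ((p - q)%:~R *: L (p + q) u
    + (if p + q == 0 then cc * (p ^+ 3 - p)%:~R else 0) *: u).
  apply/eqP; rewrite addrC -subr_eq vir; apply/eqP.
  by congr (_ + _); case: ifP; rewrite ?scale0r.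
have dC0 : d j (if p + q == 0 then cc * (p ^+ 3 - p)%:~R else 0) = 0.
  by case: ifP; rewrite ?(der0 (hd j)) // (derM (hd j)) d_cc (der_int (hd j)) mul0r mulr0 addr0.
rewrite (dM_lower j m qr) !swap !dMD !dMZ dC0 (der_int (hd j)) !scale0r !add0r.
by rewrite (dM_lower j _ qr) !IH.
Qed.

Lemma dM_L j (p : int) m : dM j (L p m) = L p (dM j m).
Proof.
have [s [a [gs ->]]] := spanning m.
rewrite !linear_sum !dM_sum linear_sum [LHS]big_seq [RHS]big_seq.
apply: eq_bigr => la /(allP gs) /andP[_ la0].
by rewrite linearZ !dMZ linearD !linearZ dM_L_word.
Qed.

Lemma frame_vec_L n p m : frame_vec n (L p m) = L p (frame_vec n m).
Proof.
by rewrite linear_sum; apply: eq_bigr => j _; rewrite dM_L linearZ.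
Qed.

Lemma frame_der_c n k : (k <= r.-1)%N -> frame_der n (c k) = k%:R * c (n + k).
Proof.
case: k => [|k] kr; rewrite /frame_der.
  by rewrite mul0r big1 // => j _; rewrite dc mulr0.
rewrite (bigD1 (Ordinal kr)) //= dc eqxx mulr1 big1 ?addr0 // => j jk.
by rewrite dc eqSS (_ : (k == j) = false) ?mulr0 //; apply: negbTE; rewrite eq_sym.
Qed.

Lemma frame_der_frame n m j : (j < r.-1)%N ->
  frame_der n (frame m j) - frame_der m (frame n j) = (m%:R - n%:R) * frame (m + n) j.
Proof.
have der_frame n' m' : frame_der n' (frame m' j)
    = j.+1%:R * (m' + j.+1)%:R * c (n' + m' + j.+1).
  transitivity (j.+1%:R * frame_der n' (c (m' + j.+1))).
    by rewrite /frame_der mulr_sumr; apply: eq_bigr => i _; rewrite (der_natM (hd i)) mulrCA.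
  have [mr|rm] := leqP (m' + j.+1) r.-1.
    by rewrite frame_der_c // mulrA addnA.
  rewrite (c_out rm) /frame_der big1 ?mulr0; last by move=> i _; rewrite (der0 (hd i)) mulr0.
  by rewrite c_out ?mulr0 //; lia.
rewrite !der_frame /frame [(n + m)%N]addnC !natrD.
rewrite -!mulrA -mulrBr -mulrBl opprD addrACA subrr addr0.
by rewrite mulrCA.
Qed.

Lemma frame_vec_frame_vec n m u : frame_vec n (frame_vec m u)
  = \sum_(k < r.-1) frame_der n (frame m k) *: dM k u
    + \sum_(k < r.-1) frame m k *: \sum_(j < r.-1) frame n j *: dM j (dM k u).
Proof.
transitivity (\sum_(k < r.-1) frame_vec n (frame m k *: dM k u)).
  rewrite /frame_vec exchange_big; apply: eq_bigr => j _ /=.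
  by rewrite dM_sum scaler_sumr.
by rewrite -big_split; apply: eq_bigr => k _; rewrite frame_vecZ.
Qed.

(** Since D commutes with the generators, L_m L_n v_0 = (w_n + D_n)(w_m + D_m) v_0 with the order
    reversed. The Virasoro relation thus becomes a relation among the D_n, and the weight cocycle
    removes the multiples of v_0. *)
Lemma frame_vec_bracket_v0 n m :
  frame_vec n (frame_vec m v0) - frame_vec m (frame_vec n v0)
  = (m%:R - n%:R) *: frame_vec (m + n) v0.
Proof.
have LL i j : L i%:Z (L j%:Z v0) = (w i * w j) *: v0 + (w j *: frame_vec i v0
    + w i *: frame_vec j v0) + (frame_der j (w i) *: v0 + frame_vec j (frame_vec i v0)).
  rewrite L_v0_frame linearD linearZ /= -frame_vec_L L_v0_frame frame_vecD frame_vecZ.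
  rewrite scalerDr scalerA mulrC -!addrA; congr (_ + (_ + _)).
  by rewrite addrCA.
have : L m%:Z (L n%:Z v0) - L n%:Z (L m%:Z v0)
    = (m%:R - n%:R) *: L (m + n)%N%:Z v0.
  rewrite vir rmorphB /=; case: ifP => [/eqP mn0|_]; last by rewrite addr0.
  have [-> ->] : m = 0%N /\ n = 0%N by lia.
  have -> : (0%N%:Z : int) ^+ 3 - 0%N%:Z = 0 by [].
  by rewrite mulr0 scale0r addr0.
rewrite !LL L_v0_frame scalerDr scalerA -w_cocycle.
rewrite [w n * w m]mulrC [w m *: _ + _]addrC => e.
apply: (addrI ((frame_der n (w m) - frame_der m (w n)) *: v0)); rewrite -e.
set x := _ + (_ + _); rewrite opprD [in RHS]addrACA subrr add0r opprD addrACA scalerBl.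
by [].
Qed.

(** As vector fields the D_n have the same bracket as found on v_0, so first-order terms cancel and
    the curvature contracted with any two members of the frame vanishes; the frame is nondegenerate
    in each slot. *)
Lemma curvature_v0 j k : dM j (dM k v0) = dM k (dM j v0).
Proof.
pose K (j k : 'I_r.-1) := dM j (dM k v0) - dM k (dM j v0).
have e n m : \sum_(k < r.-1) frame m k *: \sum_(j < r.-1) frame n j *: K j k = 0.
  have := frame_vec_bracket_v0 n m; rewrite !frame_vec_frame_vec.
  rewrite opprD addrACA -sumrB.
  under eq_bigr => i _ do rewrite -scalerBl frame_der_frame // -scalerA.
  rewrite -scaler_sumr -/(frame_vec _ _) -[RHS]addr0 => /addrI e.
  rewrite -[RHS]e; under eq_bigr => i _.
    under eq_bigr => l _ do rewrite scalerBr.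
    rewrite big_split sumrN scalerBr; over.
  rewrite sumrB; congr (_ - _).
  under eq_bigr do rewrite scaler_sumr.
  rewrite exchange_big; apply: eq_bigr => i _; rewrite /= scaler_sumr.
  by apply: eq_bigr => l _; rewrite !scalerA mulrC.
apply/eqP; rewrite -subr_eq0; apply/eqP; rewrite -/(K j k).
move: j; apply: (@frame_eq0 (K^~ k)) => n nr; move: k.
by apply: (@frame_eq0 (fun k => \sum_(j < r.-1) frame n j *: K j k)) => m mr; exact: e.
Qed.

Lemma curvature_word j k la : dM j (dM k (word la)) = dM k (dM j (word la)).
Proof.
elim: la => [|q la IH]; first exact: curvature_v0.
by rewrite /= !dM_L IH.
Qed.

Lemma dM_commute j k m : dM j (dM k m) = dM k (dM j m).
Proof.
have [s [a [gs ->]]] := spanning m.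
rewrite !dM_sum; apply: eq_bigr => la _.
rewrite !dMZ !dMD !dMZ dC curvature_word -!addrA; congr (_ + _).
by rewrite addrCA.
Qed.

Section DerivedLattice.
Hypothesis independent : forall (s : seq (seq nat)) (a : seq nat -> F),
  uniq s -> all is_partition s -> \sum_(la <- s) a la *: word la = 0 ->
  forall la, la \in s -> a la = 0.
Variable B : F -> Prop.
Hypotheses (B1 : B 1) (BB : forall x y, B x -> B y -> B (x - y)).
Hypothesis BM : forall x y, B x -> B y -> B (x * y).
Hypotheses (Bcc : B cc) (Bw : forall n, B (w n)) (Bc : forall k, B (c k)).
Hypothesis BcV : forall j : nat, B (j.+1%:R * c r.-1)^-1.
Hypothesis Bd : forall j x, B x -> B (d j x).

Local Notation lat := (lattice spanning B).

Lemma lattice_dM_v0 j : lat (dM j v0).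
Proof.
have Zv0 : lat v0 by apply: lattice_v0.
move: j; apply: (@frame_solve B lat) => //.
- exact: lattice0.
- by move=> u v; apply: latticeB.
- by move=> a u; apply: latticeZ.
- by move=> i j; apply: BM => //; exact: (subP_nat B1 BB).
move=> i ir; rewrite -/(frame_vec i v0).
have -> : frame_vec i v0 = L i%:Z v0 - w i *: v0 by rewrite L_v0_frame addrC addKr.
by apply: latticeB => //; [apply: lattice_L | apply: latticeZ].
Qed.

Lemma lattice_dM j m : lat m -> lat (dM j m).
Proof.
move=> hm; have [s [us gs hs ->]] := coord_decomposition spanning m.
rewrite dM_sum; apply: lattice_sum => // la _; rewrite dMZ.
apply: latticeD => //; first by apply: latticeZ => //; [exact/Bd/hm | exact: lattice_word].
apply: latticeZ => //; elim: la => [|k la IH]; first exact: lattice_dM_v0.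
by rewrite /= dM_L; apply: lattice_L.
Qed.
End DerivedLattice.
End Deformation.

End IrregularVerma.

(** * Gauge operators and their defects *)

Section OperatorCocycle.
Variables (A : comNzRingType) (n : nat) (dA : nat -> A -> A) (tau : nat -> A) (u : nat -> nat -> A).
Variable x : nat -> A.
Hypothesis hd : forall j, derivation (dA j).
Hypothesis dx : forall j k, (j < n)%N -> (k < n)%N -> dA j (x k) = if j == k then 1 else 0.

Local Notation V i a := (\sum_(j < n) u i j * dA j a).
Local Notation C i a := (tau i * a + V i a).

Hypothesis C_bracket : forall i l a, C i (C l a) - C l (C i a) = (l%:R - i%:R) * C (i + l)%N a.

Lemma operator_tau_cocycle i l : V i (tau l) - V l (tau i) = (l%:R - i%:R) * tau (i + l)%N.
Proof.
have V1 a : V a 1 = 0 by apply: big1 => j _; rewrite (der1 (hd j)) mulr0.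
have := C_bracket i l 1; rewrite !V1 !mulr1 !addr0 => <-.
by rewrite [tau l * _]mulrC opprD addrACA subrr add0r.
Qed.

(** Evaluating the operator relation at 1 isolates [tau]; evaluating it at the coordinate function
    [x k] and subtracting the [tau] part isolates the k-th components of the vector fields. *)
Lemma operator_u_bracket i l k : (k < n)%N ->
  V i (u l k) - V l (u i k) = (l%:R - i%:R) * u (i + l)%N k.
Proof.
move=> kn; have Vx a : V a (x k) = u a k.
  rewrite (bigD1 (Ordinal kn)) //= dx // eqxx mulr1 big1 ?addr0 // => j jk.
  by rewrite dx // ifN ?mulr0.
have VD a b c : V a (b + c) = V a b + V a c.
  by rewrite -big_split; apply: eq_bigr => j _; rewrite (derD (hd j)) mulrDr.
have VM a b c : V a (b * c) = V a b * c + b * V a c.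
  rewrite mulr_suml mulr_sumr -big_split; apply: eq_bigr => j _.
  by rewrite (derM (hd j)) mulrDr mulrA mulrCA.
have := C_bracket i l (x k); rewrite !Vx !VD !VM !Vx => e.
have t := operator_tau_cocycle i l; apply: (addrI ((l%:R - i%:R) * tau (i + l)%N * x k)).
rewrite -mulrA -mulrDr -e mulrA -t; ring.
Qed.
End OperatorCocycle.

Section GaugeConnection.
Variables (A : comUnitRingType) (X : lmodType A) (n : nat).
Variables (dA : nat -> A -> A) (nab : nat -> X -> X) (K : nat -> nat -> A).
Variables (Lx : nat -> {linear X -> X}) (tau : nat -> A) (u : nat -> nat -> A).
Hypothesis hd : forall j, derivation (dA j).
Hypothesis nabD : forall j x y, nab j (x + y) = nab j x + nab j y.
Hypothesis nabZ : forall j a x, nab j (a *: x) = dA j a *: x + a *: nab j x.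
Hypothesis nabK : forall j k x, nab j (nab k x) - nab k (nab j x) = K j k *: x.
Hypothesis nabL : forall j i x, nab j (Lx i x) = Lx i (nab j x).
Hypothesis Lx_bracket : forall i l x,
  Lx i (Lx l x) - Lx l (Lx i x) = (i%:R - l%:R) *: Lx (i + l)%N x.

Definition vder_scalar (i : nat) (a : A) : A := \sum_(j < n) u i j * dA j a.
Definition vder_vec (i : nat) (x : X) : X := \sum_(j < n) u i j *: nab j x.

Hypothesis tau_cocycle : forall i l,
  vder_scalar i (tau l) - vder_scalar l (tau i) = (l%:R - i%:R) * tau (i + l)%N.
Hypothesis u_bracket : forall i l k, (k < n)%N ->
  vder_scalar i (u l k) - vder_scalar l (u i k) = (l%:R - i%:R) * u (i + l)%N k.

Definition gauge_op (i : nat) (x : X) : X := tau i *: x + vder_vec i x.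
Definition gauge_defect (i : nat) (x : X) : X := Lx i x - gauge_op i x.
(** The curvature two-form [K] evaluated on the i-th and l-th vector fields. *)
Definition vcurv (i l : nat) : A := \sum_(k < n) \sum_(j < n) u l k * u i j * K j k.

Lemma nab0 j : nab j 0 = 0.
Proof. by apply: (addrI (nab j 0)); rewrite -nabD !addr0. Qed.
Lemma nab_sum j (I : Type) (s : seq I) (P : pred I) (f : I -> X) :
  nab j (\sum_(i <- s | P i) f i) = \sum_(i <- s | P i) nab j (f i).
Proof. exact: (big_morph (nab j) (nabD j) (nab0 j)). Qed.

Lemma vder_vecD i x y : vder_vec i (x + y) = vder_vec i x + vder_vec i y.
Proof. by rewrite -big_split; apply: eq_bigr => j _; rewrite nabD scalerDr. Qed.
Lemma vder_vecZ i a x : vder_vec i (a *: x) = vder_scalar i a *: x + a *: vder_vec i x.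
Proof.
rewrite /vder_vec /vder_scalar scaler_suml scaler_sumr -big_split; apply: eq_bigr => j _.
by rewrite nabZ scalerDr !scalerA [a * _]mulrC.
Qed.
Lemma vder_vec_L i l x : vder_vec i (Lx l x) = Lx l (vder_vec i x).
Proof. by rewrite linear_sum; apply: eq_bigr => j _; rewrite nabL linearZ. Qed.

Lemma vder_vec_vder_vec i l x : vder_vec i (vder_vec l x)
  = \sum_(k < n) vder_scalar i (u l k) *: nab k x
    + \sum_(k < n) \sum_(j < n) (u l k * u i j) *: nab j (nab k x).
Proof.
transitivity (\sum_(k < n) vder_vec i (u l k *: nab k x)).
  rewrite /vder_vec exchange_big; apply: eq_bigr => j _ /=.
  by rewrite nab_sum scaler_sumr.
rewrite -big_split; apply: eq_bigr => k _; rewrite vder_vecZ; congr (_ + _).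
by rewrite scaler_sumr; apply: eq_bigr => j _; rewrite scalerA.
Qed.

Lemma vder_vec_bracket i l x : vder_vec i (vder_vec l x) - vder_vec l (vder_vec i x)
  = (l%:R - i%:R) *: vder_vec (i + l) x + vcurv i l *: x.
Proof.
rewrite !vder_vec_vder_vec opprD addrACA -sumrB; congr (_ + _).
  rewrite scaler_sumr; apply: eq_bigr => k _.
  by rewrite -scalerBl u_bracket // scalerA.
rewrite [X in _ - X]exchange_big -sumrB /vcurv scaler_suml; apply: eq_bigr => k _.
rewrite scaler_suml -sumrB; apply: eq_bigr => j _.
by rewrite [u i j * _]mulrC -scalerBr nabK scalerA.
Qed.

Lemma gauge_opD i x y : gauge_op i (x + y) = gauge_op i x + gauge_op i y.
Proof. by rewrite /gauge_op vder_vecD scalerDr addrACA. Qed.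

Lemma gauge_op_bracket i l x : gauge_op i (gauge_op l x) - gauge_op l (gauge_op i x)
  = (l%:R - i%:R) *: gauge_op (i + l) x + vcurv i l *: x.
Proof.
have e a b : gauge_op a (gauge_op b x) = ((tau a * tau b) *: x
    + (tau a *: vder_vec b x + tau b *: vder_vec a x))
    + (vder_scalar a (tau b) *: x + vder_vec a (vder_vec b x)).
  rewrite {2}/gauge_op /gauge_op vder_vecD vder_vecZ scalerDr scalerA -!addrA.
  by congr (_ + (_ + _)); rewrite addrCA.
rewrite !e [tau l * _]mulrC [tau l *: _ + _]addrC opprD addrACA subrr add0r.
rewrite opprD addrACA -scalerBl tau_cocycle vder_vec_bracket /gauge_op scalerDr scalerA.
by rewrite addrA.
Qed.

(** The generators commute with the gauge operators, so the cross terms are symmetric in i and l and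
    cancel. The gauge operators obey the relations with the opposite sign, which the minus sign in
    the defect absorbs. *)
Lemma defect_bracket i l x : gauge_defect i (gauge_defect l x) - gauge_defect l (gauge_defect i x)
  = (i%:R - l%:R) *: gauge_defect (i + l) x + vcurv i l *: x.
Proof.
have gauge_opB a y z : gauge_op a (y - z) = gauge_op a y - gauge_op a z.
  by apply: (addIr (gauge_op a z)); rewrite -gauge_opD !subrK.
have gauge_opL a b y : gauge_op a (Lx b y) = Lx b (gauge_op a y).
  by rewrite /gauge_op vder_vec_L linearD linearZ.
have e a b : gauge_defect a (gauge_defect b x) = (Lx a (Lx b x) + gauge_op a (gauge_op b x))
    - (Lx a (gauge_op b x) + Lx b (gauge_op a x)).
  rewrite /gauge_defect linearB gauge_opB gauge_opL opprB addrACA; congr (_ + _).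
  by rewrite -opprD.
rewrite !e [Lx l (gauge_op i x) + _]addrC opprB addrA subrK.
rewrite opprD addrACA Lx_bracket gauge_op_bracket /gauge_defect scalerBr -!addrA; congr (_ + _).
by rewrite -[l%:R - i%:R]opprB scaleNr.
Qed.

Lemma defectZ i a x : gauge_defect i (a *: x) = a *: gauge_defect i x - vder_scalar i a *: x.
Proof.
rewrite /gauge_defect /gauge_op vder_vecZ linearZ scalerBr scalerDr !scalerA -[in RHS]addrA.
congr (_ + _); rewrite -opprD [tau i * a]mulrC; congr (- _).
by rewrite -addrA; congr (_ + _); rewrite addrC.
Qed.

Section Eigenvector.
Variables (W : X) (rho omega : nat -> A).
Hypothesis W_free : forall a, a *: W = 0 -> a = 0.
Hypothesis defect_W : forall i, gauge_defect i W = rho i *: W.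
Hypothesis rho_omega : forall i, rho i = \sum_(j < n) u i j * omega j.
Hypothesis u_nondeg : forall x : 'I_n -> A,
  (forall i, (i < n)%N -> \sum_(j < n) u i j * x j = 0) -> forall j, x j = 0.

Lemma rho_cocycle i l :
  vder_scalar l (rho i) - vder_scalar i (rho l) = (i%:R - l%:R) * rho (i + l)%N + vcurv i l.
Proof.
apply/eqP; rewrite -subr_eq0; apply/eqP/W_free.
rewrite scalerBl scalerBl scalerDl -scalerA -defect_W -defect_bracket !defect_W !defectZ !defect_W.
rewrite !scalerA [rho i * _]mulrC; apply/eqP; rewrite subr_eq0; apply/eqP.
by rewrite opprB [RHS]addrC addrA subrK.
Qed.

(** The cocycle of [rho] is the Cartan formula for the exterior derivative of [omega] on two of the
    fields; since these span, it can be read off in coordinates. *)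
Lemma omega_curvature (j k : 'I_n) : dA k (omega j) - dA j (omega k) = K j k.
Proof.
pose z (j k : 'I_n) := dA k (omega j) - dA j (omega k) - K j k.
suff : z j k = 0 by move/eqP; rewrite subr_eq0 => /eqP.
have der_rho i l : vder_scalar i (rho l) = \sum_(k < n) vder_scalar i (u l k) * omega k
    + \sum_(k < n) \sum_(j < n) u l k * u i j * dA j (omega k).
  rewrite rho_omega /vder_scalar; under eq_bigr => a _ do rewrite (der_sum (hd a)) mulr_sumr.
  rewrite exchange_big -big_split; apply: eq_bigr => b _ /=.
  rewrite mulr_suml -big_split; apply: eq_bigr => a _ /=.
  by rewrite (derM (hd a)); ring.
have e i l : \sum_(k < n) u l k * \sum_(j < n) u i j * z j k = 0.
  have := rho_cocycle i l; rewrite !der_rho opprD addrACA -sumrB.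
  under eq_bigr => a _ do rewrite -mulrBl u_bracket // -mulrA [(l + i)%N]addnC.
  rewrite -mulr_sumr -rho_omega => /addrI; rewrite exchange_big -sumrB => /eqP.
  rewrite -subr_eq0 => /eqP e0; rewrite -[RHS]e0 /vcurv -sumrB; apply: eq_bigr => a _.
  rewrite mulr_sumr -!sumrB; apply: eq_bigr => b _ /=.
  by rewrite /z; ring.
move: j; apply: (u_nondeg (x := z^~ k)) => i ir; move: k.
by apply: (u_nondeg (x := fun k => \sum_(j < n) u i j * z j k)) => l lr; exact: e.
Qed.
End Eigenvector.

End GaugeConnection.

(** * The matrix of the vector fields *)

Section VectorFieldMatrix.
Variables (F : fieldType) (r : nat) (c : nat -> F) (S : nat -> laurent F).
Variables (vf : nat -> nat -> laurent F) (B : F -> Prop).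
Hypothesis hr : (2 <= r)%N.
Hypothesis char0 : forall n : nat, (n.+1%:R : F) != 0.
Hypotheses (c_out : forall k, (r.-1 < k)%N -> c k = 0) (c_top : c r.-1 != 0).
Hypotheses (B1 : B 1) (BB : forall x y, B x -> B y -> B (x - y)).
Hypothesis BM : forall x y, B x -> B y -> B (x * y).
Hypotheses (Bc : forall k, B (c k)) (BcV : B (c r.-1)^-1) (BnV : forall n : nat, B (n.+1%:R)^-1).
Hypotheses (SB : forall n, lsub B (S n)) (S_top : S (2 * r - 1) = lmon 1 1).
Hypothesis vf_out : forall i j, (j < r)%N -> (r <= i + j)%N -> vf i j = 0.
Hypothesis vf_euler : forall j, (j < r.-1)%N -> vf 0%N j = lmon 0 (j.+1%:R * c j.+1).
Hypothesis vf_euler_top : vf 0%N r.-1 = (2 * r - 1)%:R * lmon 1 1.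
Hypothesis vf_eq : forall n m, (0 < n < r)%N -> (r <= m <= 2 * r - 2)%N ->
  \sum_(j < r.-1) vf n j * lmon 0 (- (2%:R * c (m - j.+1))) = (m%:R - n%:R) * S (m + n).

Lemma lmon_unit k (a : F) : a != 0 -> lmon k a * lmon (- k) a^-1 = 1.
Proof. by move=> a0; rewrite lmonM subrr divff. Qed.

Lemma subPV x y : x * y = 1 -> (x : laurent F)^-1 = y.
Proof.
move=> xy; have xu : x \is a GRing.unit by apply/unitrPr; exists y.
by apply: (mulrI xu); rewrite mulrV.
Qed.

Lemma two_c_neq0 : - (2%:R * c r.-1) != 0.
Proof. by rewrite oppr_eq0 mulf_neq0. Qed.

Lemma two_cV : B (- (2%:R * c r.-1))^-1.
Proof. by rewrite invrN invfM; apply: (subPN B1 BB); apply: BM. Qed.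

(** For a row of positive index, the defining equations at m = r + l have coefficients -2 c_(l+k+1)
    once the unknowns are numbered backwards. This matrix is anti-triangular with antidiagonal -2
    c_(r-1), so only c_(r-1) and integers are inverted. *)
Lemma vf_lsub i j : (i < r)%N -> (j < r)%N -> lsub B (vf i j).
Proof.
case: i => [|n] nr jr.
  have [jr'|] := ltnP j r.-1.
    by rewrite vf_euler //; apply: lsub_mon => //; apply: BM => //; exact: (subP_nat B1 BB).
  move=> rj; have -> : j = r.-1 by apply/eqP; rewrite eqn_leq rj -ltnS prednK ?jr // ltnW.
  rewrite vf_euler_top -lmon_nat lmonM; apply: lsub_mon => //.
  by rewrite mulr1; exact: (subP_nat B1 BB).
have [jr'|rj] := ltnP j r.-1; last by rewrite vf_out //; [exact: lsub_mon B1 BB 0 _ (subP0 B1 BB) | lia].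
pose t i j : laurent F := lmon 0 (- (2%:R * c (i + j).+1)).
pose x (k : 'I_r.-1) : (laurent F)^o := vf n.+1 (r.-1 - k.+1)%N.
have tt k : (k < r.-1)%N -> t (r.-1 - k.+1)%N k = lmon 0 (- (2%:R * c r.-1)).
  by move=> kr; rewrite /t -addnS subnK.
have BN z : B z -> B (- z) by exact: (subPN B1 BB).
suff /(_ (rev_ord (Ordinal jr'))) : forall k, lsub B (x k).
  by rewrite /x /= subnSK // subKn // ltnW.
apply: (@antitriangular_solve _ _ _ t x (lsub B) (lsub B)).
- exact: lsub_mon B1 BB 0 _ (subP0 B1 BB).
- by move=> u v; exact: lsubB.
- by move=> a u; exact: lsubM.
- by move=> a b _ ab; rewrite /t c_out ?mulr0 ?oppr0 ?lmon0.
- by move=> k kr; rewrite tt //; apply/unitrPr; eexists; exact: (lmon_unit 0 two_c_neq0).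
- move=> a b _ _; apply: lsub_mon => //; apply: BN; apply: BM => //; exact: (subP_nat B1 BB).
- move=> k kr; rewrite tt // (subPV (lmon_unit 0 two_c_neq0)); apply: lsub_mon => //; exact: two_cV.
move=> l lr; have -> : \sum_(k < r.-1) t l k *: x k
    = \sum_(k < r.-1) vf n.+1 k * lmon 0 (- (2%:R * c (r + l - k.+1))).
  rewrite [RHS](reindex_inj rev_ord_inj); apply: eq_bigr => k _ /=.
  rewrite /t /x [LHS]mulrC; congr (_ * lmon 0 (- (_ * c _))); have := ltn_ord k; lia.
rewrite vf_eq; [| lia | lia].
by apply: lsubM => //; apply: lsubB => //; rewrite -lmon_nat; apply: lsub_mon => //; exact: (subP_nat B1 BB).
Qed.

Lemma natrB_neq0 m n : m != n -> m%:R - n%:R != 0 :> F /\ B (m%:R - n%:R)^-1.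
Proof.
have pos a b : (a < b)%N -> b%:R - a%:R != 0 :> F /\ B (b%:R - a%:R)^-1.
  move=> ab; rewrite -natrB ?(ltnW ab) // -(prednK (_ : 0 < b - a)%N) ?subn_gt0 //.
rewrite neq_ltn => /orP[mn|/pos //]; have [h1 h2] := pos _ _ mn.
by rewrite -opprB invrN oppr_eq0; split=> //; exact: (subPN B1 BB).
Qed.

(** For j < r - 1, the equation with m = r + j and n = r - j - 1 has right-hand side (2j+1) Lambda,
    and all its terms but one vanish. The entry is therefore -(2j+1) Lambda / (2 c_(r-1)), a unit;
    the last entry is (2r-1) Lambda, from the Euler field. *)
Lemma vf_diag j : (j < r)%N ->
  exists y, lsub B y /\ vf (r - j.+1) j * y = 1.
Proof.
move=> jr; have [rj|jr'] := leqP r.-1 j.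
  have -> : j = r.-1 by lia.
  have -> : (r - r.-1.+1 = 0)%N by lia.
  rewrite vf_euler_top -lmon_nat lmonM mulr1; have -> : (2 * r - 1 = (2 * r - 2).+1)%N by lia.
  exists (lmon (-1) ((2 * r - 2).+1%:R)^-1); split; first exact: lsub_mon.
  by rewrite lmonM subrr divff // add0r.
have e : vf (r - j.+1) j * lmon 0 (- (2%:R * c r.-1)) = lmon 1 ((r + j)%:R - (r - j.+1)%N%:R).
  have h1 : (0 < r - j.+1 < r)%N by lia.
  have h2 : (r <= r + j <= 2 * r - 2)%N by lia.
  have := vf_eq h1 h2; have -> : (r + j + (r - j.+1) = 2 * r - 1)%N by lia.
  rewrite S_top (bigD1 (Ordinal jr')) //= big1 ?addr0.
    rewrite (_ : (r + j - j.+1 = r.-1)%N); last by lia.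
    by move=> ->; rewrite -!lmon_nat -lmonN -lmonD lmonM mulr1.
  move=> k kj; have kj' : (k : nat) != j by [].
  have [lt|gt] := ltnP k j; last by rewrite vf_out ?mul0r //; have := ltn_ord k; lia.
  by rewrite c_out ?mulr0 ?oppr0 ?lmon0 ?mulr0 //; lia.
have [z0 zB] := @natrB_neq0 (r + j)%N (r - j.+1)%N ltac:(lia).
exists (lmon 0 (- (2%:R * c r.-1)) * lmon (-1) ((r + j)%:R - (r - j.+1)%N%:R)^-1); split.
  apply: lsubM => //; apply: lsub_mon => //; apply: (subPN B1 BB); apply: BM => //.
  exact: (subP_nat B1 BB).
by rewrite mulrA e lmon_unit.
Qed.

Lemma vf_diag_unit j : (j < r)%N -> vf (r - j.+1) j \is a GRing.unit.
Proof. by case/vf_diag => y [_ ey]; apply/unitrPr; exists y. Qed.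

Lemma vf_solve (X : lmodType (laurent F)) (BX : laurent F -> Prop) (Z : X -> Prop) (x : 'I_r -> X) :
  (forall a, lsub B a -> BX a) ->
  Z 0 -> (forall u v, Z u -> Z v -> Z (u - v)) -> (forall a u, BX a -> Z u -> Z (a *: u)) ->
  (forall i, (i < r)%N -> Z (\sum_(j < r) vf i j *: x j)) -> forall j, Z (x j).
Proof.
move=> hBX Z0 ZB ZZ; apply: (antitriangular_solve (B := BX) Z0 ZB ZZ vf_out vf_diag_unit).
  by move=> i j ir jr; apply/hBX/vf_lsub.
by move=> j /vf_diag[y [yB /subPV ->]]; exact: hBX.
Qed.

Lemma vf_solve_lsub (x : nat -> laurent F) :
  (forall i, (i < r)%N -> lsub B (\sum_(j < r) vf i j * x j)) ->
  forall j : nat, (j < r)%N -> lsub B (x j).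
Proof.
move=> hx j jr; apply: (@vf_solve (laurent F)^o (lsub B) (lsub B) (fun j : 'I_r => x j) _ _ _ _ _ (Ordinal jr)) => //.
- exact: lsub_mon B1 BB 0 _ (subP0 B1 BB).
- by move=> u v; exact: lsubB.
- by move=> a u; exact: lsubM.
Qed.

Lemma vf_nondeg (x : 'I_r -> laurent F) :
  (forall i, (i < r)%N -> \sum_(j < r) vf i j * x j = 0) -> forall j, x j = 0.
Proof.
apply: (@vf_solve (laurent F)^o (fun=> True) (fun a => a = 0) x) => //.
  by move=> u v -> ->; rewrite subrr.
by move=> a u _ ->; rewrite scaler0.
Qed.

(** Reversing the columns makes the matrix triangular up to transposition, with the units of
    [vf_diag] on the diagonal. *)
Lemma vf_unitmx (A : 'M[laurent F]_(r.-1.+1)) : (forall i j, A i j = vf i j) -> A \in unitmx.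
Proof.
move=> AE; have rE : r.-1.+1 = r by rewrite prednK // ltnW.
pose s := perm (@rev_ord_inj r.-1.+1).
have trig : is_trig_mx (col_perm s A)^T.
  apply/is_trig_mxP => i j ij; rewrite mxE mxE permE AE vf_out //=.
    by lia.
  by have := ltn_ord j; have := ltn_ord i; move: ij; rewrite /=; lia.
have e := det_trig trig; rewrite det_tr [in LHS]col_permE det_mulmx det_perm in e.
have : \prod_(i < r.-1.+1) (col_perm s A)^T i i \is a GRing.unit.
  apply: rpred_prod => i _; rewrite !mxE permE AE /=.
  have ir : (i < r)%N by have := ltn_ord i; lia.
  have -> : (r.-1.+1 - i.+1 = r - i.+1)%N by lia.
  have -> : vf i (r - i.+1) = vf (r - (r - i.+1).+1) (r - i.+1) by congr vf; lia.
  by apply: vf_diag_unit; lia.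
by rewrite -e unitrM unitmxE => /andP[].
Qed.

End VectorFieldMatrix.

(** * Whittaker vectors in Laurent series and the one-form *)

Section WhittakerSeries.
Variables (F : fieldType) (r : nat) (M : lmodType F) (L : int -> {linear M -> M}) (v0 : M).
Variables (w : nat -> F) (S : nat -> laurent F) (phi : M -> F) (B : F -> Prop).
Hypothesis phi_linear : forall a u v, phi (a *: u + v) = a * phi u + phi v.
Hypothesis phi_v0 : phi v0 = 1.
Hypothesis whittaker : forall u : M,
  (forall n : nat, (r <= n)%N -> L n%:Z u = w n *: u) -> u = phi u *: v0.
Hypothesis S_gen : forall n, (r <= n)%N -> n != (2 * r - 1)%N -> S n = lmon 0 (w n).
Hypotheses (S_top : S (2 * r - 1) = lmon 1 1) (w_top : w (2 * r - 1) = 0).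
Hypotheses (B1 : B 1) (BB : forall x y, B x -> B y -> B (x - y)).
Hypothesis BM : forall x y, B x -> B y -> B (x * y).

Local Notation Lx p := (mlmap_lin (L p)).

Lemma phiD u v : phi (u + v) = phi u + phi v.
Proof. by rewrite -[u]scale1r phi_linear mul1r scale1r. Qed.
Lemma phi0 : phi 0 = 0.
Proof. by apply: (addrI (phi 0)); rewrite -phiD !addr0. Qed.
Lemma phiZ a u : phi (a *: u) = a * phi u.
Proof. by rewrite -[a *: u]addr0 phi_linear phi0 addr0. Qed.
Lemma phi_sum (I : Type) (s : seq I) (P : pred I) (f : I -> M) :
  phi (\sum_(i <- s | P i) f i) = \sum_(i <- s | P i) phi (f i).
Proof. exact: (big_morph phi phiD phi0). Qed.

Fact phi_series_bound (x : mlaurent M) : exists N : int, forall n : int, n < N -> phi (x n) = 0.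
Proof. by have [N hN] := mboundP x; exists N => n nN; rewrite hN // phi0. Qed.
Definition phi_series (x : mlaurent M) : laurent F := Laurent (phi_series_bound x).

Lemma phi_seriesD x y : phi_series (x + y) = phi_series x + phi_series y.
Proof. by apply: laurentP => n /=; rewrite phiD. Qed.

Lemma phi_seriesZ a x : phi_series (a *: x) = a * phi_series x.
Proof.
apply: laurentP => n; have [N hN] := lboundP a; have [P hP] := mboundP x.
have -> : (a * phi_series x) n = (a *: regular_mlaurent (phi_series x)) n by [].
have hT : n - N - (absz (n - N - P + 1))%:Z < P by lia.
rewrite [LHS]/= -[ract a x n]/((a *: x) n) !(mscaleE_bounded hN _ hT) //.
  by rewrite phi_sum; apply: eq_bigr => i _; rewrite phiZ.
by move=> m mP /=; rewrite hP ?phi0.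
Qed.

Lemma phi_series0 : phi_series 0 = 0.
Proof. by apply: laurentP => n; rewrite lcoef0 /= phi0. Qed.

(** At the lowest possibly nonzero coefficient the weight Lambda of index 2r - 1 contributes
    nothing, so this coefficient is a Whittaker vector of the module with constant weights, hence a
    multiple of [v0] that [phi] detects. *)
Lemma whittaker_series_eq0 (x : mlaurent M) :
  (forall n, (r <= n)%N -> Lx n%:Z x = S n *: x) -> phi_series x = 0 -> x = 0.
Proof.
move=> hx px; have [P hP] := mboundP x.
apply: mlaurentP => m; have [/hP //|/laurent_split [k ->]] := ltP m P.
have [d] := ubnP k; elim: d k => // d IH k kd.
have xlow i : i < P + k%:Z -> x i = 0.
  by have [/hP //|/laurent_split [l ->]] := ltP i P; move=> hl; apply: IH; lia.
rewrite (@whittaker (x (P + k%:Z))).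
  have -> : phi (x (P + k%:Z)) = phi_series x (P + k%:Z) by [].
  by rewrite px lcoef0 scale0r.
move=> n rn; have -> : L n%:Z (x (P + k%:Z)) = (S n *: x) (P + k%:Z).
  by rewrite -(hx n rn).
have [->|ntop] := eqVneq n (2 * r - 1)%N.
  by rewrite S_top w_top scale0r mcoef_scale_mon xlow ?scaler0 //; lia.
by rewrite S_gen // mcoef_scale_mon subr0.
Qed.

Variable W : mlaurent M.
Hypotheses (W_neg : forall n, n < 0 -> W n = 0) (W_zero : W 0 = v0).
Hypothesis W_whittaker : forall n, (r <= n)%N -> Lx n%:Z W = S n *: W.

Lemma phi_W_unit (B' : F -> Prop) : B' 1 -> (forall x y, B' x -> B' y -> B' (x - y)) ->
  (forall x y, B' x -> B' y -> B' (x * y)) -> (forall n, B' (phi (W n))) ->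
  exists2 t : laurent F, lsub B' t & t * phi_series W = 1.
Proof.
move=> B'1 B'B B'M hW; apply: unit_of_one => // [n n0|] /=; first by rewrite W_neg ?phi0.
by rewrite W_zero.
Qed.

Lemma W_free a : a *: W = 0 -> a = 0.
Proof.
move=> aW; have [t _ tW] := @phi_W_unit (fun=> True) I (fun _ _ _ _ => I) (fun _ _ _ _ => I) (fun=> I).
by rewrite -[a]mulr1 -tW mulrCA -phi_seriesZ aW phi_series0 mulr0.
Qed.

(** The factor must be phi(x) / phi(W). The series phi(W) starts with 1, so dividing by it keeps the
    coefficients in [B]; the difference is a Whittaker series invisible to [phi]. *)
Lemma whittaker_series (x : mlaurent M) : (forall n, B (phi (W n))) -> (forall n, B (phi (x n))) ->
  (forall n, (r <= n)%N -> Lx n%:Z x = S n *: x) ->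
  exists2 rho : laurent F, lsub B rho & x = rho *: W.
Proof.
move=> BW Bx hx; have [t tB tW] := phi_W_unit B1 BB BM BW.
exists (phi_series x * t); first exact: lsubM.
apply/eqP; rewrite -subr_eq0; apply/eqP; apply: whittaker_series_eq0.
  by move=> n rn; rewrite linearB linearZ /= hx // W_whittaker // scalerBr !scalerA mulrC.
by rewrite phi_seriesD -scaleNr phi_seriesZ mulNr -mulrA tW mulr1 subrr.
Qed.

End WhittakerSeries.

(** * Residues of derivatives *)

Section ConstantForm.
Variable F : fieldType.
Hypothesis char0 : forall n : nat, (n.+1%:R : F) != 0.

Lemma intr_neq0 (n : int) : n != 0 -> n%:~R != 0 :> F.
Proof.
by case: n => [[|n]|n] // _; rewrite ?NegzE ?mulrNz ?oppr_eq0; exact: char0.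
Qed.

Lemma natr_sub_neq0 (m n : nat) : m != n -> m%:R - n%:R != 0 :> laurent F.
Proof.
move=> mn; apply/eqP => e; have := congr1 (fun a : laurent F => a 0) e.
rewrite lcoefD lcoefN !lcoef_nat eqxx lcoef0 => /eqP.
have -> : (m%:R - n%:R : F) = (m%:Z - n%:Z)%:~R by rewrite rmorphB.
by apply/negP/intr_neq0; lia.
Qed.

Lemma lderiv_residue (a : laurent F) (x : F) :
  lderiv a = lmon (-1) x -> x = 0 /\ a = lmon 0 (a 0).
Proof.
move=> ha; have hn n : (n + 1)%:~R * a (n + 1) = if n == -1 then x else 0.
  by rewrite -[RHS]/(lmon (-1) x n) -ha.
have x0 : x = 0 by rewrite -[LHS](hn (-1)) addNr mul0r.
split=> //; apply: laurentP => n; rewrite lcoef_mon; case: eqP => [-> //|/eqP n0].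
have := hn (n - 1); rewrite subrK x0; case: ifP => _ /eqP;
  by rewrite mulf_eq0 (negbTE (intr_neq0 n0)) => /eqP.
Qed.
End ConstantForm.

(** * Annihilation by the higher defects and the closed one-form *)

Section FlatGauge.
Variables (F : fieldType) (r : nat) (M : lmodType F).
Local Notation LF := (laurent F).
Local Notation X := (mlaurent M).
Variables (dA : nat -> LF -> LF) (nab : nat -> X -> X) (K : nat -> nat -> LF).
Variables (Lx : nat -> {linear X -> X}) (tau : nat -> LF) (u : nat -> nat -> LF).
Variables (S : nat -> LF) (N : nat -> nat -> LF) (W : X).
Hypothesis hr : (2 <= r)%N.
Hypothesis char0 : forall n : nat, (n.+1%:R : F) != 0.
Hypothesis hd : forall j, derivation (dA j).
Hypothesis nabD : forall j x y, nab j (x + y) = nab j x + nab j y.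
Hypothesis nabZ : forall j a x, nab j (a *: x) = dA j a *: x + a *: nab j x.
Hypothesis nabK : forall j k x, nab j (nab k x) - nab k (nab j x) = K j k *: x.
Hypothesis nabL : forall j i x, nab j (Lx i x) = Lx i (nab j x).
Hypothesis Lx_bracket : forall i l x,
  Lx i (Lx l x) - Lx l (Lx i x) = (i%:R - l%:R) *: Lx (i + l)%N x.
Hypothesis tau_cocycle : forall i l,
  vder_scalar r dA u i (tau l) - vder_scalar r dA u l (tau i) = (l%:R - i%:R) * tau (i + l)%N.
Hypothesis u_bracket : forall i l k, (k < r)%N ->
  vder_scalar r dA u i (u l k) - vder_scalar r dA u l (u i k) = (l%:R - i%:R) * u (i + l)%N k.
Hypothesis u_high : forall i j, (r <= i)%N -> u i j = 0.
Hypothesis tau_high : forall i, (r <= i)%N -> tau i = S i.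
Hypothesis Nu : forall j k, (j < r)%N -> (k < r)%N -> \sum_(m < r) N j m * u m k = (j == k)%:R.
Hypothesis u_euler : u 0%N 0%N \is a GRing.unit.

Local Notation defect := (gauge_defect r nab Lx tau u).
Local Notation vder := (vder_scalar r dA u).
Local Notation vcurv := (vcurv r K u).

Hypothesis W_low : forall n, (r <= n <= 2 * r - 1)%N -> Lx n W = S n *: W.
Hypothesis W_star : \sum_(m < r) N r.-1 m *: defect m W = 0.

Lemma defect_high n x : (r <= n)%N -> defect n x = Lx n x - S n *: x.
Proof.
move=> rn; rewrite /gauge_defect /gauge_op /vder_vec tau_high // big1 ?addr0 // => j _.
by rewrite u_high // scale0r.
Qed.

Let bracket := defect_bracket nabD nabZ nabK nabL Lx_bracket tau_cocycle u_bracket.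

Lemma vcurv_high i l : (r <= i)%N -> vcurv i l = 0.
Proof.
by move=> ri; apply: big1 => k _; apply: big1 => j _; rewrite (u_high _ ri) mulr0 mul0r.
Qed.

Lemma defect_highZ n a x : (r <= n)%N -> defect n (a *: x) = a *: defect n x.
Proof. by move=> rn; rewrite !defect_high // linearZ scalerBr !scalerA mulrC. Qed.
Lemma defect_highD n x y : (r <= n)%N -> defect n (x + y) = defect n x + defect n y.
Proof. by move=> rn; rewrite !defect_high // linearD scalerDr opprD addrACA. Qed.
Lemma defect_high0 n : (r <= n)%N -> defect n 0 = 0.
Proof. by move=> rn; rewrite defect_high // linear0 scaler0 subrr. Qed.
Lemma defect0 n : defect n 0 = 0.
Proof.
rewrite /gauge_defect /gauge_op /vder_vec linear0 scaler0 big1 ?addr0 ?subrr // => j _.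
by rewrite -(scale0r W) nabZ (der0 (hd j)) !scale0r addr0 scaler0.
Qed.

Lemma defect_low n : (r <= n <= 2 * r - 1)%N -> defect n W = 0.
Proof. by move=> hn; rewrite defect_high ?W_low ?subrr //; case/andP: hn. Qed.

(* For [n >= r], [defect n] is linear over Laurent series, hence applies termwise to [W_star]. *)
Lemma star_bracket n : (r <= n)%N -> defect n W = 0 ->
  \sum_(m < r) (N r.-1 m * (n%:R - m%:R)) *: defect (n + m) W = 0.
Proof.
move=> rn Wn; have := congr1 (defect n) W_star.
rewrite (big_morph (defect n) (fun x y => defect_highD x y rn) (defect_high0 rn)).
rewrite defect_high0 // => e; rewrite -[RHS]e; apply: eq_bigr => m _.
rewrite defect_highZ //; have := bracket n m W.
rewrite Wn defect0 subr0 vcurv_high // scale0r addr0 => ->.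
by rewrite scalerA.
Qed.

(* Otherwise [star_bracket] at [n = 2r - m] kills the coefficient [N r.-1 m] of every
   [m >= 1], and d/dLambda would be a multiple of the Euler field [V_0]. *)
Lemma defect_double : defect (2 * r)%N W = 0.
Proof.
apply/eqP; apply: contraT => W0.
have Nm m : (0 < m < r)%N -> N r.-1 m = 0.
  have [d] := ubnP (r - m); elim: d m => // d IH m md /andP[m0 mr].
  have hn : (r <= 2 * r - m)%N by lia.
  have hn' : (r <= 2 * r - m <= 2 * r - 1)%N by lia.
  have := star_bracket hn (defect_low hn').
  rewrite (bigD1 (Ordinal mr)) //= big1 ?addr0.
    have -> : (2 * r - m + m = 2 * r)%N by lia.
    move=> e; apply/eqP; apply: contraT => Nm.
    case/negP: W0; apply/eqP; rewrite -scalerA in e.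
    apply: (mlaurent_torsion (mlaurent_torsion e Nm)).
    by apply: natr_sub_neq0 => //; lia.
  move=> i im; have im' : (i : nat) != m by [].
  have := ltn_ord i => ir; have [lt|ge] := ltnP i m.
    by rewrite defect_low ?scaler0 //; lia.
  by rewrite IH ?mul0r ?scale0r //; lia.
have r0 : (0 < r)%N by lia.
have rr : (r.-1 < r)%N by lia.
have := Nu rr r0; rewrite (bigD1 (Ordinal r0)) //= big1 ?addr0; last first.
  by move=> i i0; rewrite Nm ?mul0r // ltn_ord andbT lt0n.
have -> : (r.-1 == 0)%N = false by lia.
move=> e; have N0 : N r.-1 0%N = 0 by apply: (mulIr u_euler); rewrite e mul0r.
have := Nu rr rr; rewrite eqxx big1; first by move/esym/eqP; rewrite oner_eq0.
move=> i _; have [->|i0] := posnP i; first by rewrite N0 mul0r.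
by rewrite Nm ?mul0r // i0 ltn_ord.
Qed.

(** For n > 2r the splitting n = r + (n - r) has distinct parts, both at least r, and the bracket
    divides by their difference; at n = 2r the two parts coincide. *)
Lemma defect_ge n : (r <= n)%N -> defect n W = 0.
Proof.
have [d] := ubnP n; elim: d n => // d IH n nd rn.
have [le|] := leqP n (2 * r - 1); first by rewrite defect_low ?rn.
rewrite leq_eqVlt => /orP[/eqP e|gt].
  by rewrite (_ : n = (2 * r)%N); [exact: defect_double | lia].
have := bracket r (n - r) W; rewrite vcurv_high // scale0r addr0 subnKC //.
have -> : defect r W = 0 by apply: IH; lia.
have -> : defect (n - r) W = 0 by apply: IH; lia.
rewrite !defect0 subrr => /esym e.
by apply: (mlaurent_torsion e); apply: natr_sub_neq0 => //; lia.
Qed.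

Lemma W_whittaker_all n : (r <= n)%N -> Lx n W = S n *: W.
Proof. by move=> rn; apply/eqP; rewrite -subr_eq0 -defect_high // defect_ge. Qed.

(** R_n R_i W = R_i R_n W + (n - i) R_(n+i) W, and both terms vanish since n and n + i are at least
    r. *)
Lemma defect_whittaker i n : (r <= n)%N -> Lx n (defect i W) = S n *: defect i W.
Proof.
move=> rn; apply/eqP; rewrite -subr_eq0 -defect_high //; apply/eqP.
have := bracket n i W; rewrite (defect_ge rn) defect0 subr0 vcurv_high // scale0r addr0 => ->.
by rewrite defect_ge ?scaler0 // (leq_trans rn) ?leq_addr.
Qed.

Section Eigenvalues.
Variables (B : F -> Prop) (rho : nat -> LF).
Hypothesis W_free : forall a, a *: W = 0 -> a = 0.
Hypothesis rhoB : forall i, (i < r)%N -> lsub B (rho i).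
Hypothesis defect_rho : forall i, (i < r)%N -> defect i W = rho i *: W.
Hypothesis uN : forall i l, (i < r)%N -> (l < r)%N -> \sum_(j < r) u i j * N j l = (i == l)%:R.
Hypothesis u_nondeg : forall x : 'I_r -> LF,
  (forall i, (i < r)%N -> \sum_(j < r) u i j * x j = 0) -> forall j, x j = 0.
Hypothesis u_solve : forall x : nat -> LF,
  (forall i, (i < r)%N -> lsub B (\sum_(j < r) u i j * x j)) ->
  forall j, (j < r)%N -> lsub B (x j).
Variables (D : 'I_r.-1 -> F -> F) (D0 : forall k, D k 0 = 0) (residue : 'I_r.-1 -> F).
Hypothesis dA_par : forall (k : 'I_r.-1) a, dA k a = lmap (D0 k) a.
Hypothesis dA_top : forall a, dA r.-1 a = lderiv a.
Hypothesis K_top : forall k : 'I_r.-1, K r.-1 k = - lmon (-1) (residue k).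
Hypothesis K_par : forall j k : 'I_r.-1, K j k = 0.

Lemma flat_gauge : exists omega : 'I_r.-1 -> F,
  [/\ forall k, B (omega k), forall j k, D j (omega k) = D k (omega j), forall k, residue k = 0
    & forall i, (i < r)%N ->
        defect i W = \sum_(k < r.-1) (u i k * lmon 0 (omega k)) *: W].
Proof.
have r_gt0 : (0 < r)%N by exact: ltnW.
have rr : (r.-1 < r)%N by rewrite prednK.
have kr (k : 'I_r.-1) : (k < r)%N by apply: leq_trans (ltn_ord k) (leq_pred r).
(* Extending by zero makes the eigenvalue equation hold for every index, as the cocycle involves
   sums i + l beyond the range. *)
pose rho' i := if (i < r)%N then rho i else 0.
pose om j := \sum_(i < r) N j i * rho' i.
have defect_rho' i : defect i W = rho' i *: W.
  by rewrite /rho'; case: ltnP => [/defect_rho //|/defect_ge ->]; rewrite scale0r.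
have rho_om i : rho' i = \sum_(j < r) u i j * om j.
  have [ir|ri] := ltnP i r; last first.
    by rewrite big1 ?/rho' ?ltnNge ?ri // => j _; rewrite u_high ?mul0r.
  under eq_bigr => j _ do rewrite /om mulr_sumr.
  rewrite exchange_big (bigD1 (Ordinal ir)) //= [X in _ + X]big1 ?addr0 => [|l li].
    by under eq_bigr => j _ do rewrite mulrA; rewrite -mulr_suml uN // eqxx mul1r.
  under eq_bigr => j _ do rewrite mulrA.
  by rewrite -mulr_suml uN // (_ : (i == l) = false) ?mul0r //; apply: negbTE; rewrite eq_sym.
have om_top : om r.-1 = 0.
  apply: W_free; rewrite /om scaler_suml -[RHS]W_star; apply: eq_bigr => i _.
  by rewrite defect_rho' scalerA.
have curv (j k : 'I_r) : dA k (om j) - dA j (om k) = K j k.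
  exact: (omega_curvature hd nabD nabZ nabK nabL Lx_bracket tau_cocycle u_bracket
    W_free defect_rho' rho_om u_nondeg).
(* Since the Lambda component of the form is 0, the mixed curvature component says that the
   Lambda-derivative of [om k] is [residue k] / Lambda. *)
have top (k : 'I_r.-1) : residue k = 0 /\ om k = lmon 0 (om k 0).
  apply: lderiv_residue => //; rewrite -dA_top.
  have := curv (Ordinal rr) (Ordinal (kr k)); rewrite /= K_top om_top (der0 (hd _)) sub0r.
  exact: oppr_inj.
exists (fun k => om k 0); split.
- move=> k; have : lsub B (om k) by apply: u_solve => // i ir; rewrite -rho_om /rho' ir; exact: rhoB.
  exact.
- move=> j k; have := curv (Ordinal (kr k)) (Ordinal (kr j)); rewrite /= K_par !dA_par.
  move/eqP; rewrite subr_eq0 => /eqP/(congr1 (fun a : LF => a 0)).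
  exact.
- by move=> k; case: (top k).
move=> i ir; rewrite defect_rho' rho_om scaler_suml.
have rE : r = r.-1.+1 by rewrite prednK.
transitivity (\sum_(0 <= k < r) (u i k * om k) *: W); first by rewrite big_mkord.
rewrite {1}rE big_nat_recr //= om_top mulr0 scale0r addr0 big_mkord.
by apply: eq_bigr => k _; case: (top k) => _ <-.
Qed.
End Eigenvalues.

End FlatGauge.

(** * The field of parameters *)

Section FieldIdentities.
Variable F : fieldType.

Lemma cross_multiply (p q n d : F) : q != 0 -> d != 0 -> p / q = n / d -> p * d = n * q.
Proof. by move=> q0 d0 /eqP; rewrite eqr_div // => /eqP. Qed.

(** The first hypothesis equates two representations of a fraction; the second is the first one
    differentiated. *)
Lemma quotient_rule_indep (p p' q q' n n' d d' : F) :
  p * d = n * q -> p' * d + p * d' = n' * q + n * q' ->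
  q != 0 -> d != 0 ->
  (n' * d - n * d') / d ^+ 2 = (p' * q - p * q') / q ^+ 2.
Proof.
move=> e e' q0 d0; apply/eqP; rewrite eqr_div ?expf_neq0 //; apply/eqP.
have -> : (n' * d - n * d') * q ^+ 2
  = ((n' * q + n * q') - n * q') * d * q - (n * q) * d' * q by ring.
rewrite -e' -e.
have -> : (p' * d + p * d' - n * q') * d * q - p * d * d' * q
  = p' * q * d ^+ 2 - (n * q) * q' * d by ring.
by rewrite -e; ring.
Qed.

Lemma quotient_rule_add (p p' q q' s s' t t' : F) : q != 0 -> t != 0 ->
  ((p' * t + p * t' + (s' * q + s * q')) * (q * t)
     - (p * t + s * q) * (q' * t + q * t')) / (q * t) ^+ 2
  = (p' * q - p * q') / q ^+ 2 + (s' * t - s * t') / t ^+ 2.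
Proof. by move=> q0 t0; field; rewrite q0 t0. Qed.

Lemma quotient_rule_mul (p p' q q' s s' t t' : F) : q != 0 -> t != 0 ->
  ((p' * s + p * s') * (q * t) - p * s * (q' * t + q * t')) / (q * t) ^+ 2
  = (p' * q - p * q') / q ^+ 2 * (s / t) + p / q * ((s' * t - s * t') / t ^+ 2).
Proof. by move=> q0 t0; field; rewrite q0 t0. Qed.

End FieldIdentities.

(** * Derivations of a fraction field by the quotient rule *)

Section FractionDerivation.
Variables (P : comNzRingType) (F : fieldType) (io : P -> F).
Hypotheses (ioD : {morph io : x y / x + y}) (ioM : {morph io : x y / x * y}).
Hypothesis io_inj : injective io.

(** Only some representation of each x is required to obey the quotient rule, which is all that is
    visible of a derivation computed on chosen representatives. *)
Definition extends_by_quotient (d : P -> P) (D : F -> F) : Prop :=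
  forall x, exists n q, [/\ io q != 0, x = io n / io q
    & D x = (io (d n) * io q - io n * io (d q)) / io q ^+ 2].

Lemma io1 : io 1 = 1.
Proof.
have io10 : io 1 != 0.
  apply/eqP => io10; have := oner_neq0 P; apply/negP/negPn/eqP/io_inj.
  by rewrite -[0 in RHS](mulr1 0) ioM io10 mulr0.
by apply: (mulfI io10); rewrite -ioM !mulr1.
Qed.

Variables (d : P -> P) (D : F -> F).
Hypotheses (hd : derivation d) (hD : extends_by_quotient d D).

Lemma quotient_derE p q : io q != 0 ->
  D (io p / io q) = (io (d p) * io q - io p * io (d q)) / io q ^+ 2.
Proof.
move=> q0; have [n [k [k0 e ->]]] := hD (io p / io q).
have {}e := cross_multiply q0 k0 e; apply: (quotient_rule_indep e) => //.
by rewrite -!ioM -!ioD -!(derM hd); congr (io (d _)); apply: io_inj; rewrite !ioM.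
Qed.

Lemma quotient_der_io p : D (io p) = io (d p).
Proof.
rewrite -[in LHS](divr1 (io p)) -io1 quotient_derE io1 ?oner_neq0 //.
have -> : io (d 1) = 0.
  by rewrite (der1 hd); apply: (addrI (io 0)); rewrite -ioD !addr0.
by rewrite mulr0 subr0 expr1n divr1 mulr1.
Qed.

Lemma quotient_derivation : derivation D.
Proof.
split=> x y; have [p [q [q0 -> _]]] := hD x; have [s [t [t0 -> _]]] := hD y.
  have -> : io p / io q + io s / io t = io (p * t + s * q) / io (q * t).
    by rewrite ioD !ioM addf_div.
  rewrite !quotient_derE // ?ioM ?mulf_neq0 // !(derD hd) !(derM hd) !(ioD, ioM).
  exact: quotient_rule_add.
have -> : io p / io q * (io s / io t) = io (p * s) / io (q * t).
  by rewrite !ioM mulf_div.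
rewrite !quotient_derE // ?ioM ?mulf_neq0 // !(derM hd) !(ioD, ioM).
exact: quotient_rule_mul.
Qed.

End FractionDerivation.

(** The commutator of two derivations is a derivation. It vanishes on the ring, so applying it to x
    q = p gives zero times q. *)
Lemma quotient_derC (P : comNzRingType) (F : fieldType) (io : P -> F) (d e : P -> P)
    (D E : F -> F) :
  {morph io : x y / x + y} -> {morph io : x y / x * y} -> injective io ->
  derivation d -> derivation e -> extends_by_quotient io d D -> extends_by_quotient io e E ->
  (forall p, d (e p) = e (d p)) -> forall x, D (E x) = E (D x).
Proof.
move=> ioD ioM io_inj hd he hD hE de x.
have dD := quotient_derivation ioD ioM io_inj hd hD.
have dE := quotient_derivation ioD ioM io_inj he hE.
have Dio := quotient_der_io ioD ioM io_inj hd hD.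
have Eio := quotient_der_io ioD ioM io_inj he hE.
have [p [q [q0 xE _]]] := hD x.
have xq : x * io q = io p by rewrite xE divfK.
apply/(mulIf q0)/eqP; rewrite -subr_eq0; apply/eqP.
have := congr1 (fun z => D (E z) - E (D z)) xq.
rewrite /= Dio Eio Dio Eio de subrr => <-.
rewrite !(derM dD, derM dE, derD dD, derD dE) Dio Eio Dio Eio de.
by ring.
Qed.

Section Localization.
Variables (P : comNzRingType) (F : fieldType) (io : P -> F) (e : P).
Hypotheses (ioD : {morph io : x y / x + y}) (ioM : {morph io : x y / x * y}).
Hypotheses (io_inj : injective io) (e0 : io e != 0).

Definition localized (x : F) : Prop := exists p m, x = io p / io e ^+ m.

Let ioX p m : io (p ^+ m) = io p ^+ m.
Proof. by elim: m => [|m IH]; rewrite ?expr0 ?(io1 ioM io_inj) // !exprS ioM IH. Qed.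

Lemma localized_io p : localized (io p).
Proof. by exists p, 0%N; rewrite expr0 divr1. Qed.

Lemma localizedM x y : localized x -> localized y -> localized (x * y).
Proof.
by move=> [p [m ->]] [q [k ->]]; exists (p * q), (m + k)%N; rewrite ioM exprD mulf_div.
Qed.

Lemma localizedB x y : localized x -> localized y -> localized (x - y).
Proof.
move=> [p [m ->]] [q [k ->]]; exists (p * e ^+ k - q * e ^+ m), (m + k)%N.
have ioN z : io (- z) = - io z.
  apply: (addrI (io z)); rewrite -ioD !subrr.
  by apply: (addrI (io 0)); rewrite -ioD !addr0.
by rewrite ioD ioN !ioM !ioX exprD -mulNr addf_div ?expf_neq0 // mulNr.
Qed.

Lemma localizedV a b : io a * io b = io e -> localized (io a)^-1.
Proof.
move=> ab; exists b, 1%N; rewrite expr1 -ab.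
by move: e0; rewrite -ab mulf_eq0 negb_or => /andP[a0 b0]; rewrite invfM mulrCA divff ?mulr1.
Qed.

Lemma localized_der (d : P -> P) (D : F -> F) : derivation d -> extends_by_quotient io d D ->
  forall x, localized x -> localized (D x).
Proof.
move=> hd hD x [p [m ->]]; rewrite -ioX.
exists (d p * e ^+ m - p * d (e ^+ m)), (m * 2)%N.
rewrite (quotient_derE ioD ioM io_inj hd hD) ?ioX ?expf_neq0 // -exprM.
have ioN z : io (- z) = - io z.
  apply: (addrI (io z)); rewrite -ioD !subrr.
  by apply: (addrI (io 0)); rewrite -ioD !addr0.
by rewrite ioD ioN !ioM ioX.
Qed.

End Localization.

Section ParameterField.
Variables (R : realType) (r : nat).
Local Notation K := (baseField R).
Local Notation F := (paramField R r).
Local Notation polyF := (@polyF R r).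

Lemma polyFD p q : polyF (p + q) = polyF p + polyF q. Proof. exact: tofracD. Qed.
Lemma polyFM p q : polyF (p * q) = polyF p * polyF q. Proof. exact: tofracM. Qed.
Lemma polyF0 : polyF 0 = 0. Proof. exact: tofrac0. Qed.
Lemma polyF1 : polyF 1 = 1. Proof. exact: tofrac1. Qed.
Lemma polyF_inj : injective polyF.
Proof. by move=> p q /eqP; rewrite /polyF tofrac_eq => /eqP. Qed.
Lemma polyF_eq0 p : (polyF p == 0) = (p == 0).
Proof. exact: tofrac_eq0. Qed.

Lemma numer_denom (x : F) :
  let u := repr (x : {fraction {mpoly K[r.-1]}}) in
  polyF \d_u != 0 /\ x = polyF \n_u / polyF \d_u.
Proof.
move=> u; have du : \d_u != 0 by exact: denom_ratioP.
split; first by rewrite polyF_eq0.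
apply: (canRL (mulfK _)); first by rewrite polyF_eq0.
rewrite /polyF -[x in LHS](reprK (x : {fraction {mpoly K[r.-1]}})) -/u.
unlock FracField.tofrac; rewrite -[LHS]FracField.pi_mul.
apply/eqP; rewrite eqmodE /= FracField.equivfE /FracField.mulf.
by rewrite !numden_Ratio ?oner_neq0 ?mulf_neq0 ?oner_neq0 // !mulr1 mulrC.
Qed.

Local Opaque Defs.polyF paramField baseField.

Lemma fder_quotient (j : 'I_r.-1) : extends_by_quotient polyF (mderiv j) (@fder R r j).
Proof. by move=> x; have [d0 xE] := numer_denom x; do 2 eexists; split; [exact: d0 | exact: xE |]. Qed.

Local Opaque fder.

Lemma mderiv_derivation (j : 'I_r.-1) : derivation (@mderiv r.-1 K j).
Proof. by split=> x y; [rewrite mderivD | rewrite mderivM]. Qed.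

Lemma fder_derivation (j : 'I_r.-1) : derivation (@fder R r j).
Proof.
exact: (quotient_derivation polyFD polyFM polyF_inj (mderiv_derivation j) (fder_quotient j)).
Qed.

Lemma fder_polyF (j : 'I_r.-1) p : fder j (polyF p) = polyF (mderiv j p).
Proof.
exact: (quotient_der_io polyFD polyFM polyF_inj (mderiv_derivation j) (fder_quotient j)).
Qed.

Lemma fderC (i j : 'I_r.-1) (x : F) : fder i (fder j x) = fder j (fder i x).
Proof.
exact: (quotient_derC polyFD polyFM polyF_inj (mderiv_derivation i) (mderiv_derivation j)
  (fder_quotient i) (fder_quotient j) (mderiv_comm j i)).
Qed.

Lemma fder_baseF (j : 'I_r.-1) (k : K) : fder j (baseF r k : F) = 0.
Proof. by rewrite /baseF fder_polyF mderivC polyF0. Qed.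

Lemma fder_Q (j : 'I_r.-1) : fder j (Q R r : F) = 0. Proof. exact: fder_baseF. Qed.
Lemma fder_c0 (j : 'I_r.-1) : fder j (c0 R r : F) = 0. Proof. exact: fder_baseF. Qed.

Lemma cparE (j : 'I_r.-1) : cpar R r j.+1 = polyF 'X_j.
Proof. by rewrite /cpar valK. Qed.

Lemma cpar_out k : (r.-1 < k)%N -> cpar R r k = 0.
Proof. by case: k => // k kr; rewrite /cpar insubN // -leqNgt -ltnS. Qed.

Lemma fder_cpar (j : 'I_r.-1) k : fder j (cpar R r k : F) = (k == j.+1)%:R.
Proof.
case: k => [|k]; first exact: fder_c0.
have [kr|kr] := ltnP k r.-1; last first.
  rewrite (@cpar_out k.+1 kr) fder0 eqSS.
  by have -> : (k == j) = false by apply/eqP => kj; have := ltn_ord j; rewrite -kj ltnNge kr.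
rewrite (cparE (Ordinal kr)) fder_polyF mderivX mnm1E eqSS.
have [<-|kj] := eqVneq (Ordinal kr) j.
  have -> : (U_(Ordinal kr) - U_(Ordinal kr))%MM = 0%MM :> 'X_{1..r.-1}.
    by apply/mnmP => i; rewrite mnmBE subnn mnm0E.
  by rewrite mpolyX0 scale1r polyF1 eqxx.
by rewrite scale0r polyF0 (_ : (k == j) = false) //; apply: negbTE.
Qed.

Lemma cpar_neq0 k : (0 < k <= r.-1)%N -> cpar R r k != 0.
Proof.
case: k => // k kr; have {}kr : (k < r.-1)%N by [].
rewrite (cparE (Ordinal kr)) polyF_eq0.
apply/eqP => /(congr1 (mcoeff U_(Ordinal kr))); rewrite mcoeffXU mcoeff0 eqxx.
by apply/eqP; exact: oner_neq0.
Qed.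

Local Notation inB := (@inALaur R r).

Lemma cpar_poly k : exists p, cpar R r k = polyF p.
Proof.
case: k => [|k]; first by exists (mpolyC r.-1 (FracField.tofrac 'X_(1 : 'I_2))).
have [kr|kr] := ltnP k r.-1; first by exists 'X_(Ordinal kr); rewrite -cparE.
by exists 0; rewrite (@cpar_out k.+1 kr) polyF0.
Qed.

(** The product of the parameters is an embedded polynomial [E], so A_Laur is a localization at one
    element and inherits its closure properties. *)
Lemma inALaur_localized : exists E, [/\ polyF E != 0, forall x, inB x <-> localized polyF E x
  & \prod_(1 <= k < r) cpar R r k = polyF E].
Proof.
have [E EE] : exists E, \prod_(1 <= k < r) cpar R r k = polyF E.
  apply: (big_ind (fun x => exists E, x = polyF E)) => //.
  - by exists 1; rewrite polyF1.
  - by move=> x y [p ->] [q ->]; exists (p * q); rewrite polyFM.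
  - by move=> k _; exact: cpar_poly.
exists E; split; [|by move=> x; rewrite /inALaur EE | exact: EE].
rewrite -EE prodf_seq_neq0; apply/allP => k; rewrite mem_index_iota => kr.
by apply: cpar_neq0; lia.
Qed.

Lemma inALaur_polyF p : inB (polyF p).
Proof.
have [E [E0 EP _]] := inALaur_localized.
exact/EP/localized_io.
Qed.

Lemma inALaur1 : inB 1.
Proof. by rewrite -polyF1; exact: inALaur_polyF. Qed.

Lemma inALaurB x y : inB x -> inB y -> inB (x - y).
Proof.
have [E [E0 EP _]] := inALaur_localized; move=> /EP hx /EP hy.
by apply/EP/(localizedB polyFD polyFM polyF_inj E0 hx hy).
Qed.

Lemma inALaurM x y : inB x -> inB y -> inB (x * y).
Proof.
have [E [E0 EP _]] := inALaur_localized; move=> /EP hx /EP hy.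
by apply/EP/(localizedM polyFM hx hy).
Qed.

Lemma inALaur_fder (j : 'I_r.-1) x : inB x -> inB (fder j x).
Proof.
have [E [E0 EP _]] := inALaur_localized; move=> /EP hx.
apply/EP/(localized_der polyFD polyFM polyF_inj E0 (mderiv_derivation j) (fder_quotient j) hx).
Qed.

Lemma inALaur_baseF (k : K) : inB (baseF r k : F).
Proof. exact: inALaur_polyF. Qed.

Lemma inALaur_cpar k : inB (cpar R r k).
Proof. by have [p ->] := cpar_poly k; exact: inALaur_polyF. Qed.

Lemma inALaur_cparV : (2 <= r)%N -> inB (cpar R r r.-1)^-1.
Proof.
move=> hr; have r0 : (0 < r)%N by exact: ltnW.
have r1 : (0 < r.-1)%N by rewrite -ltnS prednK.
have prodS n : (0 < n)%N -> \prod_(1 <= k < n.+1) cpar R r k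
    = \prod_(1 <= k < n) cpar R r k * cpar R r n.
  by move=> n0; rewrite big_nat_recr.
have [E [E0 EP EE]] := inALaur_localized.
have [p pE] := cpar_poly r.-1.
have [q qE] : exists q, \prod_(1 <= k < r.-1) cpar R r k = polyF q.
  apply: (big_ind (fun x => exists q, x = polyF q)) => [|x y [a ->] [b ->]|k _].
  - by exists 1; rewrite polyF1.
  - by exists (a * b); rewrite polyFM.
  - exact: cpar_poly.
apply/EP; rewrite pE; apply: (localizedV E0 (b := q)); rewrite -EE -pE -qE mulrC.
by rewrite -(prodS _ r1) (prednK r0).
Qed.

Lemma inA_inALaur x : (2 <= r)%N -> inA x -> inB x.
Proof.
move=> hr [p [m ->]]; apply: inALaurM; first exact: inALaur_polyF.
by rewrite -exprVn; apply: (subPX inALaur1 inALaurM); exact: inALaur_cparV.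
Qed.

Lemma paramField_char0 n : (n.+1%:R : F) != 0.
Proof.
have -> : (n.+1%:R : F) = polyF (mpolyC r.-1 (FracField.tofrac (mpolyC 2 (n.+1%:R : R[i])))).
  rewrite !rmorph_nat; elim: n.+1 => [|m IH]; first by rewrite polyF0.
  by rewrite -addn1 !natrD polyFD polyF1 IH.
rewrite polyF_eq0 mpolyC_eq0.
rewrite tofrac_eq0 mpolyC_eq0.
by rewrite pnatr_eq0.
Qed.

Lemma baseFM (k l : K) : baseF r (k * l) = baseF r k * baseF r l :> F.
Proof. by rewrite /baseF -polyFM mpolyCM. Qed.
Lemma baseF1 : baseF r 1 = 1 :> F.
Proof. by rewrite /baseF mpolyC1 polyF1. Qed.
Lemma baseF_nat n : baseF r n%:R = n%:R :> F.
Proof.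
elim: n => [|n IH]; first by rewrite /baseF mpolyC0 polyF0.
by rewrite -addn1 !natrD -IH /baseF mpolyCD mpolyC1 polyFD polyF1.
Qed.
Lemma baseF_eq0 (k : K) : (baseF r k == 0 :> F) = (k == 0).
Proof. by rewrite /baseF polyF_eq0 mpolyC_eq0. Qed.

Lemma inALaur_natV n : inB (n.+1%:R)^-1.
Proof.
have n0 : n.+1%:R != 0 :> K by rewrite -baseF_eq0 baseF_nat paramField_char0.
have -> : (n.+1%:R : F)^-1 = baseF r (n.+1%:R^-1).
  apply: (mulfI (paramField_char0 n)); rewrite (mulfV (paramField_char0 n)).
  by rewrite -[X in _ = X * _]baseF_nat -baseFM (mulfV n0) baseF1.
exact: inALaur_baseF.
Qed.

End ParameterField.

Local Opaque polyF paramField baseField fder cpar Q c0.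

(** * The irregular vector of half-integer rank *)

Section IrregularVector.
Variables (R : realType) (r : nat).
Hypothesis hr : (2 <= r)%N.
Local Notation F := (paramField R r).
Local Notation LF := (laurent F).
Local Notation K := (baseField R).
Variables (M : lmodType F) (L : int -> {linear M -> M}) (v0 : M).
Hypothesis hM : irregular_verma L v0.
Variable dM : 'I_r.-1 -> M -> M.
Hypothesis hdM : parameter_derivations L v0 dM.

Local Notation c := (cpar R r).
Local Notation q := (Q R r).
Local Notation cz := (c0 R r).

Definition total_weight : nat -> F := gen_weight c q cz (Delta cz).
Definition central_charge12 : F := (1 + 6%:R * q ^+ 2) / 12%:R.

Lemma cpar_ge k : (r <= k)%N -> c k = 0.
Proof. by move=> rk; apply: cpar_out; rewrite prednK // ltnW. Qed.

Lemma quadcE n : quadc R r n = quad c n.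
Proof. exact: quad_square cpar_ge. Qed.

Lemma total_weightE n : (0 < n)%N -> weight' R r n = total_weight n.
Proof. by case: n => // n _; rewrite /weight' /total_weight /gen_weight quadcE. Qed.

Let r1 : (0 < r.-1)%N. Proof. by rewrite -ltnS prednK // ltnW. Qed.

Lemma L_v0_total_weight n : (r.-1 <= n)%N -> L n%:Z v0 = total_weight n *: v0.
Proof. by move=> rn; rewrite (verma_v0 hM rn) total_weightE // (leq_trans r1). Qed.

Lemma verma_spanning (m : M) : exists s (a : seq nat -> F),
  all is_partition s /\ m = \sum_(la <- s) a la *: word r L v0 la.
Proof. by have [s [a [gs _ mE]]] := verma_span hM m; exists s, a; split. Qed.

Lemma verma_independent (s : seq (seq nat)) (a : seq nat -> F) :
  uniq s -> all is_partition s -> \sum_(la <- s) a la *: word r L v0 la = 0 ->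
  forall la, la \in s -> a la = 0.
Proof. exact: (verma_free hM). Qed.

Lemma v0_neq0 : v0 != 0.
Proof.
apply/eqP => v00.
have e : \sum_(la <- [:: [::]]) (1 : F) *: pbw L v0 la = 0 by rewrite big_seq1 scale1r.
have /eqP := verma_free hM (s := [:: [::]]) (a := fun=> 1) isT isT e (mem_head _ _).
by rewrite oner_eq0.
Qed.

Lemma total_weight_out n : (2 * r - 2 < n)%N -> total_weight n = 0.
Proof.
case: n => // n rn; rewrite /total_weight /gen_weight (quad_out cpar_ge rn) subr0.
by rewrite cpar_ge ?mulr0 //; lia.
Qed.

Lemma total_weight_top : total_weight (2 * r - 2) = - (c r.-1 * c r.-1).
Proof.
rewrite /total_weight -(quad_top hr cpar_ge) /gen_weight.
have -> : (2 * r - 2 = (2 * r - 3).+1)%N by lia.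
by rewrite (cpar_ge (k := (2 * r - 3).+1)) ?mulr0 ?sub0r //; lia.
Qed.

Lemma total_weight_top_neq0 : total_weight (2 * r - 2) != 0.
Proof.
by rewrite total_weight_top oppr_eq0; apply: mulf_neq0; apply: cpar_neq0; rewrite r1 leqnn.
Qed.

Local Notation inB := (@inALaur R r).
Local Notation lat := (lattice verma_spanning inB).

Lemma inALaur_q : inB q. Proof. exact: inALaur_baseF. Qed.
Lemma inALaur_cz : inB cz. Proof. exact: inALaur_baseF. Qed.
Lemma inALaur_nat n : inB n%:R.
Proof. exact: (subP_nat (@inALaur1 R r) (@inALaurB R r)). Qed.
Lemma inALaurD x y : inB x -> inB y -> inB (x + y).
Proof. exact: (subPD (@inALaur1 R r) (@inALaurB R r)). Qed.
Lemma inALaurN x : inB x -> inB (- x).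
Proof. exact: (subPN (@inALaur1 R r) (@inALaurB R r)). Qed.

Lemma inALaur_quad n : inB (quad c n).
Proof.
apply: (subP_sum (@inALaur1 R r) (@inALaurB R r)) => p _.
by apply: inALaurM; exact: inALaur_cpar.
Qed.

Lemma inALaur_central : inB central_charge12.
Proof.
apply: inALaurM; last exact: inALaur_natV.
apply: inALaurD; first exact: inALaur1.
apply: inALaurM; first exact: inALaur_nat.
by rewrite expr2; apply: inALaurM; exact: inALaur_q.
Qed.

Lemma inALaur_weight n : inB (total_weight n).
Proof.
case: n => [|n].
  apply: inALaurM; first exact: inALaur_cz.
  by apply: inALaurB; [exact: inALaur_q | exact: inALaur_cz].
apply: inALaurB; last exact: inALaur_quad.
apply: inALaurM; last exact: inALaur_cpar.
by apply: inALaurB; (apply: inALaurM; first exact: inALaur_nat); [exact: inALaur_q | exact: inALaur_cz].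
Qed.

Lemma fder_central (j : 'I_r.-1) : fder j central_charge12 = 0.
Proof.
have hj := @fder_derivation R r j; have fn n : fder j (n%:R : F) = 0 := der_nat hj n.
have n12 : (12%:R : F) != 0 by exact: paramField_char0.
have : fder j (central_charge12 * 12%:R) = 0.
  rewrite /central_charge12 divfK // (derD hj) (der1 hj) (derM hj) fn expr2 (derM hj) fder_Q.
  by rewrite !(mul0r, mulr0, addr0).
rewrite (derM hj) fn mulr0 addr0 => /eqP; rewrite mulf_eq0 (negbTE n12) orbF.
by move/eqP.
Qed.

Lemma frame_der_cpar n k : frame_der c (@fder R r) n (c k) = k%:R * c (n + k).
Proof.
have [kr|rk] := leqP k r.-1; first exact: (frame_der_c (@fder_cpar R r)).
rewrite (@cpar_out R r _ rk) (@cpar_out R r _ (leq_trans rk (leq_addl n k))) mulr0.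
by apply: big1 => j _; rewrite fder0 mulr0.
Qed.

Lemma frame_der_derivation n : derivation (frame_der c (@fder R r) n).
Proof.
split=> x y.
  by rewrite /frame_der -big_split; apply: eq_bigr => j _; rewrite (derD (@fder_derivation R r j)) mulrDr.
rewrite /frame_der mulr_suml mulr_sumr -big_split; apply: eq_bigr => j _.
by rewrite (derM (@fder_derivation R r j)) mulrDr mulrA [X in _ + X]mulrCA.
Qed.

Lemma total_weight_cocycle n m :
  frame_der c (@fder R r) n (total_weight m) - frame_der c (@fder R r) m (total_weight n)
  = (m%:R - n%:R) * total_weight (m + n).
Proof.
apply: weight_cocycle.
- exact: frame_der_derivation.
- exact: frame_der_cpar.
- by move=> k; apply: big1 => j _; rewrite fder_Q mulr0.
- by move=> k; apply: big1 => j _; rewrite fder_c0 mulr0.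
move=> k; apply: big1 => j _; have hj := @fder_derivation R r j.
by rewrite /Delta (derM hj) (derB hj) fder_Q fder_c0 subr0 mul0r mulr0 addr0 mulr0.
Qed.

Lemma L_v0_low i : (i < r.-1)%N ->
  L i%:Z v0 = total_weight i *: v0 + frame_vec c dM i v0.
Proof.
case: i => [_|i ir]; first exact: (pd_L0 hdM).
rewrite (pd_Li hdM); last by lia.
rewrite total_weightE //; congr (_ + _); rewrite big_mkcond; apply: eq_bigr => j _.
case: ifP => // /negbT; rewrite -ltnNge => hj.
by rewrite /frame cpar_ge ?mulr0 ?scale0r //; lia.
Qed.

Let c_top : c r.-1 != 0. Proof. by apply: cpar_neq0; rewrite r1 leqnn. Qed.

Lemma verma_dM_L j p m : dM j (L p m) = L p (dM j m).
Proof.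
exact: (dM_L hr (verma_vir hM) L_v0_total_weight verma_spanning (@paramField_char0 R r)
  (@fder_derivation R r) fder_central (@cpar_out R r) c_top (pd_add hdM) (pd_leibniz hdM)
  (pd_comm hdM) L_v0_low total_weight_cocycle).
Qed.

Lemma verma_dM_commute j k m : dM j (dM k m) = dM k (dM j m).
Proof.
exact: (dM_commute hr (verma_vir hM) L_v0_total_weight verma_spanning (@paramField_char0 R r)
  (@fder_derivation R r) fder_central (@fder_cpar R r) (@fderC R r) (@cpar_out R r) c_top
  (pd_add hdM) (pd_leibniz hdM) (pd_comm hdM) L_v0_low total_weight_cocycle).
Qed.

Definition v0_coord (m : M) : F := coord verma_spanning [::] m.

Lemma v0_coord_linear a u v : v0_coord (a *: u + v) = a * v0_coord u + v0_coord v.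
Proof. exact: (coord_linear verma_spanning verma_independent). Qed.

Lemma v0_coord_v0 : v0_coord v0 = 1.
Proof. exact: (coord_basis verma_spanning verma_independent [::] (j := [::])). Qed.

Lemma verma_whittaker (u : M) :
  (forall n : nat, (r <= n)%N -> L n%:Z u = total_weight n *: u) -> u = v0_coord u *: v0.
Proof.
move=> hu; apply: (whittaker_vector hr (verma_vir hM) L_v0_total_weight (@paramField_char0 R r)
  total_weight_out total_weight_top_neq0 verma_spanning v0_neq0) => k k0.
by rewrite /raising hu ?subrr //; lia.
Qed.

Let B1 := @inALaur1 R r.
Let BB := @inALaurB R r.
Let BM := @inALaurM R r.

Lemma lat_scale a m : inB a -> lat m -> lat (a *: m).
Proof. exact: (latticeZ verma_independent BM). Qed.
Lemma lat_add m n : lat m -> lat n -> lat (m + n).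
Proof. exact: (latticeD verma_independent B1 BB). Qed.
Lemma lat_sub m n : lat m -> lat n -> lat (m - n).
Proof. exact: (latticeB verma_independent BB). Qed.
Lemma lat_sum (I : Type) (s : seq I) (P : pred I) (f : I -> M) :
  (forall i, P i -> lat (f i)) -> lat (\sum_(i <- s | P i) f i).
Proof. exact: (lattice_sum verma_independent B1 BB). Qed.

Lemma lat_L p m : lat m -> lat (L p m).
Proof.
apply: (lattice_L hr (verma_vir hM) L_v0_total_weight verma_independent B1 BB BM inALaur_central).
by move=> n _; exact: inALaur_weight.
Qed.

Lemma lat_dM j m : lat m -> lat (dM j m).
Proof.
apply: (lattice_dM hr (verma_vir hM) L_v0_total_weight (@paramField_char0 R r)
  (@fder_derivation R r) fder_central (@cpar_out R r) c_top (pd_add hdM) (pd_leibniz hdM)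
  (pd_comm hdM) L_v0_low total_weight_cocycle verma_independent B1 BB BM inALaur_central
  inALaur_weight (@inALaur_cpar R r)).
- move=> k; rewrite invfM; apply: BM; first exact: inALaur_natV.
  exact: inALaur_cparV.
- exact: inALaur_fder.
Qed.

Lemma lat_MA m : in_MA L v0 m -> lat m.
Proof.
move=> [s [a [_ ha ->]]]; apply: lat_sum => la _; apply: lat_scale; first exact: inA_inALaur.
rewrite -[pbw _ _ _]/(word r L v0 la).
exact: (lattice_word hr (verma_vir hM) L_v0_total_weight verma_spanning verma_independent B1 BB BM inALaur_central
  (fun n _ => inALaur_weight n)).
Qed.

Lemma lat_series_scale (a : LF) (x : mlaurent M) : lsub inB a -> (forall n, lat (x n)) ->
  forall n, lat ((a *: x) n).
Proof.
move=> ha hx n; have [N hN] := lboundP a; have [P hP] := mboundP x.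
have hT : n - N - (absz (n - N - P + 1))%:Z < P by lia.
rewrite (mscaleE_bounded hN hP hT).
by apply: lat_sum => i _; apply: lat_scale; [exact: ha | exact: hx].
Qed.

Lemma pder_par (k : 'I_r.-1) (a : LF) : pder k a = lmap (@fder0 R r k) a.
Proof. by rewrite /pder valK. Qed.

Lemma pder_top (a : LF) : pder r.-1 a = lderiv a.
Proof. by rewrite /pder insubN // ltnn. Qed.

Lemma pder_derivation j : derivation (@pder R r j).
Proof.
rewrite /pder; case: insubP => [k _ _|_]; last exact: lderiv_derivation.
exact/lmap_derivation/fder_derivation.
Qed.

Lemma pderC i j (a : LF) : pder i (pder j a) = pder j (pder i a).
Proof.
rewrite /pder; case: insubP => [k _ _|_]; case: insubP => [l _ _|_] //.
- exact/lmapC/fderC.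
- exact/lmap_lderiv/fder_derivation.
- exact/esym/lmap_lderiv/fder_derivation.
Qed.

Lemma big_ord_pred (V : nmodType) (f : nat -> V) :
  \sum_(j < r) f j = \sum_(k < r.-1) f k + f r.-1.
Proof.
rewrite -(big_mkord xpredT f) -(big_mkord xpredT f).
have rE : r = r.-1.+1 by rewrite prednK // ltnW.
by rewrite {1}rE big_nat_recr.
Qed.

Lemma weightS_top : weightS R r (2 * r - 1) = lmon 1 1.
Proof. by rewrite /weightS ifN ?eqxx // -ltnNge; lia. Qed.

Lemma weightS_low m : (m <= 2 * r - 2)%N -> weightS R r m = lmon 0 (- quad c m).
Proof. by move=> mr; rewrite /weightS mr quadcE. Qed.

(** For n >= r the parameter c_n is zero, so Lambda'_n reduces to Lambda_n. The index 2r - 1 is the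
    exception, with Lambda'_n zero and weight Lambda. *)
Lemma weightS_gen n : (r <= n)%N -> n != (2 * r - 1)%N -> weightS R r n = lmon 0 (total_weight n).
Proof.
move=> rn n1; have [nr|rn'] := leqP n (2 * r - 2).
  rewrite weightS_low //; case: n rn {n1 nr} => [|n] rn; first by move: rn; rewrite leqNgt ltnW.
  by rewrite /total_weight /gen_weight cpar_ge // mulr0 sub0r.
by rewrite total_weight_out // lmon0 /weightS ifN -?ltnNge // (negbTE n1).
Qed.

Lemma weightS_lsub n : lsub inB (weightS R r n).
Proof.
have [nr|rn'] := leqP n (2 * r - 2).
  by rewrite weightS_low //; apply: (lsub_mon B1 BB); apply: inALaurN; exact: inALaur_quad.
have [->|n1] := eqVneq n (2 * r - 1)%N; first by rewrite weightS_top; apply: (lsub_mon B1 BB).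
by rewrite weightS_gen //; [apply: (lsub_mon B1 BB); exact: inALaur_weight | lia].
Qed.

Section VectorFields.
Variable h : nat -> nat -> LF.
Hypothesis hh : vf_equations h.
Local Notation vf := (vf_coef h).

Lemma vf_coef_out i j : (j < r)%N -> (r <= i + j)%N -> vf i j = 0.
Proof.
by case: i => [|i] jr rij; rewrite /vf_coef; [move: rij; rewrite leqNgt jr | rewrite ifN // -ltnNge; lia].
Qed.

Lemma vf_coef_euler j : (j < r.-1)%N -> vf 0 j = lmon 0 (j.+1%:R * c j.+1).
Proof. by move=> jr; rewrite /vf_coef ifT //; lia. Qed.

Lemma vf_coef_euler_top : vf 0 r.-1 = (2 * r - 1)%:R * lmon 1 1.
Proof. by rewrite /vf_coef ifN // -leqNgt prednK // ltnW. Qed.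

Lemma vf_coef_eq n m : (0 < n < r)%N -> (r <= m <= 2 * r - 2)%N ->
  \sum_(j < r.-1) vf n j * lmon 0 (- (2%:R * c (m - j.+1))) = (m%:R - n%:R) * weightS R r (m + n).
Proof.
move=> nr mr; have nr' : (1 <= n <= r - 1)%N by lia.
have mr' : (r <= m <= 2 * r - 1)%N by lia.
rewrite -(hh nr' mr') /vfield (big_ord_pred (fun j => vf n j * pder j (weightS R r m))).
have mr2 : (m <= 2 * r - 2)%N by case/andP: mr.
rewrite (weightS_low mr2) pder_top lderiv_const mulr0 addr0; apply: eq_bigr => k _.
rewrite pder_par lmap_mon (derN (@fder_derivation R r k)).
rewrite (der_quad_coord (k := k.+1) (@fder_derivation R r k) (@fder_cpar R r k)) //.
by have := ltn_ord k; lia.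
Qed.

Let char0 := @paramField_char0 R r.
Let BcV : inB (c r.-1)^-1 := @inALaur_cparV R r hr.

Lemma vf_coef_lsub i j : (i < r)%N -> (j < r)%N -> lsub inB (vf i j).
Proof.
exact: (vf_lsub hr char0 (@cpar_out R r) c_top B1 BB BM (@inALaur_cpar R r) BcV
  (@inALaur_natV R r) weightS_lsub vf_coef_out vf_coef_euler vf_coef_euler_top vf_coef_eq).
Qed.

Lemma vf_coef_unitmx : vf_matrix h \in unitmx.
Proof.
apply: (vf_unitmx hr char0 (@cpar_out R r) c_top B1 BB BM (@inALaur_cpar R r)
  (@inALaur_natV R r) weightS_top vf_coef_out vf_coef_euler_top vf_coef_eq).
by move=> i j; rewrite mxE.
Qed.

Lemma vf_coef_nondeg (x : 'I_r -> LF) :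
  (forall i, (i < r)%N -> \sum_(j < r) vf i j * x j = 0) -> forall j, x j = 0.
Proof.
exact: (vf_nondeg hr char0 (@cpar_out R r) c_top B1 BB BM (@inALaur_cpar R r) BcV
  (@inALaur_natV R r) weightS_lsub weightS_top vf_coef_out vf_coef_euler vf_coef_euler_top vf_coef_eq).
Qed.

Lemma vf_coef_solve_lsub (x : nat -> LF) :
  (forall i, (i < r)%N -> lsub inB (\sum_(j < r) vf i j * x j)) ->
  forall j : nat, (j < r)%N -> lsub inB (x j).
Proof.
exact: (vf_solve_lsub hr char0 (@cpar_out R r) c_top B1 BB BM (@inALaur_cpar R r) BcV
  (@inALaur_natV R r) weightS_lsub weightS_top vf_coef_out vf_coef_euler vf_coef_euler_top vf_coef_eq).
Qed.

Definition vf_inv (j m : nat) : LF := invmx (vf_matrix h) (inord j) (inord m).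

Lemma vf_inv_last m : inv_last h m = vf_inv r.-1 m.
Proof.
rewrite /inv_last /vf_inv; congr (invmx _ _ _).
by apply: val_inj; rewrite /= inordK.
Qed.

Lemma big_ord_predS (V : nmodType) (f : nat -> V) : \sum_(j < r) f j = \sum_(j < r.-1.+1) f j.
Proof. by rewrite -(big_mkord xpredT f) -(big_mkord xpredT f) prednK // ltnW. Qed.

Lemma vf_invl j k : (j < r)%N -> (k < r)%N -> \sum_(m < r) vf_inv j m * vf m k = (j == k)%:R.
Proof.
have rE : r.-1.+1 = r by rewrite prednK // ltnW.
move=> jr kr; have := mulVmx vf_coef_unitmx => /matrixP/(_ (inord j) (inord k)).
rewrite !mxE -val_eqE /= !inordK ?rE // => <-.
rewrite (big_ord_predS (fun m => vf_inv j m * vf m k)); apply: eq_bigr => m _.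
by rewrite /vf_inv inord_val mxE inordK ?rE.
Qed.

Lemma vf_invr i l : (i < r)%N -> (l < r)%N -> \sum_(j < r) vf i j * vf_inv j l = (i == l)%:R.
Proof.
have rE : r.-1.+1 = r by rewrite prednK // ltnW.
move=> jr kr; have := mulmxV vf_coef_unitmx => /matrixP/(_ (inord i) (inord l)).
rewrite !mxE -val_eqE /= !inordK ?rE // => <-.
rewrite (big_ord_predS (fun m => vf i m * vf_inv m l)); apply: eq_bigr => m _.
by rewrite /vf_inv inord_val mxE inordK ?rE.
Qed.

Section Canonical.
Variable sigma : nat -> LF.
Hypothesis hsigma : Lstar_gauge h sigma.
Variables (nu : F) (g : nat -> F) (v : nat -> M).
Hypothesis hW : canonical_vector h L v0 dM nu g v.
Local Notation X := (mlaurent M).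

(** Together with [gauge_u] this writes all operators calL_i in one form, the high ones being
    multiplications with no vector field. *)
Definition gauge_tau (i : nat) : LF := if (i < r)%N then sigma i else weightS R r i.
Definition gauge_u (i j : nat) : LF := if (i < r)%N then vf i j else 0.

Lemma verma_dM0 k : dM k 0 = 0.
Proof. by apply: (addrI (dM k 0)); rewrite -(pd_add hdM) !addr0. Qed.

Definition par_der (j : nat) (x : X) : X :=
  if insub j is Some k then mlmap (verma_dM0 k) x else mlderiv x.

Lemma par_derD j x y : par_der j (x + y) = par_der j x + par_der j y.
Proof.
rewrite /par_der; case: insubP => [k _ _|_]; last exact: mlderivD.
exact/mlmapD/(pd_add hdM).
Qed.

Lemma par_derZ j (a : LF) x : par_der j (a *: x) = pder j a *: x + a *: par_der j x.
Proof.
rewrite /par_der /pder; case: insubP => [k _ _|_]; last exact: mlderivZ.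
exact: (mlmapZ (@fder0 R r k) (verma_dM0 k) (pd_add hdM k) (pd_leibniz hdM k)).
Qed.

Lemma par_der_const j (t : K) (x : X) :
  par_der j (lmon 0 (baseF r t) *: x) = lmon 0 (baseF r t) *: par_der j x.
Proof.
rewrite par_derZ (_ : pder j _ = 0) ?scale0r ?add0r // /pder.
by case: insubP => [k _ _|_]; rewrite ?lderiv_const // lmap_mon fder_baseF lmon0.
Qed.

Lemma dM_mlderiv k x : mlmap (verma_dM0 k) (mlderiv x) = mlderiv (mlmap (verma_dM0 k) x).
Proof.
apply: mlaurentP => n /=.
by rewrite (pd_leibniz hdM) (der_int (@fder_derivation R r k)) scale0r add0r.
Qed.

Lemma par_derC j k x : par_der j (par_der k x) = par_der k (par_der j x).
Proof.
rewrite /par_der; case: insubP => [a _ _|_]; case: insubP => [b _ _|_] //.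
- by apply: mlaurentP => n /=; exact: verma_dM_commute.
- exact: dM_mlderiv.
- exact/esym/dM_mlderiv.
Qed.

Definition Lser (n : nat) : {linear X -> X} := mlmap_lin (L n%:Z).

Lemma par_der_L j n x : par_der j (Lser n x) = Lser n (par_der j x).
Proof.
rewrite /par_der; case: insubP => [k _ _|_]; apply: mlaurentP => m /=.
  exact: verma_dM_L.
by rewrite linearZ.
Qed.

Lemma mcoef_const (t : F) (x : X) n : (lmon 0 t *: x) n = t *: x n.
Proof. by rewrite mcoef_scale_mon subr0. Qed.

Lemma Lser_bracket i l x :
  Lser i (Lser l x) - Lser l (Lser i x) = (i%:R - l%:R) *: Lser (i + l)%N x.
Proof.
rewrite -!lmon_nat -lmonN -lmonD; apply: mlaurentP => n; rewrite mcoef_const mcoefD mcoefN /=.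
rewrite (verma_vir hM) rmorphB /=; case: ifP => [/eqP il0|_]; last by rewrite addr0.
have [-> ->] : i = 0%N /\ l = 0%N by lia.
have -> : (0%N%:Z : int) ^+ 3 - 0%N%:Z = 0 by [].
by rewrite mulr0 scale0r addr0.
Qed.

Local Notation dlog := (dlog_prefactor nu g).
Definition log_coef (j : nat) : LF := (dlog j)`_0.
Definition log_pol : LF := \sum_(1 <= j < r) lmon (- j%:Z) (g j).

Lemma logP_coef i : (logP nu g)`_i = if i is 0 then log_pol else if i is 1 then lmon 0 nu else 0.
Proof.
rewrite /logP coefD coefZ coefX coefC; case: i => [|[|i]] /=.
- by rewrite mulr0 add0r.
- by rewrite mulr1 addr0.
- by rewrite mulr0 addr0.
Qed.

Lemma pder0 j : @pder R r j 0 = 0. Proof. exact: (der0 (pder_derivation j)). Qed.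

Lemma dlog_par (k : 'I_r.-1) i : (dlog k)`_i =
  if i is 0 then pder k log_pol else if i is 1 then lmon 0 (fder k nu) else 0.
Proof.
rewrite /dlog_prefactor /lpder ltn_ord addr0 coef_map_id0 ?pder0 // logP_coef.
by case: i => [|[|i]] //; rewrite ?pder0 // pder_par lmap_mon.
Qed.

Lemma dlog_top i : (dlog r.-1)`_i =
  if i is 0 then lderiv log_pol + lmon (-1) nu else 0.
Proof.
rewrite /dlog_prefactor /lpder ltnn coefD coefZ coef_deriv coef_map_id0 ?pder0 // !logP_coef.
rewrite !pder_top; case: i => [|[|i]].
- by rewrite mulr1n lmonM mul1r addr0.
- by rewrite mul0rn mulr0 lderiv_const addr0.
- by rewrite mul0rn mulr0 addr0 (der0 (@lderiv_derivation _)).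
Qed.

(* The connection without the term [nu log Lambda] of log P: it acts on log-free bodies, at
   the price of the curvature [- dnu / Lambda] of [log_curv_top]. *)
Definition log_conn (j : nat) (x : X) : X := par_der j x + log_coef j *: x.
Definition log_curv (j k : nat) : LF := pder j (log_coef k) - pder k (log_coef j).

Lemma log_connD j x y : log_conn j (x + y) = log_conn j x + log_conn j y.
Proof. by rewrite /log_conn par_derD scalerDr addrACA. Qed.

Lemma log_connZ j (a : LF) x : log_conn j (a *: x) = pder j a *: x + a *: log_conn j x.
Proof. by rewrite /log_conn par_derZ scalerDr !scalerA -addrA [a * _]mulrC. Qed.

Lemma log_connK j k x : log_conn j (log_conn k x) - log_conn k (log_conn j x) = log_curv j k *: x.
Proof.
have e a b : log_conn a (log_conn b x) = (par_der a (par_der b x)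
    + (log_coef b *: par_der a x + log_coef a *: par_der b x) + (log_coef a * log_coef b) *: x)
    + pder a (log_coef b) *: x.
  rewrite {1}/log_conn [log_conn b x]/log_conn par_derD par_derZ scalerDr scalerA.
  rewrite [pder a _ *: x + _]addrC [par_der a (par_der b x) + (_ + _)]addrA [LHS]addrAC.
  by rewrite !addrA.
rewrite !e par_derC [log_coef j *: _ + _]addrC [log_coef j * _]mulrC opprD addrACA subrr add0r.
by rewrite -scalerBl.
Qed.

Lemma log_connL j n x : log_conn j (Lser n x) = Lser n (log_conn j x).
Proof. by rewrite /log_conn par_der_L linearD linearZ. Qed.

Lemma log_curv_par (j k : 'I_r.-1) : log_curv j k = 0.
Proof. by rewrite /log_curv /log_coef !dlog_par pderC subrr. Qed.

Lemma log_curv_top (k : 'I_r.-1) : log_curv r.-1 k = - lmon (-1) (fder k nu).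
Proof.
rewrite /log_curv /log_coef dlog_par dlog_top (derD (pder_derivation k)).
rewrite [pder k (lmon _ _)]pder_par lmap_mon -pder_top.
by rewrite pderC opprD addrA subrr sub0r.
Qed.

(** The coordinate functions c_1, ..., c_(r-1), Lambda, on which the operator relations are
    tested. *)
Definition scalar_coord (k : nat) : LF := if (k < r.-1)%N then lmon 0 (c k.+1) else Lambda R r.

Lemma pder_scalar_coord j k : (j < r)%N -> (k < r)%N ->
  pder j (scalar_coord k) = if j == k then 1 else 0.
Proof.
have rE : r.-1.+1 = r by rewrite prednK // ltnW.
move=> jr kr; rewrite /scalar_coord; have [kr'|rk] := ltnP k r.-1; last first.
  have -> : k = r.-1 by apply/eqP; rewrite eqn_leq rk -ltnS rE kr.
  have [jr'|rj] := ltnP j r.-1.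
    rewrite (pder_par (Ordinal jr')) lmap_mon (der1 (@fder_derivation R r _)) lmon0.
    by rewrite (ltn_eqF jr').
  have -> : j = r.-1 by apply/eqP; rewrite eqn_leq rj -ltnS rE jr.
  by rewrite pder_top /Lambda lderiv_mon mulr1z mulr1 subrr eqxx.
have [jr'|rj] := ltnP j r.-1.
  rewrite (pder_par (Ordinal jr')) lmap_mon fder_cpar eqSS eq_sym.
  by case: eqP => _; [exact: lmon1 | exact: lmon0].
have -> : j = r.-1 by apply/eqP; rewrite eqn_leq rj -ltnS rE jr.
by rewrite pder_top lderiv_const (gtn_eqF kr').
Qed.

Lemma gauge_bracket i l (a : LF) :
  let C := fun i (a : LF) => gauge_tau i * a + \sum_(j < r) gauge_u i j * pder j a in
  C i (C l a) - C l (C i a) = (l%:R - i%:R) * C (i + l)%N a.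
Proof.
move=> C; have CE m s : calL_scalar h sigma m s = C m s.
  rewrite /calL_scalar /C /gauge_tau /gauge_u; case: ifP => // _.
  by rewrite big1 ?addr0 // => j _; rewrite mul0r.
by rewrite -!CE (gauge_comm hsigma).
Qed.

Lemma gauge_tau_cocycle i l :
  vder_scalar r (@pder R r) gauge_u i (gauge_tau l)
  - vder_scalar r (@pder R r) gauge_u l (gauge_tau i) = (l%:R - i%:R) * gauge_tau (i + l)%N.
Proof. exact: (operator_tau_cocycle pder_derivation gauge_bracket). Qed.

Lemma gauge_u_bracket i l k : (k < r)%N ->
  vder_scalar r (@pder R r) gauge_u i (gauge_u l k)
  - vder_scalar r (@pder R r) gauge_u l (gauge_u i k) = (l%:R - i%:R) * gauge_u (i + l)%N k.
Proof. exact: (operator_u_bracket pder_derivation pder_scalar_coord gauge_bracket). Qed.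

Fact Wser_bound : lbounded (fun n : int => if n is Posz k then v k else 0).
Proof. by exists 0 => -[]. Qed.
Definition Wser : X := MLaurent Wser_bound.

Definition log_free (x : X) : nat -> int -> M := fun a n => if a is 0 then x n else 0.

Lemma power_series_log_free : power_series v = log_free Wser.
Proof. by apply/funext => a; apply/funext => n; case: a. Qed.

Lemma lact_const (a : LF) (w : nat -> int -> M) i n : lact a%:P w i n = ract a (w i) n.
Proof.
rewrite /lact big_ord_recl [X in _ + X]big1 ?addr0 => [|k _].
  by rewrite coefC eqxx subn0.
apply: fsbig1 => m _; rewrite coefC lift0.
by rewrite -[LHS]/((0 : LF) m *: w (i - k.+1)%N (n - m)) lcoef0 scale0r.
Qed.

Lemma lact_log_free (p : {poly LF}) (x : X) i n : lact p (log_free x) i n = (p`_i *: x) n.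
Proof.
rewrite /lact big_ord_recr /= subnn [X in X + _]big1 ?add0r // => k _.
apply: fsbig1 => m _; rewrite /log_free; have := ltn_ord k; rewrite -subn_gt0.
by case: (i - k)%N => // l _; rewrite scaler0.
Qed.

Definition nabla_coef (pref : nat -> {poly LF}) (j : nat) (x : X) (i : nat) : X :=
  (if i is 0 then par_der j x else 0) + (pref j)`_i *: x.

Lemma nabla_log_free pref j x i : nabla dM pref j (log_free x) i = nabla_coef pref j x i :> (int -> M).
Proof.
apply/funext => n; rewrite /nabla /nabla_coef /=.
rewrite -[LHS]/(vder dM j (log_free x) i n + lact (pref j) (log_free x) i n) lact_log_free; congr (_ + _).
rewrite /vder /par_der /log_free; case: insubP => [k _ _|_]; case: i => [|i] //=.
- exact: verma_dM0.
- by rewrite scaler0 addr0.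
- by rewrite !scaler0 addr0.
Qed.

Lemma lact_sum (n : nat) (f : 'I_n -> nat -> int -> M) i m :
  (\sum_(j < n) f j) i m = \sum_(j < n) f j i m.
Proof. by elim/big_rec2: _ => // j y1 y2 _ <-. Qed.

Lemma W_low_eq n : (r <= n <= 2 * r - 1)%N -> Lser n Wser = weightS R r n *: Wser.
Proof.
move=> hn; apply: mlaurentP => m.
have := congr1 (fun f : nat -> int -> M => f 0%N m) (cv_Ln hW hn).
by rewrite power_series_log_free lact_log_free coefC eqxx.
Qed.

Local Notation R_ := (gauge_defect r log_conn Lser gauge_tau gauge_u).

Lemma gauge_uE i j : (i < r)%N -> gauge_u i j = vf i j.
Proof. by rewrite /gauge_u => ->. Qed.

Lemma Lambda_unit : Lambda R r \is a GRing.unit.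
Proof. by apply/unitrPr; exists (lmon (-1) 1); rewrite lmonM mul1r. Qed.

Lemma star_series : \sum_(m < r) vf_inv r.-1 m *: Lser m Wser = log_conn r.-1 Wser.
Proof.
have e : \sum_(m < r) Lstar_coef h m *: Lser m Wser = Lambda R r ^+ r *: log_conn r.-1 Wser.
  apply: mlaurentP => n.
  have := congr1 (fun f : nat -> int -> M => f 0%N n) (cv_Lstar hW).
  rewrite /= lact_const power_series_log_free nabla_log_free /nabla_coef => <-.
  rewrite /Lstar lact_sum mcoef_sum; apply: eq_bigr => m _.
  by rewrite lact_const.
have Lr : Lambda R r ^+ r \is a GRing.unit by rewrite unitrX // Lambda_unit.
rewrite -[RHS]scale1r -(mulVr Lr) -scalerA -e scaler_sumr; apply: eq_bigr => m _.
by rewrite scalerA /Lstar_coef mulrA mulVr // mul1r vf_inv_last.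
Qed.

(** The last row of the inverse matrix contracts the vector fields to the Lambda-derivative and, by
    the gauge normalization, the scalars [sigma] to zero. The defect combination is thus the [L_*]
    equation divided by Lambda^r. *)
Lemma W_star_eq : \sum_(m < r) vf_inv r.-1 m *: R_ m Wser = 0.
Proof.
have rr : (r.-1 < r)%N by rewrite prednK // ltnW.
rewrite /gauge_defect; under eq_bigr => m _ do rewrite scalerBr.
rewrite sumrB star_series /gauge_op.
under eq_bigr => m _ do rewrite scalerDr scalerA.
rewrite big_split -scaler_suml /=.
rewrite [X in X *: _](_ : _ = 0) ?scale0r ?add0r; last first.
  rewrite -[RHS](gauge_norm hsigma); apply: eq_bigr => m _.
  by rewrite vf_inv_last /gauge_tau ltn_ord.
apply/eqP; rewrite subr_eq0 eq_sym; apply/eqP.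
transitivity (\sum_(j < r) (r.-1 == j)%:R *: log_conn j Wser).
  under eq_bigr => m _ do rewrite /vder_vec scaler_sumr.
  rewrite exchange_big; apply: eq_bigr => j _ /=.
  rewrite -(vf_invl rr (ltn_ord j)) scaler_suml; apply: eq_bigr => m _.
  by rewrite scalerA gauge_uE.
rewrite (bigD1 (Ordinal rr)) //= eqxx scale1r big1 ?addr0 // => j jr.
by rewrite (_ : (r.-1 == j)%N = false) ?scale0r //; apply: negbTE; rewrite eq_sym.
Qed.

Lemma lat0 : lat 0.
Proof. exact: (lattice0 verma_spanning verma_independent B1 BB). Qed.

Lemma lat_W n : lat (Wser n).
Proof. by case: n => k; [apply: lat_MA; exact: (cv_v hW) | exact: lat0]. Qed.

Lemma lat_par_der j (x : X) : (forall n, lat (x n)) -> forall n, lat (par_der j x n).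
Proof.
move=> hx n; rewrite /par_der; case: insubP => [k _ _|_]; first exact/lat_dM/hx.
by apply: lat_scale; [exact: (subP_int B1 BB) | exact: hx].
Qed.

Lemma log_pol_lsub : lsub inB log_pol.
Proof.
rewrite /log_pol big_nat; apply: (lsub_sum B1 BB) => j jr; apply: (lsub_mon B1 BB).
by apply: inA_inALaur => //; exact: (cv_g hW).
Qed.

Lemma lsub_pder j (a : LF) : lsub inB a -> lsub inB (pder j a).
Proof.
move=> ha n; rewrite /pder; case: insubP => [k _ _|_]; first exact/inALaur_fder/ha.
by apply: BM; [exact: (subP_int B1 BB) | exact: ha].
Qed.

Lemma log_coef_lsub j : (j < r)%N -> lsub inB (log_coef j).
Proof.
move=> jr; have [jr'|rj] := ltnP j r.-1.
  by rewrite /log_coef (dlog_par (Ordinal jr')); apply: lsub_pder; exact: log_pol_lsub.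
have -> : j = r.-1 by apply/eqP; rewrite eqn_leq rj -ltnS prednK ?jr // ltnW.
rewrite /log_coef dlog_top; apply: (lsubD B1 BB).
  by rewrite -pder_top; apply: lsub_pder; exact: log_pol_lsub.
by apply: (lsub_mon B1 BB); apply: inA_inALaur => //; exact: (cv_nu hW).
Qed.

(** All ingredients of R_i have coefficients in A_Laur; this later places the eigenvalues there. *)
Lemma lat_defect i n : (i < r)%N -> lat (R_ i Wser n).
Proof.
move=> ir; rewrite /gauge_defect /gauge_op mcoefD mcoefN mcoefD; apply: lat_sub.
  exact/lat_L/lat_W.
apply: lat_add.
  apply: lat_series_scale lat_W _; rewrite /gauge_tau ir => k; exact: (gauge_coef hsigma).
rewrite /vder_vec mcoef_sum; apply: lat_sum => j _.
rewrite gauge_uE //; apply: lat_series_scale; first exact: vf_coef_lsub.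
move=> m; rewrite /log_conn mcoefD; apply: lat_add; first exact/lat_par_der/lat_W.
by apply: lat_series_scale lat_W _; exact: log_coef_lsub.
Qed.

Lemma gauge_u_high i j : (r <= i)%N -> gauge_u i j = 0.
Proof. by move=> ri; rewrite /gauge_u ltnNge ri. Qed.
Lemma gauge_tau_high i : (r <= i)%N -> gauge_tau i = weightS R r i.
Proof. by move=> ri; rewrite /gauge_tau ltnNge ri. Qed.

Lemma gauge_u_invl j k : (j < r)%N -> (k < r)%N ->
  \sum_(m < r) vf_inv j m * gauge_u m k = (j == k)%:R.
Proof. by move=> jr kr; rewrite -(vf_invl jr kr); apply: eq_bigr => m _; rewrite gauge_uE. Qed.

Lemma gauge_u_euler : gauge_u 0 0 \is a GRing.unit.
Proof.
rewrite gauge_uE ?(ltnW hr) // vf_coef_euler // mul1r.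
have c1 : c 1 != 0 by apply: cpar_neq0; rewrite r1.
by apply/unitrPr; exists (lmon 0 (c 1)^-1); rewrite lmonM divff.
Qed.

Lemma Wser_free (a : LF) : a *: Wser = 0 -> a = 0.
Proof.
apply: (W_free v0_coord_linear v0_coord_v0) => [[]|] //=.
exact: (cv_v0 hW).
Qed.

Lemma W_all n : (r <= n)%N -> Lser n Wser = weightS R r n *: Wser.
Proof.
exact: (W_whittaker_all hr char0 pder_derivation log_connD log_connZ log_connK log_connL
  Lser_bracket gauge_tau_cocycle gauge_u_bracket gauge_u_high gauge_tau_high gauge_u_invl
  gauge_u_euler W_low_eq W_star_eq).
Qed.

Lemma defect_eigen i : (i < r)%N -> exists2 rho : LF, lsub inB rho & R_ i Wser = rho *: Wser.
Proof.
move=> ir.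
have w_top0 : total_weight (2 * r - 1) = 0 by apply: total_weight_out; lia.
have W_neg (n : int) : n < 0 -> Wser n = 0 by case: n.
have W_zero : Wser 0 = v0 := cv_v0 hW.
have W_lat n : inB (v0_coord (Wser n)) by exact: lat_W.
have R_lat n : inB (v0_coord (R_ i Wser n)) by exact: lat_defect.
have R_whit n : (r <= n)%N -> Lser n (R_ i Wser) = weightS R r n *: R_ i Wser.
  exact: (defect_whittaker hr char0 pder_derivation log_connD log_connZ log_connK log_connL
    Lser_bracket gauge_tau_cocycle gauge_u_bracket gauge_u_high gauge_tau_high gauge_u_invl
    gauge_u_euler W_low_eq W_star_eq i).
exact: (whittaker_series v0_coord_linear v0_coord_v0 verma_whittaker weightS_gen weightS_top
  w_top0 B1 BB BM W_neg W_zero W_all W_lat R_lat R_whit).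
Qed.

Lemma connection_form : exists omega : 'I_r.-1 -> F,
  [/\ forall k, inB (omega k), forall j k, fder j (omega k) = fder k (omega j),
      forall k : 'I_r.-1, fder k nu = 0
    & forall i, (i < r)%N -> R_ i Wser = \sum_(k < r.-1) (vf i k * lmon 0 (omega k)) *: Wser].
Proof.
have ex_rho i : exists rho : LF, (i < r)%N -> lsub inB rho /\ R_ i Wser = rho *: Wser.
  have [ir|ri] := ltnP i r; last by exists 0.
  by have [x xB xE] := defect_eigen ir; exists x.
have [rho hrho] := choice ex_rho.
have uN i l : (i < r)%N -> (l < r)%N -> \sum_(j < r) gauge_u i j * vf_inv j l = (i == l)%:R.
  by move=> ir lr; rewrite -(vf_invr ir lr); apply: eq_bigr => j _; rewrite gauge_uE.
have nondeg (x : 'I_r -> LF) : (forall i, (i < r)%N -> \sum_(j < r) gauge_u i j * x j = 0) ->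
    forall j, x j = 0.
  move=> hx; apply: vf_coef_nondeg => i ir; rewrite -[RHS](hx i ir).
  by apply: eq_bigr => j _; rewrite gauge_uE.
have solve (x : nat -> LF) : (forall i, (i < r)%N -> lsub inB (\sum_(j < r) gauge_u i j * x j)) ->
    forall j, (j < r)%N -> lsub inB (x j).
  move=> hx; apply: vf_coef_solve_lsub => i ir.
  by under eq_bigr => j _ do rewrite -gauge_uE //; exact: hx.
have [omega [oB oC onu oE]] := flat_gauge hr char0 pder_derivation log_connD log_connZ log_connK
  log_connL Lser_bracket gauge_tau_cocycle gauge_u_bracket gauge_u_high gauge_tau_high
  gauge_u_invl gauge_u_euler W_low_eq W_star_eq Wser_free (fun i ir => (hrho i ir).1)
  (fun i ir => (hrho i ir).2) uN nondeg solve pder_par pder_top log_curv_top log_curv_par.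
exists omega; split=> // i ir; rewrite oE //; apply: eq_bigr => k _.
by rewrite gauge_uE.
Qed.

(** The coefficient of (log Lambda)^a in the transported R_i on a log-free body; in positive degree
    only the derivatives of the prefactor can contribute. *)
Definition rop_coef (pref : nat -> {poly LF}) (i : nat) (x : X) (a : nat) : X :=
  (if a is 0 then Lser i x - sigma i *: x else 0) - \sum_(j < r) vf i j *: nabla_coef pref j x a.

Lemma Rop_log_free pref i (x : X) a n : (i < r)%N ->
  Rop h sigma L dM pref i (log_free x) a n = rop_coef pref i x a n.
Proof.
move=> ir; rewrite /Rop /calL ir.
rewrite -[LHS]/(L i%:Z (log_free x a n) - (lact (sigma i)%:P (log_free x) a n
  + (\sum_(j < r) lact (vf i j)%:P (nabla dM pref j (log_free x))) a n)).
rewrite lact_sum lact_log_free opprD addrA /rop_coef mcoefD mcoefN; congr (_ - _); last first.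
  by rewrite mcoef_sum; apply: eq_bigr => j _; rewrite lact_const nabla_log_free.
case: a => [|a]; first by rewrite coefC eqxx mcoefD mcoefN.
by rewrite /log_free linear0 coefC scale0r subr0.
Qed.

Lemma ff_body_log_free (f : formal_function R r) :
  ff_body f (power_series v) = log_free (lmon 0 (baseF r (ff_const f)) *: Wser).
Proof.
apply/funext => a; apply/funext => n; rewrite power_series_log_free /ff_body /log_free.
by case: a => [|a]; [rewrite mcoef_const | rewrite scaler0].
Qed.

Lemma ff_dlog_par (f : formal_function R r) (k : 'I_r.-1) : ff_dlog f k = (lmon 0 (ff_dh f k))%:P.
Proof. by rewrite /ff_dlog valK. Qed.

Lemma ff_dlog_top (f : formal_function R r) : ff_dlog f r.-1 = 0.
Proof. by rewrite /ff_dlog insubN // ltnn. Qed.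

(** A factor e^h adds V_i(h) to the gauge operator and so subtracts it from the eigenvalue, while
    the constant of f commutes with everything. *)
Lemma rop_coef0 (f : formal_function R r) i : (i < r)%N ->
  let t : LF := lmon 0 (baseF r (ff_const f)) in
  rop_coef (ff_prefactor f dlog) i (t *: Wser) 0
  = t *: (R_ i Wser - \sum_(k < r.-1) (vf i k * lmon 0 (ff_dh f k)) *: Wser).
Proof.
move=> ir t; rewrite /rop_coef.
have e j : nabla_coef (ff_prefactor f dlog) j (t *: Wser) 0
    = t *: (log_conn j Wser + (ff_dlog f j)`_0 *: Wser).
  rewrite /nabla_coef /ff_prefactor /log_conn par_der_const coefD scalerDl !scalerDr.
  by rewrite !scalerA ![t * _]mulrC addrAC addrA.
under eq_bigr => j _ do rewrite e scalerA mulrC -scalerA.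
rewrite -scaler_sumr linearZ /= [sigma i *: _]scalerA mulrC -scalerA -!scalerBr; congr (_ *: _).
under eq_bigr => j _ do rewrite scalerDr.
rewrite big_split /= opprD addrA; congr (_ - _).
  rewrite /gauge_defect /gauge_op /gauge_tau ir opprD addrA; congr (_ - _).
  by apply: eq_bigr => j _; rewrite gauge_uE.
rewrite (big_ord_pred (fun j => vf i j *: ((ff_dlog f j)`_0 *: Wser))) ff_dlog_top coef0.
rewrite scale0r scaler0 addr0; apply: eq_bigr => k _.
by rewrite ff_dlog_par coefC eqxx scalerA.
Qed.

(** Logarithms enter only through the parameter derivatives of nu log Lambda, which vanish with
    those of nu. *)
Lemma rop_coefS (f : formal_function R r) i (x : X) a : (forall k : 'I_r.-1, fder k nu = 0) ->
  rop_coef (ff_prefactor f dlog) i x a.+1 = 0.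
Proof.
move=> dnu; rewrite /rop_coef sub0r big1 ?oppr0 // => j _.
suff -> : nabla_coef (ff_prefactor f dlog) j x a.+1 = 0 by rewrite scaler0.
rewrite /nabla_coef add0r /ff_prefactor coefD; have jr := ltn_ord j.
have [jr'|rj] := ltnP j r.-1.
  rewrite (dlog_par (Ordinal jr')) (ff_dlog_par f (Ordinal jr')) coefC add0r.
  by case: a => [|a]; rewrite ?dnu ?lmon0 scale0r.
have -> : j = r.-1 :> nat by apply/eqP; rewrite eqn_leq rj -ltnS prednK ?jr // ltnW.
by rewrite dlog_top ff_dlog_top coef0 add0r scale0r.
Qed.

Definition annihilated (f : formal_function R r) : Prop := forall i : nat, (i <= r - 1)%N ->
  Rop h sigma L dM (ff_prefactor f dlog) i (ff_body f (power_series v)) = 0.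

Lemma annihilatedP (omega : 'I_r.-1 -> F) (f : formal_function R r) :
  (forall k : 'I_r.-1, fder k nu = 0) ->
  (forall i, (i < r)%N -> R_ i Wser = \sum_(k < r.-1) (vf i k * lmon 0 (omega k)) *: Wser) ->
  ff_nonzero f -> annihilated f <-> ff_dh f = omega.
Proof.
move=> dnu hom f0; split=> [hf|fE i ir].
  have t_neq0 : lmon 0 (baseF r (ff_const f)) != 0 :> LF.
    apply/eqP => t0; case/negP: f0; rewrite -(baseF_eq0 r); apply/eqP.
    by apply: (@lmon_inj F 0); rewrite t0 lmon0.
  (* The difference of the two forms, extended by zero in the Lambda direction so that nondegeneracy
     of the full matrix applies. *)
  pose y (j : nat) : LF := if insub j is Some k then lmon 0 (omega k - ff_dh f k) else 0.
  have y_par (k : 'I_r.-1) : y k = lmon 0 (omega k - ff_dh f k) by rewrite /y valK.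
  have y_top : y r.-1 = 0 by rewrite /y insubN // ltnn.
  have y0 (j : 'I_r) : y j = 0.
    apply: (@vf_coef_nondeg (fun j => y j)) => i ir; apply: Wser_free.
    rewrite (big_ord_pred (fun j => vf i j * y j)) y_top mulr0 addr0 scaler_suml.
    have ir' : (i <= r - 1)%N by lia.
    have e : rop_coef (ff_prefactor f dlog) i (lmon 0 (baseF r (ff_const f)) *: Wser) 0 = 0.
      apply: mlaurentP => n; rewrite -Rop_log_free // -ff_body_log_free.
      by rewrite (hf i ir').
    rewrite (rop_coef0 f ir) in e; rewrite -[RHS](mlaurent_torsion e t_neq0) hom // -sumrB.
    apply: eq_bigr => k _; rewrite -scalerBl -mulrBr y_par; congr (_ * _ *: _).
    by rewrite lmonD lmonN.
  apply/funext => k; have kr : (k < r)%N by apply: leq_trans (ltn_ord k) (leq_pred r).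
  have := y0 (Ordinal kr); rewrite /= y_par -(lmon0 F 0) => /lmon_inj/eqP.
  by rewrite subr_eq0 => /eqP.
have ir' : (i < r)%N by lia.
apply/funext => a; apply/funext => n; rewrite ff_body_log_free Rop_log_free //.
case: a => [|a]; last by rewrite rop_coefS.
by rewrite rop_coef0 // fE -hom // subrr scaler0.
Qed.

End Canonical.
End VectorFields.
End IrregularVector.

Lemma formal_function_eq (R : realType) (r : nat) (f f' : formal_function R r) :
  ff_const f = ff_const f' -> ff_dh f = ff_dh f' -> f = f'.
Proof.
case: f f' => [k dh p q] [k' dh' p' q'] /= kk dd; case: _ / kk; case: _ / dd p' q' => p' q'.
by congr FormalFunction; exact: Prop_irrelevance.
Qed.

Theorem theorem4p6 (R : realType) (r : nat) (hr : (2 <= r)%N)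
    (M : lmodType (paramField R r)) (L : int -> {linear M -> M}) (v0 : M)
    (hM : irregular_verma L v0)
    (dM : 'I_r.-1 -> M -> M) (hdM : parameter_derivations L v0 dM)
    (h : nat -> nat -> laurent (paramField R r)) (hh : vf_equations h)
    (sigma : nat -> laurent (paramField R r)) (hsigma : Lstar_gauge h sigma)
    (nu : paramField R r) (g : nat -> paramField R r) (v : nat -> M)
    (hW : canonical_vector h L v0 dM nu g v) :
  let W := power_series v in
  let dlogP := dlog_prefactor nu g in
  let annihilated (f : formal_function R r) := forall i : nat, (i <= r - 1)%N ->
    Rop h sigma L dM (ff_prefactor f dlogP) i (ff_body f W) = 0 in
  exists f : formal_function R r,
    [/\ ff_nonzero f,
        annihilated f,
        forall i : nat, (i <= r - 1)%N ->
          Lact L i%:Z (ff_body f W)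
          = calL h sigma dM (ff_prefactor f dlogP) i (ff_body f W)
      & forall f' : formal_function R r, ff_nonzero f' ->
          (annihilated f' <->
           exists k : baseField R, k != 0 /\ f' = ff_scale k f)].
Proof.
have [omega [oB oC dnu hom]] := connection_form hr hM hdM hh hsigma hW.
move=> W dlogP annih.
have annihP f : ff_nonzero f -> annih f <-> ff_dh f = omega.
  exact: (annihilatedP hr hM hh hW dnu hom).
pose f := FormalFunction (1 : baseField R) oB oC.
have f0 : ff_nonzero f by exact: oner_neq0.
have fA : annih f by apply/(annihP f f0).
exists f; split=> // [i ir|f' f'0].
  by apply/eqP; rewrite -subr_eq0; apply/eqP; exact: fA.
rewrite annihP //; split=> [fE|[k [k0 ->]] //].
(* Both functions have the form [omega], hence the same exponential part; as f has constant 1, the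
   ratio is the constant of f'. *)
exists (ff_const f'); split=> //.
by apply: formal_function_eq => //=; rewrite mulr1.
Qed.
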